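(* For any fixed constant $\alpha>0$, if $p=p(n)$ satisfies $\frac{\alpha}{n}<p<\frac12$ and $d = d(n) = \widetilde{\Omega}(p^2n^3)$, then $$\lim_{n\to\infty}\mathrm{d}_{\mathrm{TV}}\left(\mathsf{Geo}_d(n,p),\,\mathsf{G}(n,p)\right)=0 .$$
   Context: $\mathsf{G}(n,p)$ is the Erdős–Rényi random graph on vertex set $[n]$: each pair is an edge independently with probability $p$. $\mathsf{Geo}_d(n,p)$ is the random geometric graph on vertex set $[n]$: sample $v_1,\dots,v_n$ independently and uniformly from the unit sphere $\mathbb{S}^{d-1}\subset\mathbb{R}^d$, and join $i\ne j$ by an edge iff $\langle v_i,v_j\rangle \ge \tau(p)$, where $\tau(p)$ (depending on $p,d$) is the threshold with $\Pr[\langle v_i,v_j\rangle\ge\tau(p)]=p$. $\mathrm{d}_{\mathrm{TV}}$ is total variation distance. The notation $\widetilde\Omega$ hides factors polylogarithmic in $n$: the hypothesis on $d$ means that $d\ge p^2n^3\cdot C\log^{C} n$ for a suitable sufficiently large constant $C$ (i.e. the theorem asserts that such a $C$, possibly depending on $\alpha$, exists). *)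

(* Defs.v *)
From HB Require Import structures.
From mathcomp Require Import all_boot all_order all_algebra.
From mathcomp Require Import all_classical all_reals all_analysis.
From mathcomp Require Import measurable_realfun.
Import Order.TTheory GRing.Theory Num.Theory.
Import numFieldNormedType.Exports.

Set Implicit Arguments.
Unset Strict Implicit.
Unset Printing Implicit Defensive.

Local Open Scope classical_set_scope.
Local Open Scope ring_scope.

Definition cons_pair (T : Type) (n : nat) (x : T * n.-tuple T) :
  n.+1.-tuple T := [tuple of x.1 :: x.2].

Lemma measurable_cons_pair d (T : measurableType d) (n : nat) :
  measurable_fun setT (@cons_pair T n).
Proof. exact: measurable_cons. Qed.

HB.instance Definition _ d (T : measurableType d) (n : nat) :=
  isMeasurableFun.Build _ _ _ _ (@cons_pair T n) (@measurable_cons_pair d T n).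

Section cons_measure.
Local Open Scope ereal_scope.
Context d (T : measurableType d) (R : realType) (n : nat).
Variables (mu : {sigma_finite_measure set T -> \bar R})
  (nu : {sigma_finite_measure set (n.-tuple T) -> \bar R}).

Definition cons_measure : set (n.+1.-tuple T) -> \bar R :=
  pushforward (mu \x nu) (@cons_pair T n).

HB.instance Definition _ := Measure.copy cons_measure
  (measure_function_pushforward__canonical__measure_function_Measure
    (mu \x nu) (@measurable_cons_pair d T n)).

Lemma cons_measure_sigma_finite : sigma_finite setT cons_measure.
Proof.
have [F FT Ffin] : sigma_finite [set: T * n.-tuple T] (mu \x nu).
  have /sigma_finiteP[F [FT ndF Foo]] := sigma_finiteT mu.
  have /sigma_finiteP[G [GT ndG Goo]] := sigma_finiteT nu.
  exists (fun k => F k `*` G k).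
    rewrite -setXTT FT GT predeqE => -[x y]; split.
      move=> [/= [i _ Fix] [j _ Gjy]]; exists (maxn i j) => //; split.
      - by move: x Fix; exact/subsetPset/ndF/leq_maxl.
      - by move: y Gjy; exact/subsetPset/ndG/leq_maxr.
    by move=> [k _ []/= ? ?]; split; exists k.
  move=> k; have [? ?] := Foo k; have [? ?] := Goo k.
  split; first exact: measurableX.
  by rewrite product_measure1E// lte_mul_pinfty// ge0_fin_numE.
pose g (t : n.+1.-tuple T) := (thead t, [tuple of behead t]).
have gK : cancel (@cons_pair T n) g.
  by move=> [x t]; congr pair; apply: val_inj.
have mg : measurable_fun setT g.
  apply/measurable_fun_pairP; split; first exact: measurable_tnth.
  exact: measurable_behead.
exists (fun k => g @^-1` F k).
  by rewrite -preimage_bigcup -FT preimage_setT.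
move=> k; have [mF muF] := Ffin k; split.
  by rewrite -[X in measurable X]setTI; exact: mg.
rewrite /cons_measure /pushforward -comp_preimage (_ : _ \o _ = id)//.
exact/funext.
Qed.

HB.instance Definition _ := Measure_isSigmaFinite.Build _ _ _
  cons_measure cons_measure_sigma_finite.

End cons_measure.

(* The product measure mu^n on n.-tuple T. *)
Fixpoint power_measure d (T : measurableType d) (R : realType)
    (mu : {sigma_finite_measure set T -> \bar R}) (n : nat) :
    {sigma_finite_measure set (n.-tuple T) -> \bar R} :=
  match n with
  | 0 => \d_ [tuple]
  | n'.+1 => cons_measure mu (power_measure mu n')
  end.

(* R^d, with the product of d copies of the Borel sigma-algebra of R. *)
Notation vec R d := (d.-tuple (measurableTypeR R)).

Definition dotp (R : realType) (d : nat) (x y : vec R d) : R :=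
  \sum_(k < d) tnth x k * tnth y k.

Definition enorm (R : realType) (d : nat) (x : vec R d) : R :=
  Num.sqrt (dotp x x).

Definition unit_vec (R : realType) (d : nat) (x : vec R d) : vec R d :=
  [tuple tnth x k / enorm x | k < d].

Definition lebesgue_power (R : realType) (d : nat) :
    {sigma_finite_measure set (vec R d) -> \bar R} :=
  power_measure (@lebesgue_measure R) d.

Definition punctured_ball (R : realType) (d : nat) : set (vec R d) :=
  [set x | 0 < enorm x <= 1].

Lemma measurable_dotp_diag (R : realType) (d : nat) :
  measurable_fun setT (fun x : vec R d => dotp x x : R).
Proof.
apply: measurable_sum => k; apply: measurable_funM; exact: measurable_tnth.
Qed.

Lemma measurable_enorm (R : realType) (d : nat) :
  measurable_fun setT (fun x : vec R d => enorm x : R).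
Proof.
rewrite (_ : (fun x => _) = (@powR R ^~ 2^-1) \o (fun x : vec R d => dotp x x)).
  by apply: measurableT_comp; [exact: measurable_powR|exact: measurable_dotp_diag].
apply/funext => x /=; rewrite powR12_sqrt// sumr_ge0// => k _.
by rewrite -expr2 sqr_ge0.
Qed.

Lemma measurable_unit_vec (R : realType) (d : nat) :
  measurable_fun setT (@unit_vec R d).
Proof.
apply/measurable_fun_tnthP => k.
rewrite (_ : _ \o _ =
  (fun x => (tnth x k : R) * (@powR R ^~ (-1) \o @enorm R d) x)).
  apply: (@measurable_funM _ _ R); first exact: measurable_tnth.
  by apply: measurableT_comp; [exact: measurable_powR|exact: measurable_enorm].
by apply/funext => x /=; rewrite tnth_mktuple powR_inv1// sqrtr_ge0.
Qed.

HB.instance Definition _ (R : realType) (d : nat) :=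
  isMeasurableFun.Build _ _ _ _ (@unit_vec R d) (@measurable_unit_vec R d).

Lemma measurable_punctured_ball (R : realType) (d : nat) :
  measurable (@punctured_ball R d).
Proof.
rewrite (_ : @punctured_ball R d = @enorm R d @^-1` [set` `]0, 1]]).
  by rewrite -[X in measurable X]setTI; apply: measurable_enorm => //;
    exact: (@measurable_itv R).
by apply/seteqP; split => x /=; rewrite in_itv.
Qed.

(* The surface measure of the unit sphere, up to a constant factor: the mass of
   A is the Lebesgue measure of the cone {t *: u | u in A, 0 < t <= 1}. *)
Definition cone_measure (R : realType) (d : nat) : set (vec R d) -> \bar R :=
  pushforward (mrestr (lebesgue_power R d) (@measurable_punctured_ball R d))
    (@unit_vec R d).

HB.instance Definition _ (R : realType) (d : nat) :=
  Measure.copy (@cone_measure R d)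
    (measure_function_pushforward__canonical__measure_function_Measure
      (mrestr (lebesgue_power R d) (@measurable_punctured_ball R d))
      (@measurable_unit_vec R d)).

(* The normalized surface measure, carried by the sphere. The second argument
   of mnormalize is a default that is used only when d = 0, since the unit ball
   of R^d has positive finite Lebesgue measure when d > 0. *)
Definition sphere_unif (R : realType) (d : nat) : probability (vec R d) R :=
  mnormalize (@cone_measure R d) (\d_ ([tuple 0 | _ < d] : vec R d)).

(* tau(p): the value with Pr[<v, w> >= tau(p)] = p for independent uniform v, w
   on the sphere. It exists and is unique when d >= 2 and 0 < p < 1; it is 0
   where no such value exists. *)
Definition tau (R : realType) (d : nat) (p : R) : R :=
  xget 0 [set t : R | ((sphere_unif R d \x sphere_unif R d)
    [set x : vec R d * vec R d | (t <= dotp x.1 x.2)%R] = p%:E)%E].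

(* A graph on the vertex set 'I_n is its set of edges. *)
Definition vpair (n : nat) := {e : {set 'I_n} | #|e| == 2}.

Definition graph (n : nat) := {set vpair n}.

Definition geo_graph (R : realType) (d n : nat) (t : R)
    (v : n.-tuple (vec R d)) : graph n :=
  finset (fun e : vpair n =>
    [forall i in val e, forall j in val e,
      (i != j) ==> (t <= dotp (tnth v i) (tnth v j))]).

(* The laws of the random graphs, as functions of events A : {set graph n}. *)
Definition Geo (R : realType) (d n : nat) (p : R) (A : {set graph n}) : R :=
  fine (power_measure (sphere_unif R d) n
    [set v | geo_graph (tau d p) v \in A]).

Definition ER (R : realType) (n : nat) (p : R) (A : {set graph n}) : R :=
  \sum_(G in A) \prod_(e : vpair n) (if e \in G then p else 1 - p).

Definition dTV (R : realType) (T : finType) (P Q : {set T} -> R) : R :=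
  \big[Num.max/0]_(A : {set T}) `|P A - Q A|.

(* Main.v *)
(** Condition on the latent vectors: the row joining vertex k + 1 to the first k
    vertices then has, given their positions, a law r(S), and by Cauchy-Schwarz
    the divergence of Geo from G(n, p) grows at each new vertex by at most the
    mean of the chi-squared divergence of r from the product Bernoulli law. Two
    independent rows with a common latent point decouple, so that this mean is
    E[(1 + gamma(w, w'))^k] - 1, where w, w' are uniform on the sphere and
    gamma = (q - p^2) / (p (1 - p)), with q the measure of the intersection of
    the caps of measure p centred at w and w'. Since E gamma = 0, only
    k^2 E gamma^2 matters. Slicing the sphere along w exhibits q as a mean of
    cap measures one dimension lower; a log-Lipschitz estimate for cap measures
    bounds |gamma| by a multiple of p (M |<w, w'>| + M^2 / d), up to an
    exponentially small term in M = O(log n). As E <w, w'>^2 = 1 / d, the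
    divergence is O(n^3 p^2 polylog(n) / d), and it dominates the squared total
    variation distance. *)
Require Import Defs.
From mathcomp Require Import all_boot all_order all_algebra.
From mathcomp Require Import all_classical all_reals all_analysis.
From mathcomp Require Import measurable_realfun ring lra.
Import Order.TTheory GRing.Theory Num.Theory.
Import numFieldNormedType.Exports.

Set Implicit Arguments.
Unset Strict Implicit.
Unset Printing Implicit Defensive.

Local Open Scope classical_set_scope.
Local Open Scope ring_scope.

(** * Integration over product measures *)

(** The obstacle is that the power (1 + gamma)^k is not governed by its second-order expansion
    everywhere: gamma reaches 1 when w = w', and the power is then 2^k. The expansion is therefore
    used only for |<w, w'>| <= e with e^2 = 8 n / d; outside, the trivial bound 2^n meets a
    probability of order exp (- 4 n). This requires d to exceed a large multiple of n, which p >
    alpha / n provides, since then p^2 n^3 >= alpha^2 n. Inside, n |gamma| <= 1 is required, and n p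
    M e is small because (n p M e)^2 is of order n^3 p^2 M^2 / d. Relative entropy is the quantity
    summed over vertices because it obeys a chain rule; the chi-squared divergence only bounds each
    increment. Points of the sphere are described by slopes x / |y| instead of angles. The density
    of the slope is explicit up to a constant K, which cancels when two cap measures are compared.
    In the same spirit, the estimate of gamma never locates the conditional cap measure: it uses
    only that its oscillation is small and that its mean is p. *)

Section power.
Local Open Scope ereal_scope.
Context d (T : measurableType d) (R : realType).

Lemma integral_power_measureS (mu : {sigma_finite_measure set T -> \bar R}) n
    (f : n.+1.-tuple T -> \bar R) :
  measurable_fun setT f -> (forall x, 0 <= f x) ->
  \int[power_measure mu n.+1]_x f x =
  \int[mu]_x \int[power_measure mu n]_v f (cons_pair (x, v)).
Proof.
move=> mf f0.
transitivity (\int[mu \x power_measure mu n]_z (f \o @cons_pair T n) z).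
  rewrite -(@ge0_integral_pushforward _ _ _ _ _ _ (@measurable_cons_pair d T n) _ setT)//.
rewrite (fubini_tonelli1 (f \o @cons_pair T n))//; last first. 
  by move=> z; exact: f0.
exact: (measurableT_comp mf (@measurable_cons_pair d T n)).
Qed.

Lemma integral_power_measureS2 (mu : {sigma_finite_measure set T -> \bar R}) n
    (f : n.+1.-tuple T -> \bar R) :
  measurable_fun setT f -> (forall x, 0 <= f x) ->
  \int[power_measure mu n.+1]_x f x =
  \int[power_measure mu n]_v \int[mu]_x f (cons_pair (x, v)).
Proof.
move=> mf f0; rewrite integral_power_measureS//.
apply: (fubini_tonelli (f \o @cons_pair T n)) => //; last first.

  by move=> z; exact: f0.
exact: (measurableT_comp mf (@measurable_cons_pair d T n)).
Qed.

Lemma integral_power_measure0 (mu : {sigma_finite_measure set T -> \bar R})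
    (f : 0.-tuple T -> \bar R) :
  measurable_fun setT f ->
  \int[power_measure mu 0]_x f x = f [tuple].
Proof. by move=> mf; rewrite integral_dirac// diracT mul1e. Qed.

End power.

Section coord_map.
Local Open Scope ereal_scope.
Context d (T : measurableType d) (R : realType).

Definition coord_map n (phi : 'I_n -> T -> T) (v : n.-tuple T) : n.-tuple T :=
  [tuple phi k (tnth v k) | k < n].

Lemma measurable_coord_map n (phi : 'I_n -> T -> T) :
  (forall k, measurable_fun setT (phi k)) -> measurable_fun setT (coord_map phi).
Proof.
move=> mphi; apply/measurable_fun_tnthP => k.
rewrite (_ : _ \o _ = phi k \o (fun v => tnth v k)).
  by apply: measurableT_comp => //; exact: measurable_tnth.
by apply/funext => v /=; rewrite tnth_mktuple.
Qed.

Lemma coord_map_cons n (phi : 'I_n.+1 -> T -> T) x v :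
  coord_map phi (cons_pair (x, v)) =
  cons_pair (phi ord0 x, coord_map (fun k => phi (lift ord0 k)) v).
Proof.
apply: eq_from_tnth => k; rewrite tnth_mktuple.
case: (unliftP ord0 k) => [j ->|->]; last by rewrite !(tnth_nth x).
by rewrite !tnthS tnth_mktuple.
Qed.

Lemma measurable_cons_fst n (x : T) :
  measurable_fun setT (fun v : n.-tuple T => cons_pair (x, v)).
Proof. by apply: measurable_cons => //; exact: measurable_id. Qed.

Lemma measurable_cons_snd n (v : n.-tuple T) :
  measurable_fun setT (fun x => cons_pair (x, v)).
Proof. by apply: measurable_cons => //; exact: measurable_id. Qed.

Lemma measurable_integral_cons n (mu : {sigma_finite_measure set T -> \bar R})
    (f : n.+1.-tuple T -> \bar R) :
  measurable_fun setT f -> (forall v, 0 <= f v) ->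
  measurable_fun setT (fun x => \int[power_measure mu n]_v f (cons_pair (x, v))).
Proof.
move=> mf f0.
apply: (@measurable_fun_fubini_tonelli_F _ _ _ _ _ (power_measure mu n) (f \o @cons_pair T n)) => //.
  exact: (measurableT_comp mf (@measurable_cons_pair d T n)).
by move=> z; exact: f0.
Qed.

(** Translations, dilations and the negation of R^d are all instances. The induction runs over
    families [phi], since peeling off the first coordinate leaves the shifted family
    [fun k => phi (lift ord0 k)]. *)
Lemma integral_coord_map n (mu : {sigma_finite_measure set T -> \bar R}) (a : R)
    (phi : 'I_n -> T -> T) (f : n.-tuple T -> \bar R) : (0 <= a)%R ->
  (forall k, measurable_fun setT (phi k)) ->
  (forall k g, measurable_fun setT g -> (forall x, 0 <= g x) ->
    \int[mu]_x g (phi k x) = a%:E * \int[mu]_x g x) ->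
  measurable_fun setT f -> (forall x, 0 <= f x) ->
  \int[power_measure mu n]_v f (coord_map phi v) =
    (a ^+ n)%:E * \int[power_measure mu n]_v f v.
Proof.
move=> a0; elim: n phi f => [|n IH] phi f mphi hphi mf f0.
  rewrite !integral_power_measure0 ?mul1e//; last first.
    by apply: measurableT_comp => //; exact: measurable_coord_map.
  by rewrite (tuple0 (coord_map _ _)).
have mfp : measurable_fun setT (f \o coord_map phi).
  by apply: measurableT_comp => //; exact: measurable_coord_map.
rewrite (integral_power_measureS mu mfp)//; last by move=> x; exact: f0.
rewrite integral_power_measureS//.
pose g x := \int[power_measure mu n]_v f (cons_pair (x, v)).
have mg : measurable_fun setT g by exact: measurable_integral_cons.
have g0 x : 0 <= g x by apply: integral_ge0.
transitivity (\int[mu]_x ((a ^+ n)%:E * g (phi ord0 x))).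
  apply: eq_integral => x _ /=; rewrite -[RHS](IH (fun k => phi (lift ord0 k)) (fun v => f (cons_pair (phi ord0 x, v))))//.
  - by apply: eq_integral => v _; rewrite coord_map_cons.
  - by move=> k h; exact: hphi.
  - by apply: (measurableT_comp mf); exact: measurable_cons_fst.
rewrite ge0_integralZl_EFin//; last 2 first.
- by apply: (measurableT_comp mg); exact: mphi.
- by rewrite exprn_ge0.
by rewrite hphi// muleA -EFinM -exprSr.
Qed.

End coord_map.

Section scale_measure.
Local Open Scope ereal_scope.
Context d (T : measurableType d) (R : realType).

Lemma integral_pushforward_scale (mu : {measure set T -> \bar R}) (phi : T -> T) (a : R)
    (f : T -> \bar R) : (0 <= a)%R ->
  measurable_fun setT phi ->
  (forall A, measurable A -> pushforward mu phi A = a%:E * mu A) ->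
  measurable_fun setT f -> (forall x, 0 <= f x) ->
  \int[mu]_x f (phi x) = a%:E * \int[mu]_x f x.
Proof.
move=> a0 mphi h mf f0.
rewrite -[LHS](@ge0_integral_pushforward _ _ _ _ _ _ mphi mu setT f)//.
rewrite -[RHS](@ge0_integral_mscale _ _ _ mu setT measurableT (NngNum a0) f)//.
by apply: eq_measure_integral => A mA _; exact: h.
Qed.

End scale_measure.

Section lebesgue1.
Local Open Scope ereal_scope.
Context (R : realType).
Local Notation mu := (@lebesgue_measure R).

Lemma measurable_shift1 (a : R) :
  measurable_fun setT (fun x : measurableTypeR R => x + a : measurableTypeR R)%R.
Proof. exact: (@measurable_funD _ _ R). Qed.

Lemma measurable_scale1 (a : R) :
  measurable_fun setT (fun x : measurableTypeR R => a * x : measurableTypeR R)%R.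
Proof. exact: (@measurable_funM _ _ R). Qed.

Lemma integral_shift1 (a : R) (f : measurableTypeR R -> \bar R) :
  measurable_fun setT f -> (forall x, 0 <= f x) ->
  \int[mu]_x f (x + a)%R = \int[mu]_x f x.
Proof.
move=> mf f0; rewrite -[RHS]mul1e.
apply: (@integral_pushforward_scale _ _ _ mu (fun x => x + a)%R) => //.
  exact: measurable_shift1.
move=> A mA; rewrite mul1e; apply/esym.
pose m : {measure set (measurableTypeR R) -> \bar R} := measure_function_pushforward__canonical__measure_function_Measure mu (measurable_shift1 a).
apply: (@lebesgue_measure_unique R m) => //= _ [[x y]] _ <-.
rewrite /m/=.
rewrite /pushforward (_ : _ @^-1` _ = `](x - a)%R, (y - a)%R]%classic).
  by rewrite !lebesgue_measure_itv/= !lte_fin ltrD2r -!EFinB opprB addrA subrK.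
by apply/seteqP; split => z /=; rewrite !in_itv/= ltrBlDr lerBrDr.
Qed.

Lemma integral_scale1 (a : R) (f : measurableTypeR R -> \bar R) : (0 < a)%R ->
  measurable_fun setT f -> (forall x, 0 <= f x) ->
  \int[mu]_x f (a * x)%R = a^-1%:E * \int[mu]_x f x.
Proof.
move=> a0 mf f0.
apply: (@integral_pushforward_scale _ _ _ mu (fun x => a * x)%R) => //.
- by rewrite invr_ge0 ltW.
- exact: measurable_scale1.
move=> A mA.
pose m : {measure set (measurableTypeR R) -> \bar R} := measure_function_pushforward__canonical__measure_function_Measure mu (measurable_scale1 a).
have e : forall A, measurable A -> mu A = mscale (NngNum (ltW a0)) m A.
  apply: (@lebesgue_measure_unique R (mscale (NngNum (ltW a0)) m)) => //= _ [[x y]] _ <-.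
  rewrite /mscale/= /pushforward (_ : _ @^-1` _ = `](a^-1 * x)%R, (a^-1 * y)%R]%classic).
    rewrite !lebesgue_measure_itv/= !lte_fin ltr_pM2l ?invr_gt0//.
    by case: ifPn => xy; rewrite ?mule0// -!EFinB -EFinM -mulrBr mulrA divff ?gt_eqF// mul1r.
  by apply/seteqP; split => z /=; rewrite !in_itv/= ![(a^-1 * _)%R]mulrC ltr_pdivrMr// ler_pdivlMr// ![(z * _)%R]mulrC.
transitivity (a^-1%:E * mscale (NngNum (ltW a0)) m A); last by congr (_ * _); exact/esym/e.
by rewrite /mscale muleA -EFinM mulVf ?gt_eqF// mul1e.
Qed.

Lemma integral_opp1 (f : measurableTypeR R -> \bar R) :
  measurable_fun setT f -> (forall x, 0 <= f x) ->
  \int[mu]_x f (- x)%R = \int[mu]_x f x.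
Proof.
move=> mf f0; rewrite -[RHS]mul1e.
apply: (@integral_pushforward_scale _ _ _ mu (-%R)) => //.
by move=> A mA; rewrite mul1e; exact: lebesgue_measureN.
Qed.

End lebesgue1.

Section vectors.
Context (R : realType).

Definition vadd d (x y : vec R d) : vec R d := [tuple tnth x k + tnth y k | k < d].
Definition vscale d (c : R) (x : vec R d) : vec R d := [tuple c * tnth x k | k < d].

Lemma dotpC d (x y : vec R d) : dotp x y = dotp y x.
Proof. by apply: eq_bigr => k _; rewrite mulrC. Qed.

Lemma dotpDl d (x y z : vec R d) : dotp (vadd x y) z = dotp x z + dotp y z.
Proof. by rewrite -big_split; apply: eq_bigr => k _; rewrite tnth_mktuple mulrDl. Qed.

Lemma dotpZl d c (x y : vec R d) : dotp (vscale c x) y = c * dotp x y.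
Proof. by rewrite mulr_sumr; apply: eq_bigr => k _; rewrite tnth_mktuple mulrA. Qed.

Lemma dotpDr d (x y z : vec R d) : dotp z (vadd x y) = dotp z x + dotp z y.
Proof. by rewrite dotpC dotpDl !(dotpC z). Qed.

Lemma dotpZr d c (x y : vec R d) : dotp y (vscale c x) = c * dotp y x.
Proof. by rewrite dotpC dotpZl dotpC. Qed.

Lemma dotp_cons d (a b : R) (x y : vec R d) :
  dotp (cons_pair (a : measurableTypeR R, x)) (cons_pair (b : measurableTypeR R, y)) = a * b + dotp x y.
Proof.
rewrite /dotp big_ord_recl; congr (_ + _); apply: eq_bigr => k _.
by rewrite !tnthS.
Qed.

Lemma vaddC d (x y : vec R d) : vadd x y = vadd y x.
Proof. by apply: eq_from_tnth => k; rewrite !tnth_mktuple addrC. Qed.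

Lemma vscale1 d (x : vec R d) : vscale 1 x = x.
Proof. by apply: eq_from_tnth => k; rewrite !tnth_mktuple mul1r. Qed.

Lemma vscaleA d a b (x : vec R d) : vscale a (vscale b x) = vscale (a * b) x.
Proof. by apply: eq_from_tnth => k; rewrite !tnth_mktuple mulrA. Qed.

Lemma vscale_cons d c (a : R) (x : vec R d) :
  vscale c (cons_pair (a : measurableTypeR R, x)) = cons_pair ((c * a : R) : measurableTypeR R, vscale c x).
Proof.
apply: eq_from_tnth => k; rewrite tnth_mktuple.
case: (unliftP ord0 k) => [j ->|->]; last by rewrite !(tnth_nth (0 : measurableTypeR R)).
by rewrite !tnthS tnth_mktuple.
Qed.

Lemma dotp_ge0 d (x : vec R d) : 0 <= dotp x x.
Proof. by apply: sumr_ge0 => k _; rewrite -expr2 sqr_ge0. Qed.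

Lemma enorm_ge0 d (x : vec R d) : 0 <= enorm x.
Proof. exact: sqrtr_ge0. Qed.

Lemma sqr_enorm d (x : vec R d) : enorm x ^+ 2 = dotp x x.
Proof. by rewrite sqr_sqrtr// dotp_ge0. Qed.

Lemma enormZ d c (x : vec R d) : 0 <= c -> enorm (vscale c x) = c * enorm x.
Proof.
move=> c0; rewrite /enorm dotpZl dotpZr mulrA sqrtrM ?mulr_ge0//.
by rewrite -expr2 sqrtr_sqr ger0_norm.
Qed.

Lemma unit_vecE d (x : vec R d) : unit_vec x = vscale (enorm x)^-1 x.
Proof. by apply: eq_from_tnth => k; rewrite !tnth_mktuple mulrC. Qed.

Lemma enorm_unit d (x : vec R d) : 0 < enorm x -> dotp (unit_vec x) (unit_vec x) = 1.
Proof.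
move=> x0; rewrite unit_vecE dotpZl dotpZr -sqr_enorm expr2 mulrA.
by rewrite mulrA -mulrA mulrACA mulVf ?gt_eqF// mulr1.
Qed.

Lemma unit_vecZ d c (x : vec R d) : 0 < c -> unit_vec (vscale c x) = unit_vec x.
Proof.
move=> c0; rewrite !unit_vecE vscaleA enormZ ?ltW//.
by rewrite invfM mulrC mulrA divff ?gt_eqF// mul1r.
Qed.

Lemma dotp_le1 d (x y : vec R d) : dotp x x = 1 -> dotp y y = 1 -> `|dotp x y| <= 1.
Proof.
move=> x1 y1.
have := dotp_ge0 (vadd x y); rewrite !(dotpDl, dotpDr) x1 y1 (dotpC y x).
have := dotp_ge0 (vadd x (vscale (-1) y)).
rewrite !(dotpDl, dotpDr, dotpZl, dotpZr) x1 y1 (dotpC y x) ler_norml.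
by move=> *; apply/andP; split; lra.
Qed.

Lemma measurable_dotp_comp d' (T : measurableType d') d (f g : T -> vec R d) :
  measurable_fun setT f -> measurable_fun setT g ->
  measurable_fun setT (fun t => dotp (f t) (g t) : R).
Proof.
move=> mf mg; apply: measurable_sum => k; apply: measurable_funM.
- exact: (measurableT_comp (measurable_tnth k) mf).
- exact: (measurableT_comp (measurable_tnth k) mg).
Qed.

Lemma measurable_vadd_comp d' (T : measurableType d') d (f g : T -> vec R d) :
  measurable_fun setT f -> measurable_fun setT g ->
  measurable_fun setT (fun t => vadd (f t) (g t)).
Proof.
move=> mf mg; apply/measurable_fun_tnthP => k.
rewrite (_ : _ \o _ = (fun t => (tnth (f t) k : R) + tnth (g t) k)); last first.
  by apply/funext => t /=; rewrite tnth_mktuple.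
apply: (@measurable_funD _ _ R).
- exact: (measurableT_comp (measurable_tnth k) mf).
- exact: (measurableT_comp (measurable_tnth k) mg).
Qed.

Lemma measurable_vscale_comp d' (T : measurableType d') d (f : T -> R) (g : T -> vec R d) :
  measurable_fun setT f -> measurable_fun setT g ->
  measurable_fun setT (fun t => vscale (f t) (g t)).
Proof.
move=> mf mg; apply/measurable_fun_tnthP => k.
rewrite (_ : _ \o _ = (fun t => f t * (tnth (g t) k : R))); last first.
  by apply/funext => t /=; rewrite tnth_mktuple.
apply: (@measurable_funM _ _ R) => //.
exact: (measurableT_comp (measurable_tnth k) mg).
Qed.

End vectors.

Section invariance.
Local Open Scope ereal_scope.
Context (R : realType) (d : nat).
Local Notation lam := (lebesgue_power R d).
Implicit Type f : vec R d -> \bar R.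

Lemma integral_vadd a f : measurable_fun setT f -> (forall x, 0 <= f x) ->
  \int[lam]_x f (vadd x a) = \int[lam]_x f x.
Proof.
move=> mf f0.
transitivity ((1 ^+ d)%:E * \int[lam]_x f x); last by rewrite expr1n mul1e.
rewrite /lebesgue_power; apply: (@integral_coord_map _ _ R d (@lebesgue_measure R) 1 (fun k x => x + tnth a k : measurableTypeR R)%R f) => //.
- by move=> k; exact: measurable_shift1.
- by move=> k g mg g0; rewrite mul1e integral_shift1.
Qed.

Lemma integral_vscale (c : R) f : (0 < c)%R -> measurable_fun setT f -> (forall x, 0 <= f x) ->
  \int[lam]_x f (vscale c x) = ((c^-1) ^+ d)%:E * \int[lam]_x f x.
Proof.
move=> c0 mf f0.
rewrite /lebesgue_power; apply: (@integral_coord_map _ _ R d (@lebesgue_measure R) c^-1 (fun k x => c * x : measurableTypeR R)%R f) => //.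
- by rewrite invr_ge0 ltW.
- by move=> k; exact: measurable_scale1.
- by move=> k g mg g0; exact: integral_scale1.
Qed.

Lemma integral_vopp f : measurable_fun setT f -> (forall x, 0 <= f x) ->
  \int[lam]_x f (vscale (-1) x) = \int[lam]_x f x.
Proof.
move=> mf f0.
transitivity ((1 ^+ d)%:E * \int[lam]_x f x); last by rewrite expr1n mul1e.
rewrite /lebesgue_power; apply: (@integral_coord_map _ _ R d (@lebesgue_measure R) 1 (fun k x => -1 * x : measurableTypeR R)%R f) => //.
- by move=> k; exact: measurable_scale1.
- move=> k g mg g0; rewrite mul1e -[RHS]integral_opp1//.
  by apply: eq_integral => x _; rewrite mulN1r.
Qed.

End invariance.

Section product.
Local Open Scope ereal_scope.
Context d (T : measurableType d) (R : realType).

Lemma measurable_prod_tnth n (h : T -> R) : measurable_fun setT h ->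
  measurable_fun setT (fun v : n.-tuple T => \prod_(k < n) h (tnth v k) : R)%R.
Proof.
move=> mh; apply: measurable_prod => k _.
by apply: (measurableT_comp mh); exact: measurable_tnth.
Qed.

Lemma integral_prod_tnth (mu : {sigma_finite_measure set T -> \bar R}) n (h : T -> R) :
  measurable_fun setT h -> (forall x, 0 <= h x)%R ->
  \int[power_measure mu n]_v (\prod_(k < n) h (tnth v k))%:E = (\int[mu]_x (h x)%:E) ^+ n.
Proof.
move=> mh h0.
have mp k : measurable_fun setT (fun v : k.-tuple T => (\prod_(i < k) h (tnth v i))%:E).
  by apply/measurable_EFinP; exact: measurable_prod_tnth.
elim: n => [|n IH].
  by rewrite integral_power_measure0 ?big_ord0 ?expe0//; exact: mp.
rewrite integral_power_measureS//; last by move=> v; rewrite lee_fin prodr_ge0.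
transitivity (\int[mu]_x ((h x)%:E * (\int[mu]_x (h x)%:E) ^+ n)).
  apply: eq_integral => x _; rewrite -IH -ge0_integralZl_EFin//; last 2 first.
  - by move=> v _; rewrite lee_fin prodr_ge0.
  - exact: mp.
  apply: eq_integral => v _; rewrite big_ord_recl EFinM; congr (_ * _%:E).
  by apply: eq_bigr => k _; rewrite tnthS.
rewrite expeS ge0_integralZr//.
- by apply/measurable_EFinP.
- by move=> x _; rewrite lee_fin.
- by apply: expe_ge0; apply: integral_ge0 => x _; rewrite lee_fin.
Qed.

End product.

(** * Lebesgue measure on R^d and the unit ball *)

Section punctured.
Local Open Scope ereal_scope.
Context (R : realType) (d : nat).
Local Notation lam := (lebesgue_power R d).

Lemma measurable_box (a b : R) :
  measurable [set x : vec R d | forall k, (a < tnth x k <= b)%R].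
Proof.
rewrite (_ : [set x | _] = \bigcap_(k in [set: 'I_d]) ((fun x : vec R d => tnth x k) @^-1` `]a, b]%classic)).
  apply: fin_bigcap_measurable => // k _; rewrite -[X in measurable X]setTI.
  by apply: measurable_tnth => //; exact: measurable_itv.
apply/seteqP; split => x /=.
  by move=> h k _ /=; rewrite in_itv/=; exact: h.
by move=> h k; have := h k I; rewrite /= in_itv.
Qed.

Lemma box_measure (a b : R) : (a <= b)%R ->
  lam [set x | forall k, (a < tnth x k <= b)%R] = ((b - a) ^+ d)%:E.
Proof.
move=> ab.
have mI : measurable (`]a, b]%classic : set (measurableTypeR R)) by exact: measurable_itv.
have e : \int[@lebesgue_measure R]_x (\1_(`]a, b]%classic : set (measurableTypeR R)) x)%:E = (b - a)%:E.
  rewrite integral_indic// setIT; etransitivity; first exact: lebesgue_measure_itv.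
  rewrite /= lte_fin; case: ifPn => //; rewrite -leNgt => ba.
  have -> : b = a by apply/eqP; rewrite eq_le ab ba.
  by rewrite subrr.
rewrite EFin_expe -e -(@integral_prod_tnth _ _ R (@lebesgue_measure R) d)//.
set B := [set x | _].
rewrite -(setIT B) -integral_indic//; last exact: measurable_box.
apply: eq_integral => x _; congr (_%:E).
rewrite indicE; have [xB|xB] := boolP (x \in B).
  rewrite big1// => k _; rewrite indicE mem_set//= in_itv/=.
  by move: xB; rewrite inE; exact.
move: xB; rewrite notin_setE => /existsNP[k hk].
rewrite (bigD1 k)//= indicE memNset ?mul0r//= in_itv/=; exact: hk.
Qed.

Lemma coord_le_enorm (x : vec R d) k : (`|tnth x k| <= enorm x)%R.
Proof.
rewrite -sqrtr_sqr ler_wsqrtr// /dotp (bigD1 k)//= -expr2 lerDl.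
by apply: sumr_ge0 => j _; rewrite -expr2 sqr_ge0.
Qed.

Lemma punctured_ball_lty : lam (@punctured_ball R d) < +oo.
Proof.
(* The sides of a box are open on the left, so a box starting at -1 would miss points of the ball
   with a coordinate equal to -1. *)
apply: (@le_lt_trans _ _ (lam [set x | forall k, (-2 < tnth x k <= 1)%R])); last first.
  by rewrite box_measure ?ltry//; lra.
apply: le_measure; rewrite ?inE; [exact: measurable_punctured_ball| |].
  exact: measurable_box.
move=> x /= /andP[_ x1] k; have := le_trans (coord_le_enorm x k) x1.
by rewrite ler_norml => /andP[h1 h2]; apply/andP; split => //; lra.
Qed.

Lemma punctured_ball_gt0 : (0 < d)%N -> 0 < lam (@punctured_ball R d).
Proof.
move=> d0; apply: (@lt_le_trans _ _ (lam [set x | forall k, (0 < tnth x k <= d%:R^-1)%R])).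
  by rewrite box_measure ?invr_ge0// lte_fin exprn_gt0// subr0 invr_gt0 ltr0n.
apply: le_measure; rewrite ?inE; [|exact: measurable_punctured_ball|].
  exact: measurable_box.
move=> x /= h; apply/andP; split.
  have := coord_le_enorm x (Ordinal d0); apply: lt_le_trans.
  by have /andP[h1 _] := h (Ordinal d0); rewrite gtr0_norm.
rewrite -(@ler_pXn2r _ 2)// ?nnegrE ?enorm_ge0// expr1n sqr_enorm.
apply: (@le_trans _ _ (\sum_(k < d) d%:R^-1)%R); last first.
  by rewrite sumr_const card_ord -(mulr_natl (d%:R^-1)) divff// pnatr_eq0 -lt0n.
apply: ler_sum => k _; have /andP[h1 h2] := h k.
rewrite -[leRHS]mulr1 ler_pM ?(ltW h1)// (le_trans h2)// invf_le1 ?ltr0n// ler1n//.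
Qed.

Definition ball_vol : R := fine (lam (@punctured_ball R d)).

Lemma ball_volE : lam (@punctured_ball R d) = ball_vol%:E.
Proof. by rewrite fineK// ge0_fin_numE// punctured_ball_lty. Qed.

Lemma ball_vol_gt0 : (0 < d)%N -> (0 < ball_vol)%R.
Proof. by move=> d0; rewrite -lte_fin -ball_volE punctured_ball_gt0. Qed.

Lemma measurable_indic_punctured :
  measurable_fun setT (fun x : vec R d => (\1_(@punctured_ball R d) x)%:E : \bar R).
Proof. by apply/measurable_EFinP; exact: measurable_indic (@measurable_punctured_ball R d). Qed.

Lemma integral_punctured : \int[lam]_x (\1_(@punctured_ball R d) x)%:E = ball_vol%:E.
Proof.
rewrite integral_indic ?setIT//; last exact: measurable_punctured_ball.
exact: ball_volE.
Qed.

(* The uniqueness argument for Haar measure: if mu is the image of lam under U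
   then mu(f) lam(g) = mu(g) lam(f), and mu(g) = lam(g) for radial g. *)
Lemma integral_isometry (U : vec R d -> vec R d) (f : vec R d -> \bar R) : (0 < d)%N ->
  measurable_fun setT U -> (forall x y, U (vadd x y) = vadd (U x) (U y)) ->
  (forall x, enorm (U x) = enorm x) -> (forall x, exists y, U y = x) ->
  measurable_fun setT f -> (forall x, 0 <= f x) ->
  \int[lam]_x f (U x) = \int[lam]_x f x.
Proof.
move=> d0 mU UD Un Us mf f0.
pose g (x : vec R d) : \bar R := (\1_(@punctured_ball R d) x)%:E.
have mg : measurable_fun setT g by exact: measurable_indic_punctured.
have g0 x : 0 <= g x by rewrite lee_fin.
have gU x : g (U x) = g x.
  have e : (U x \in @punctured_ball R d) = (x \in @punctured_ball R d).
    by apply/idP/idP; rewrite !inE /punctured_ball/= Un.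
  by rewrite /g !indicE e.
have mfU : measurable_fun setT (f \o U) by exact: measurableT_comp.
(* Surjectivity enters here: writing [a] as the image of some [b] shows that the image of [lam]
   under [U] is translation invariant. *)
have shift a F : measurable_fun setT F -> (forall x, 0 <= F x) ->
    \int[lam]_x F (vadd (U x) a) = \int[lam]_x F (U x).
  move=> mF F0; have [b <-] := Us a.
  have mFU : measurable_fun setT (F \o U) by exact: (measurableT_comp mF mU).
  rewrite -[RHS](integral_vadd b mFU); last by move=> x; exact: F0.
  by apply: eq_integral => x _ /=; rewrite UD.
suff : (\int[lam]_x f (U x)) * ball_vol%:E = (\int[lam]_x f x) * ball_vol%:E.
  have b0 := ball_vol_gt0 d0.
  move=> /(congr1 (fun z => z * (ball_vol^-1)%:E)).
  by rewrite -!muleA -EFinM divff ?gt_eqF// !mule1.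
(* Integrating [H] over y first produces the left-hand product. For fixed y, replacing [U x] by
   [U x] - y turns [H] into [H'], whose integral over y first is [g (U x)] times the integral of
   [f]. *)
pose H (z : vec R d * vec R d) := f (U z.1) * g (vadd z.2 (U z.1)).
have mH : measurable_fun setT H.
  apply: emeasurable_funM; first by apply: (measurableT_comp mfU); exact: measurable_fst.
  apply: (measurableT_comp mg); apply: measurable_vadd_comp; first exact: measurable_snd.
  by apply: (measurableT_comp mU); exact: measurable_fst.
pose H' (z : vec R d * vec R d) := f (vadd (U z.1) (vscale (-1) z.2)) * g (U z.1).
have mvo : measurable_fun setT (fun x : vec R d => vscale (-1) x).
  by apply: measurable_vscale_comp => //; exact: measurable_id.
have mH' : measurable_fun setT H'.
  apply: emeasurable_funM; last first.
    by apply: (measurableT_comp mg); apply: (measurableT_comp mU); exact: measurable_fst.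
  apply: (measurableT_comp mf); apply: measurable_vadd_comp.
    by apply: (measurableT_comp mU); exact: measurable_fst.
  by apply: (measurableT_comp mvo); exact: measurable_snd.
transitivity (\int[lam]_x \int[lam]_y H (x, y)).
  rewrite -ge0_integralZr//; last by rewrite lee_fin fine_ge0.
  apply: eq_integral => x _; rewrite /H/= ge0_integralZl//.
  - by rewrite integral_vadd// integral_punctured.
  - by apply: (measurableT_comp mg); apply: measurable_vadd_comp => //; exact: measurable_id.
rewrite (fubini_tonelli H)//; last by move=> z; rewrite mule_ge0.
transitivity (\int[lam]_y \int[lam]_x H' (x, y)).
  apply: eq_integral => y _.
  rewrite -[RHS](_ : \int[lam]_x (fun z => f (vadd z (vscale (-1) y)) * g z) (U x) = _)//.
  rewrite -[RHS](shift y (fun z => f (vadd z (vscale (-1) y)) * g z)).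
  - apply: eq_integral => x _; rewrite /H/= (vaddC y); congr (f _ * _).
    by apply: eq_from_tnth => k; rewrite !tnth_mktuple mulN1r addrK.
  - apply: emeasurable_funM => //; apply: (measurableT_comp mf).
    by apply: measurable_vadd_comp => //; exact: measurable_id.
  - by move=> z; rewrite mule_ge0.
rewrite -(fubini_tonelli H')//; last by move=> z; rewrite mule_ge0.
transitivity (\int[lam]_x (g (U x) * \int[lam]_y f y)).
  apply: eq_integral => x _; rewrite /H'/=.
  rewrite ge0_integralZr//; last first.
    by apply: (measurableT_comp mf); apply: measurable_vadd_comp.
  rewrite muleC; congr (_ * _).
  have mfx : measurable_fun setT (fun y => f (vadd (U x) y)).
    by apply: (measurableT_comp mf); apply: measurable_vadd_comp => //; exact: measurable_id.
  rewrite (integral_vopp mfx)// -(integral_vadd (U x) mf)//.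
  by apply: eq_integral => y _; rewrite vaddC.
rewrite ge0_integralZr//; last 2 first.
- exact: measurableT_comp.
- exact: integral_ge0.
rewrite muleC; congr (_ * _).
by under eq_integral do rewrite gU; rewrite integral_punctured.
Qed.

End punctured.

(** * The uniform law on the sphere *)

Section restriction.
Local Open Scope ereal_scope.
Context d (T : measurableType d) (R : realType).

Lemma ge0_integral_mrestr (mu : {measure set T -> \bar R}) (D : set T) (mD : measurable D)
    (f : T -> \bar R) : measurable_fun setT f -> (forall x, 0 <= f x) ->
  \int[mrestr mu mD]_x f x = \int[mu]_x ((\1_D x)%:E * f x).
Proof.
move=> mf f0.
have mC : measurable (~` D) by exact: measurableC.
transitivity (\int[mrestr mu mD]_(x in D `|` ~` D) f x); first by rewrite setUv.
rewrite ge0_integral_setU//; last 2 first.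
- by rewrite setUv.
- by apply/disj_setPS => x [].
rewrite [X in _ + X](_ : _ = 0) ?adde0; last first.
  rewrite -(integral_measure_zero (T := T) (~` D) f).
  apply: eq_measure_integral => A mA AD.
  change (mu (A `&` D) = 0); rewrite (_ : A `&` D = set0) ?measure0//.
  by apply/seteqP; split => // x [/AD].
transitivity (\int[mu]_(x in D) f x).
  apply: eq_measure_integral => A mA AD.
  change (mu (A `&` D) = mu A); have -> // : A `&` D = A.
  by apply/seteqP; split => x; [case|move=> Ax; split => //; exact: AD].
rewrite integral_mkcond; apply: eq_integral => x _; rewrite patchE indicE.
by case: ifPn => _; rewrite ?mul1e ?mul0e.
Qed.

End restriction.

Section sphere.
Local Open Scope ereal_scope.
Context (R : realType) (d : nat) (d_gt0 : (0 < d)%N).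
Local Notation lam := (lebesgue_power R d).
Local Notation sig := (sphere_unif R d).
Local Notation P := (@punctured_ball R d).
Local Notation V := (vec R d).
Implicit Type F : V -> \bar R.

Lemma measurable_comp_unit F : measurable_fun setT F -> measurable_fun setT (F \o @unit_vec R d).
Proof. by move=> mF; apply: (measurableT_comp mF); exact: measurable_unit_vec. Qed.

Lemma integral_sphere F : measurable_fun setT F -> (forall x, 0 <= F x) ->
  \int[sig]_x F x = ((ball_vol R d)^-1)%:E * \int[lam]_x ((\1_P x)%:E * F (unit_vec x)).
Proof.
move=> mF F0.
have v0 := ball_vol_gt0 R d_gt0.
have iv0 : (0 <= (ball_vol R d)^-1)%R by rewrite invr_ge0 ltW.
transitivity (\int[mscale (NngNum iv0) (@cone_measure R d)]_x F x).
  apply: eq_measure_integral => A mA _.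
  (* The total mass is a positive real number, so [mnormalize] rescales and does not return its
     default measure. *)
  have cT : @cone_measure R d setT = (ball_vol R d)%:E.
    by rewrite /cone_measure /pushforward preimage_setT /mrestr setTI ball_volE.
  rewrite /sphere_unif/= /mnormalize/= cT.
  by rewrite eqe gt_eqF//= /mscale/= muleC.
rewrite ge0_integral_mscale//=; congr (_ * _).
rewrite /cone_measure.
rewrite (@ge0_integral_pushforward _ _ _ _ _ _ (@measurable_unit_vec R d) (mrestr lam (@measurable_punctured_ball R d)) setT)//.
rewrite preimage_setT ge0_integral_mrestr//; first exact: measurable_comp_unit.
by move=> x; exact: F0.
Qed.

Lemma measurable_indic_comp F : measurable_fun setT F ->
  measurable_fun setT (fun x => (\1_P x)%:E * F (unit_vec x)).
Proof.
move=> mF; apply: emeasurable_funM; first exact: measurable_indic_punctured.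
exact: measurable_comp_unit.
Qed.

Lemma eq_integral_sphere F G : measurable_fun setT F -> (forall x, 0 <= F x) ->
  measurable_fun setT G -> (forall x, 0 <= G x) ->
  (forall x, dotp x x = 1%R -> F x = G x) -> \int[sig]_x F x = \int[sig]_x G x.
Proof.
move=> mF F0 mG G0 FG; rewrite !integral_sphere//; congr (_ * _).
apply: eq_integral => x _; rewrite indicE; have [xP|xP] := boolP (x \in P); last by rewrite !mul0e.
rewrite FG// enorm_unit//; move: xP; rewrite inE => /andP[]//.
Qed.

Lemma le_integral_sphere F G : measurable_fun setT F -> (forall x, 0 <= F x) ->
  measurable_fun setT G -> (forall x, 0 <= G x) ->
  (forall x, dotp x x = 1%R -> F x <= G x) -> \int[sig]_x F x <= \int[sig]_x G x.
Proof.
move=> mF F0 mG G0 FG; rewrite !integral_sphere//.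
apply: lee_wpmul2l; first by rewrite lee_fin invr_ge0 ltW// ball_vol_gt0.
apply: ge0_le_integral => //.
- by move=> x _; rewrite mule_ge0// lee_fin.
- exact: measurable_indic_comp.
- exact: measurable_indic_comp.
- move=> x _; rewrite indicE; have [xP|xP] := boolP (x \in P); last by rewrite !mul0e.
  rewrite !mul1e FG// enorm_unit//; move: xP; rewrite inE => /andP[]//.
Qed.

(** The Householder reflection in the hyperplane orthogonal to u. For u = 0 the division by zero
    makes it the identity, so the isometry lemmas hold for every u. *)
Definition refl (u x : V) : V := vadd x (vscale (- 2 * dotp x u / dotp u u)%R u).

Lemma measurable_refl u : measurable_fun setT (refl u).
Proof.
apply: measurable_vadd_comp; first exact: measurable_id.
apply: measurable_vscale_comp => //.
apply: measurable_funM => //; apply: measurable_funM => //.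
by apply: measurable_dotp_comp => //; exact: measurable_id.
Qed.

Lemma reflD u x y : refl u (vadd x y) = vadd (refl u x) (refl u y).
Proof.
by apply: eq_from_tnth => k; rewrite !tnth_mktuple dotpDl; ring.
Qed.

Lemma reflZ u c x : refl u (vscale c x) = vscale c (refl u x).
Proof.
by apply: eq_from_tnth => k; rewrite !tnth_mktuple dotpZl; ring.
Qed.

Lemma dotp_refl u x y : dotp (refl u x) (refl u y) = dotp x y.
Proof.
rewrite /refl !(dotpDl, dotpDr, dotpZl, dotpZr) (dotpC u y).
have [->|c0] := eqVneq (dotp u u) 0%R; first by rewrite invr0; ring.
by field.
Qed.

Lemma enorm_refl u x : enorm (refl u x) = enorm x.
Proof. by rewrite /enorm dotp_refl. Qed.

Lemma reflK u x : refl u (refl u x) = x.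
Proof.
apply: eq_from_tnth => k; rewrite /refl !tnth_mktuple !(dotpDl, dotpZl).
have [->|c0] := eqVneq (dotp u u) 0%R; first by rewrite invr0; ring.
by field.
Qed.

Lemma dotp_eq0 (x : V) : dotp x x = 0%R -> forall k, tnth x k = 0%R.
Proof.
move=> x0 k; have := coord_le_enorm x k.
by rewrite /enorm x0 sqrtr0 normr_le0 => /eqP.
Qed.

(** With u = w - z and equal norms, [dotp u u = 2 * dotp w u], so the reflection subtracts exactly u
    from w. If u = 0, then w = z and nothing moves. *)
Lemma refl_swap (w z : V) : dotp w w = dotp z z -> refl (vadd w (vscale (-1) z)) w = z.
Proof.
move=> wz; set u := vadd _ _.
have uE k : tnth u k = (tnth w k - tnth z k)%R by rewrite !tnth_mktuple mulN1r.
apply: eq_from_tnth => k; rewrite /refl tnth_mktuple [tnth (vscale _ _) _]tnth_mktuple uE.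
have uu : dotp u u = (2 * dotp w u)%R.
  by rewrite /u !(dotpDl, dotpDr, dotpZl, dotpZr) (dotpC z w) wz; ring.
have [u0|u0] := eqVneq (dotp u u) 0%R.
  have := dotp_eq0 u0 k; rewrite uE => /eqP; rewrite subr_eq0 => /eqP ->.
  by rewrite subrr mulr0 addr0.
have wu0 : dotp w u != 0%R by apply: contra_neq u0 => h; rewrite uu h mulr0.
by rewrite uu; field.
Qed.

Lemma integral_sphere_refl u F : measurable_fun setT F -> (forall x, 0 <= F x) ->
  \int[sig]_x F (refl u x) = \int[sig]_x F x.
Proof.
move=> mF F0.
have mFu : measurable_fun setT (F \o refl u) by apply: (measurableT_comp mF); exact: measurable_refl.
rewrite (integral_sphere mFu); last by move=> x; exact: F0.
rewrite integral_sphere//; congr (_ * _).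
rewrite -[RHS](@integral_isometry R d (refl u))//.
- apply: eq_integral => x _ /=; congr (_%:E * F _).
    rewrite !indicE; have -> // : (refl u x \in P) = (x \in P).
    by apply/idP/idP; rewrite !inE /punctured_ball/= enorm_refl.
  by rewrite !unit_vecE enorm_refl reflZ.
- exact: measurable_refl.
- by move=> x y; rewrite reflD.
- by move=> x; rewrite enorm_refl.
- by move=> x; exists (refl u x); rewrite reflK.
- exact: measurable_indic_comp.
- by move=> x; rewrite mule_ge0// lee_fin.
Qed.

(* Householder reflections act transitively on unit vectors. *)
Lemma sphere_rotation (w z : V) : dotp w w = 1%R -> dotp z z = 1%R ->
  exists U : V -> V, [/\ measurable_fun setT U,
    forall x y, dotp (U x) (U y) = dotp x y, U w = z &
    forall F, measurable_fun setT F -> (forall x, 0 <= F x) ->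
      \int[sig]_x F (U x) = \int[sig]_x F x].
Proof.
move=> w1 z1; exists (refl (vadd w (vscale (-1) z))); split.
- exact: measurable_refl.
- exact: dotp_refl.
- by rewrite refl_swap// w1 z1.
- by move=> F mF F0; exact: integral_sphere_refl.
Qed.

Lemma integral_sphere_marginal (w z : V) (h : R -> \bar R) :
  dotp w w = 1%R -> dotp z z = 1%R -> measurable_fun setT h -> (forall x, 0 <= h x) ->
  \int[sig]_x h (dotp x w) = \int[sig]_x h (dotp x z).
Proof.
move=> w1 z1 mh h0; have [U [mU Ud Uw Ui]] := sphere_rotation w1 z1.
rewrite -[RHS](Ui (fun x => h (dotp x z)))//; last first.
  by apply: (measurableT_comp mh); apply: measurable_dotp_comp => //; exact: measurable_id.
by apply: eq_integral => x _; rewrite -Uw Ud.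
Qed.

Definition basis_vec (k : 'I_d) : V := [tuple ((j == k)%:R : R) : measurableTypeR R | j < d].

Lemma dotp_basis (x : V) k : dotp x (basis_vec k) = tnth x k.
Proof.
rewrite /dotp (bigD1 k)//= tnth_mktuple eqxx mulr1 big1 ?addr0// => j jk.
by rewrite tnth_mktuple (negbTE jk) mulr0.
Qed.

Lemma dotp_basis_diag k : dotp (basis_vec k) (basis_vec k) = 1%R.
Proof. by rewrite dotp_basis tnth_mktuple eqxx. Qed.

(** By rotation invariance every coordinate has this same second moment, and the d squared
    coordinates of a unit vector sum to 1. *)
Lemma sphere_second_moment (w : V) : dotp w w = 1%R ->
  \int[sig]_x ((dotp x w) ^+ 2)%:E = (d%:R^-1)%:E.
Proof.
move=> w1.
have m2 (z : V) : measurable_fun setT (fun x : V => ((dotp x z) ^+ 2)%:E : \bar R).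
  apply/measurable_EFinP; apply: measurable_funX.
  by apply: measurable_dotp_comp => //; exact: measurable_id.
have mh : measurable_fun setT (fun t : R => (t ^+ 2)%:E : \bar R).
  by apply/measurable_EFinP; apply: measurable_funX.
have hk k : \int[sig]_x ((dotp x (basis_vec k)) ^+ 2)%:E = \int[sig]_x ((dotp x w) ^+ 2)%:E.
  apply: (@integral_sphere_marginal _ _ (fun t => (t ^+ 2)%:E)) => //.
    exact: dotp_basis_diag.
  by move=> x; rewrite lee_fin sqr_ge0.
have : \sum_(k < d) \int[sig]_x ((dotp x (basis_vec k)) ^+ 2)%:E = 1.
  rewrite -ge0_integral_sum//; last by move=> k x _; rewrite lee_fin sqr_ge0.
  transitivity (\int[sig]_x (cst 1 x)); last first.
    by rewrite integral_cst// mul1e; exact: probability_setT.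
  apply: eq_integral_sphere => //.
  - exact: emeasurable_sum.
  - by move=> x; apply: sume_ge0 => k _; rewrite lee_fin sqr_ge0.
  - move=> x x1; rewrite /cst -x1 sumEFin; congr (_%:E).
    by apply: eq_bigr => k _; rewrite dotp_basis expr2.
under eq_bigr do rewrite hk.
(* The common value has to be finite before the equation can be solved for it in the reals. *)
have : \int[sig]_x ((dotp x w) ^+ 2)%:E <= 1.
  apply: (@le_trans _ _ (\int[sig]_x (cst 1 x))); last first.
    by rewrite integral_cst// mul1e probability_le1.
  apply: le_integral_sphere => //.
  - by move=> x; rewrite lee_fin sqr_ge0.
  - by move=> x x1; rewrite /cst lee_fin -real_normK ?num_real// exprn_ile1// dotp_le1.
have : 0 <= \int[sig]_x ((dotp x w) ^+ 2)%:E.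
  by apply: integral_ge0 => x _; rewrite lee_fin sqr_ge0.
case: (\int[sig]_x _) => // r _ _; rewrite sumEFin => -[].
rewrite sumr_const card_ord -(mulr_natl r) => h; congr (_%:E).
by apply: (@mulfI _ (d%:R : R)%R); rewrite ?h ?divff// pnatr_eq0 -lt0n.
Qed.

End sphere.

Section measurability.
Context d (T : measurableType d) (R : realType).

Lemma measurable_natb (b : T -> bool) : measurable_fun setT b ->
  measurable_fun setT (fun x => (b x)%:R : R).
Proof.
move=> mb; rewrite (_ : (fun _ => _) = (fun x => if b x then 1 else 0 : R)).
  exact: measurable_fun_ifT.
by apply/funext => x; case: (b x).
Qed.

Lemma measurable_sqrt_comp (f : T -> R) : measurable_fun setT f ->
  measurable_fun setT (fun x => Num.sqrt (f x)).
Proof.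
move=> mf; apply: (measurableT_comp _ mf).
by apply: nondecreasing_measurable => // x y; exact: ler_wsqrtr.
Qed.

Lemma measurable_inv_comp (f : T -> R) : measurable_fun setT f -> (forall x, 0 <= f x) ->
  measurable_fun setT (fun x => (f x)^-1).
Proof.
move=> mf f0; rewrite (_ : (fun _ => _) = (@powR R ^~ (-1)) \o f).
  by apply: measurableT_comp => //; exact: measurable_powR.
by apply/funext => x /=; rewrite powR_inv1.
Qed.

End measurability.

Section null.
Local Open Scope ereal_scope.
Context (R : realType) (d : nat) (d_gt0 : (0 < d)%N).
Local Notation lam := (lebesgue_power R d).
Local Notation V := (vec R d).

Lemma measurable_enorm0 : measurable [set x : V | enorm x = 0%R].
Proof.
rewrite (_ : [set _ | _] = @enorm R d @^-1` [set 0%R]) //.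
by rewrite -[X in measurable X]setTI; exact: measurable_enorm.
Qed.

(** The set is invariant under dilation by 2, which changes Lebesgue measure by the factor 2^d. Its
    measure is finite, since it lies in a box, hence it vanishes. *)
Lemma measure_enorm0 : lam [set x : V | enorm x = 0%R] = 0.
Proof.
set N := [set _ | _].
have mN : measurable N by exact: measurable_enorm0.
have Nlty : lam N < +oo.
  apply: (@le_lt_trans _ _ (lam [set x | forall k, (-1 < tnth x k <= 1)%R])); last first.
    by rewrite box_measure ?ltry//; lra.
  apply: le_measure; rewrite ?inE//; first exact: measurable_box.
  move=> x /= x0 k; have := coord_le_enorm x k; rewrite x0 normr_le0 => /eqP ->.
  by apply/andP; split; lra.
have hI : lam N = ((2^-1) ^+ d)%:E * lam N.
  transitivity (\int[lam]_x (\1_N x)%:E); first by rewrite integral_indic// setIT.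
  transitivity (\int[lam]_x (\1_N (vscale 2 x))%:E).
    apply: eq_integral => x _; congr (_%:E).
    rewrite !indicE; have -> // : (vscale 2 x \in N) = (x \in N).
    apply/idP/idP; rewrite !inE /N/= enormZ// => /eqP; rewrite ?mulf_eq0 ?pnatr_eq0/=.
      by move=> /eqP.
    by move=> /eqP ->; rewrite mulr0.
  rewrite (integral_vscale (f := fun x => (\1_N x)%:E))//.
    by congr (_ * _); rewrite integral_indic// setIT.
  exact/measurable_EFinP.
have [r rE] : exists r, lam N = r%:E.
  by exists (fine (lam N)); rewrite fineK// ge0_fin_numE.
move: hI; rewrite rE -EFinM => -[] e; congr (_%:E).
apply/eqP; move: e => /eqP; rewrite -subr_eq0 -{1}[r]mul1r -mulrBl mulf_eq0.
case/orP => [|//]; rewrite subr_eq0 eq_sym => /eqP e.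
have : (2^-1 ^+ d < 1 :> R)%R by rewrite exprn_ilt1 -?lt0n// ?invr_ge0// invf_lt1// ltr1n.
by rewrite e ltxx.
Qed.

Lemma measure_closed_ball : lam [set x : V | (enorm x <= 1)%R] = (ball_vol R d)%:E.
Proof.
rewrite (_ : [set _ | _] = @punctured_ball R d `|` [set x : V | enorm x = 0%R]); last first.
  apply/seteqP; split => x /=.
    move=> x1; have := enorm_ge0 x; rewrite le_eqVlt => /orP[/eqP h|h]; [by right|left].
    by rewrite /punctured_ball/= h.
  by case=> [/andP[]//|->].
transitivity (lam (@punctured_ball R d) + lam [set x : V | enorm x = 0%R]); last first.
  by rewrite ball_volE measure_enorm0 adde0.
apply: measureU.
- exact: measurable_punctured_ball.
- exact: measurable_enorm0.
- by apply/seteqP; split => // x [] /= /andP[+ _] x0; rewrite x0 ltxx.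
Qed.

(* The part of the cone over the cap lying in the unit ball is contained in the
   ball of centre e w and radius sqrt (1 - e^2). *)
Lemma sphere_tail (w : V) (e : R) : dotp w w = 1%R -> (0 <= e)%R -> (e ^+ 2 <= 2^-1)%R ->
  \int[sphere_unif R d]_x ((e <= dotp x w)%R%:R)%:E <= (Num.sqrt (1 - e ^+ 2) ^+ d)%:E.
Proof.
move=> w1 e0 e2.
have v0 := ball_vol_gt0 R d_gt0.
have c20 : (0 < 1 - e ^+ 2)%R by lra.
pose c := Num.sqrt (1 - e ^+ 2)%R.
have c0 : (0 < c)%R by rewrite sqrtr_gt0.
have cc : (c ^+ 2 = 1 - e ^+ 2)%R by rewrite sqr_sqrtr// ltW.
have mF : measurable_fun setT (fun x : V => (e <= dotp x w)%R%:R%:E : \bar R).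
  apply/measurable_EFinP; apply: measurable_natb; apply: measurable_fun_ler => //.
  by apply: measurable_dotp_comp => //; exact: measurable_id.
rewrite integral_sphere//.
pose B := [set x : V | (enorm x <= 1)%R].
have mB : measurable B.
  rewrite (_ : B = @enorm R d @^-1` `]-oo, 1%R]).
    by rewrite -[X in measurable X]setTI; apply: measurable_enorm => //; exact: (@measurable_itv R).
  by apply/seteqP; split => x; rewrite /B/= in_itv.
have mIB : measurable_fun setT (fun x : V => (\1_B x)%:E : \bar R) by apply/measurable_EFinP.
pose h (x : V) := (\1_B (vscale c^-1 (vadd x (vscale (- e) w))))%:E : \bar R.
have mh : measurable_fun setT h.
  apply: (measurableT_comp mIB); apply: measurable_vscale_comp => //.
  by apply: measurable_vadd_comp => //; exact: measurable_id.
have -> : (Num.sqrt (1 - e ^+ 2) ^+ d)%:E = ((ball_vol R d)^-1)%:E * \int[lam]_x h x.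
  rewrite /h (integral_vadd (vscale (- e)%R w) (f := fun x => (\1_B (vscale c^-1 x))%:E)) //; last first.
  - apply: (measurableT_comp mIB); apply: measurable_vscale_comp => //; exact: measurable_id.
  rewrite (integral_vscale (f := fun x => (\1_B x)%:E))//; last by rewrite invr_gt0.
  have -> : \int[lam]_x (\1_B x)%:E = (ball_vol R d)%:E.
    by rewrite integral_indic// setIT; exact: measure_closed_ball.
  rewrite invrK -!EFinM mulrCA mulVf ?gt_eqF//.
  by rewrite mulr1.
apply: lee_wpmul2l; first by rewrite lee_fin invr_ge0 ltW.
apply: ge0_le_integral => //.
  exact: (measurable_indic_comp mF).
move=> x _; rewrite -EFinM lee_fin indicE.
have [xP|xP] := boolP (x \in _); last by rewrite mul0r.
rewrite mul1r; case: (leP e) => //= ex; rewrite indicE mem_set//= /B/=.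
rewrite enormZ ?invr_ge0 ?(ltW c0)// ler_pdivrMl// mulr1.
move: xP; rewrite inE /punctured_ball/= => /andP[x0 x1].
rewrite -(@ler_pXn2r _ 2)// ?nnegrE ?enorm_ge0 ?(ltW c0)// cc sqr_enorm.
rewrite !(dotpDl, dotpDr, dotpZl, dotpZr) w1 (dotpC w) -sqr_enorm.
have exr : (e * enorm x <= dotp x w)%R.
  move: ex; rewrite unit_vecE dotpZl mulrC ler_pdivlMr//.
set r := enorm x in x0 x1 exr *; set s := dotp x w in exr *.
(* Twice this product plus the next one is exactly 1 - e^2 minus the squared distance r^2 - 2 e s +
   e^2. The second product is nonnegative because r <= 1 and 2 e^2 <= 1. *)
have : (e * (s - e * r) >= 0)%R by rewrite mulr_ge0// subr_ge0.
have : ((1 - r) * (1 + r - 2 * e ^+ 2) >= 0)%R by rewrite mulr_ge0//; lra.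
by nra.
Qed.

End null.

(** * Slicing the sphere *)

Section radial.
Local Open Scope ereal_scope.
Context (R : realType) (m : nat) (m_gt0 : (0 < m)%N).
Local Notation lam := (lebesgue_power R m).
Local Notation leb := (@lebesgue_measure R).
Local Notation V := (vec R m).
Local Notation P := (@punctured_ball R m).

Lemma measurable_enorm_comp d (T : measurableType d) (f : T -> V) : measurable_fun setT f ->
  measurable_fun setT (fun x => enorm (f x) : R).
Proof. by move=> mf; apply: (measurableT_comp _ mf); exact: measurable_enorm. Qed.

Lemma measurable_unit_comp d (T : measurableType d) (f : T -> V) : measurable_fun setT f ->
  measurable_fun setT (fun x => unit_vec (f x)).
Proof. by move=> mf; apply: (measurableT_comp _ mf); exact: measurable_unit_vec. Qed.

Lemma indic_puncturedE (x : V) : (\1_P x = (0 < enorm x <= 1)%R%:R :> R)%R.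
Proof.
rewrite indicE; congr (_%:R)%R; congr nat_of_bool.
by apply/idP/idP; rewrite inE.
Qed.

Lemma measurable_enorm_itv d (T : measurableType d) (f : T -> V) (a : T -> R) :
  measurable_fun setT f -> measurable_fun setT a ->
  measurable_fun setT (fun x => (0 < enorm (f x) <= a x)%R%:R : R).
Proof.
move=> mf ma; apply: measurable_natb; apply: measurable_and.
- by apply: measurable_fun_ltr => //; exact: measurable_enorm_comp.
- by apply: measurable_fun_ler => //; exact: measurable_enorm_comp.
Qed.

(* Integrate the indicator of {|y| <= a} over a in ]0, 1] in the two orders. *)
Lemma integral_radial : exists2 c : R, (0 <= c)%R & forall G : V -> R,
  measurable_fun setT G -> (forall x, 0 <= G x <= 1)%R ->
  \int[lam]_y (\1_P y * (enorm y * G (unit_vec y)))%:E =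
  c%:E * \int[lam]_y (\1_P y * G (unit_vec y))%:E.
Proof.
pose ka : \bar R := \int[leb]_a ((0 < a <= 1)%R%:R * a ^+ m)%:E.
have mind : measurable_fun setT (fun a : R => (0 < a <= 1)%R%:R : R).
  by apply: measurable_natb; apply: measurable_and; [exact: measurable_fun_ltr|exact: measurable_fun_ler].
have mka : measurable_fun setT (fun a : R => ((0 < a <= 1)%R%:R * a ^+ m)%:E : \bar R).
  by apply/measurable_EFinP; apply: measurable_funM => //; exact: measurable_funX.
have iind : \int[leb]_a ((0 < a <= 1)%R%:R)%:E = 1.
  transitivity (\int[leb]_a (\1_(`]0%R, 1%R]%classic : set (measurableTypeR R)) a)%:E).
    apply: eq_integral => a _; congr (_%:E); rewrite indicE; congr (_%:R)%R.
    congr nat_of_bool; apply/idP/idP; rewrite inE/= in_itv//.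
  rewrite integral_indic// setIT; etransitivity; first exact: lebesgue_measure_itv.
  by rewrite /= lte_fin ltr01 oppr0 adde0.
have ka0 : 0 <= ka.
  apply: integral_ge0 => a _; rewrite lee_fin; case: (ltP 0%R a) => //= a0; last by rewrite mul0r.
  by rewrite mulr_ge0// exprn_ge0// ltW.
have ka1 : ka <= 1.
  rewrite -iind; apply: ge0_le_integral => //.
  - move=> a _; rewrite lee_fin; case: (ltP 0%R a) => //= a0; last by rewrite mul0r.
    by rewrite mulr_ge0// exprn_ge0// ltW.
  - exact/measurable_EFinP.
  - move=> a _; rewrite lee_fin; case: (ltP 0%R a) => //= a0; last by rewrite mul0r.
    by case: (leP a 1%R) => //= a1; rewrite ?mul0r// mul1r exprn_ile1// ltW.
have [k kE] : exists k, ka = k%:E.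
  by exists (fine ka); rewrite fineK// ge0_fin_numE// (le_lt_trans ka1) ?ltry.
rewrite kE lee_fin in ka1.
(* Since [k] is the integral of a^m over ]0, 1], the constant is m / (m + 1), the mean radius of a
   uniform point of the ball. Its value is never computed. *)
exists (1 - k)%R; first by rewrite subr_ge0.
move=> G mG G01.
have mGu : measurable_fun setT (fun y : V => G (unit_vec y)).
  by apply: (measurableT_comp mG); exact: measurable_unit_vec.
have G0 x : (0 <= G x)%R by have /andP[] := G01 x.
have mP : measurable_fun setT (\1_P : V -> R) by exact: measurable_indic (@measurable_punctured_ball R m).
pose I := \int[lam]_y (\1_P y * G (unit_vec y))%:E.
have mI : measurable_fun setT (fun y : V => (\1_P y * G (unit_vec y))%:E : \bar R).
  by apply/measurable_EFinP; exact: measurable_funM.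
have I0 : 0 <= I by apply: integral_ge0 => y _; rewrite lee_fin mulr_ge0.
have Ilt : I < +oo.
  apply: (@le_lt_trans _ _ (ball_vol R m)%:E); last exact: ltry.
  rewrite -integral_punctured; apply: ge0_le_integral => //.
  - by move=> y _; rewrite lee_fin mulr_ge0.
  - exact: measurable_indic_punctured.
  - by move=> y _; rewrite lee_fin ler_piMr//; have /andP[] := G01 (unit_vec y).
pose W := \int[lam]_y (\1_P y * (enorm y * G (unit_vec y)))%:E.
pose W' := \int[lam]_y (\1_P y * ((1 - enorm y) * G (unit_vec y)))%:E.
have mW : measurable_fun setT (fun y : V => (\1_P y * (enorm y * G (unit_vec y)))%:E : \bar R).
  apply/measurable_EFinP; apply: measurable_funM => //; apply: measurable_funM => //.
  exact: measurable_enorm.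
have mW' : measurable_fun setT (fun y : V => (\1_P y * ((1 - enorm y) * G (unit_vec y)))%:E : \bar R).
  apply/measurable_EFinP; apply: measurable_funM => //; apply: measurable_funM => //.
  by apply: measurable_funB => //; exact: measurable_enorm.
have W0' (y : V) : (0 <= \1_P y * ((1 - enorm y) * G (unit_vec y)))%R.
  rewrite indic_puncturedE; case: (ltP 0%R (enorm y)) => //= y0; last by rewrite mul0r.
  by case: (leP (enorm y) 1%R) => //= y1; rewrite ?mul0r// mul1r mulr_ge0// subr_ge0.
have WW : W + W' = I.
  rewrite -ge0_integralD//.
  - by apply: eq_integral => y _; rewrite -EFinD; congr (_%:E); ring.
  - by move=> y _; rewrite lee_fin !mulr_ge0// enorm_ge0.
  - by move=> y _; rewrite lee_fin.
(* The radii a in [|y|, 1] have measure 1 - |y|, so the double integral yields [W']; the integral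
   [W] then follows by subtraction from [I]. *)
suff W'E : W' = k%:E * I.
  have Wfin : exists w, W = w%:E.
    exists (fine W); rewrite fineK// ge0_fin_numE.
      by apply: le_lt_trans Ilt; rewrite -WW leeDl//; apply: integral_ge0 => y _; rewrite lee_fin.
    by apply: integral_ge0 => y _; rewrite lee_fin !mulr_ge0// enorm_ge0.
  have [i iE] : exists i, I = i%:E by exists (fine I); rewrite fineK// ge0_fin_numE.
  have [w wE] := Wfin.
  rewrite -/W -/I wE iE -EFinM; congr (_%:E).
  by move: WW; rewrite W'E wE iE -EFinM -EFinD => -[] h; rewrite mulrBl mul1r -[X in (X - _)%R]h addrK.
pose Q (z : measurableTypeR R * V) := ((0 < z.1 <= 1)%R%:R * ((0 < enorm z.2 <= z.1)%R%:R * G (unit_vec z.2)))%:E : \bar R.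
have mQ : measurable_fun setT Q.
  apply/measurable_EFinP; apply: measurable_funM.
    by apply: (measurableT_comp mind); exact: measurable_fst.
  apply: measurable_funM.
    by apply: measurable_enorm_itv; [exact: measurable_snd|exact: measurable_fst].
  by apply: (measurableT_comp mGu); exact: measurable_snd.
have Q0 z : 0 <= Q z by rewrite lee_fin !mulr_ge0.
transitivity (\int[lam]_y \int[leb]_a Q (a, y)).
  apply: eq_integral => y _; rewrite /Q/=.
  transitivity (\int[leb]_a ((G (unit_vec y) * (0 < enorm y)%R%:R)%:E * (\1_(`[enorm y, 1%R]%classic : set (measurableTypeR R)) a)%:E)).
    rewrite ge0_integralZl_EFin//; last 2 first.
    - by apply/measurable_EFinP; apply: measurable_indic; exact: measurable_itv.
    - by rewrite mulr_ge0.
    have mJ : measurable (`[enorm y, 1%R]%classic : set (measurableTypeR R)) by exact: measurable_itv.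
    rewrite integral_indic// setIT [X in _ * X](_ : _ = if (enorm y <= 1)%R then (1 - enorm y)%:E else 0); last first.
      etransitivity; first exact: lebesgue_measure_itv.
      rewrite /= lte_fin; case: ltgtP => // ->; by rewrite subrr.
    rewrite indic_puncturedE; case: (ltP 0%R (enorm y)) => //= y0; last by rewrite mulr0 mul0r mul0e.
    case: (leP (enorm y) 1%R) => //= y1; rewrite ?mule0 ?mul0r//.
    by rewrite -EFinM mulr1 mul1r mulrC.
  apply: eq_integral => a _; rewrite -EFinM; congr (_%:E).
  rewrite indicE.
  have -> : (a \in (`[enorm y, 1%R]%classic : set (measurableTypeR R))) = (enorm y <= a <= 1)%R.
    by apply/idP/idP; rewrite inE/= in_itv.
  case: (ltP 0%R (enorm y)) => //= y0; last by rewrite mul0r !mulr0 mul0r.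
  case: (leP (enorm y) a) => //= ya; last by rewrite mul0r !mulr0.
  by rewrite (lt_le_trans y0 ya)/= mulr1 mul1r mulrC.
rewrite -(fubini_tonelli Q)//.
rewrite -kE muleC -ge0_integralZl//; last first.
  move=> a _; rewrite lee_fin; case: (ltP 0%R a) => //= a0; last by rewrite mul0r.
  by rewrite mulr_ge0// exprn_ge0// ltW.
apply: eq_integral => a _; rewrite /Q/=.
case: (ltP 0%R a) => /= a0; last first.
  rewrite mul0r mule0; under eq_integral do rewrite mul0r.
  exact: integral0.
case: (leP a 1%R) => /= a1; last first.
  rewrite mul0r mule0; under eq_integral do rewrite mul0r.
  exact: integral0.
rewrite mul1r muleC.
pose f (y : V) := ((0 < enorm y <= a)%R%:R * G (unit_vec y))%:E : \bar R.
have mf : measurable_fun setT f.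
  by apply/measurable_EFinP; apply: measurable_funM => //; apply: measurable_enorm_itv => //; exact: measurable_id.
have := integral_vscale a0 mf; rewrite /f => h.
have {h} -> : I = (a^-1 ^+ m)%:E * \int[lam]_x f x.
  rewrite -h; last by move=> x; rewrite lee_fin mulr_ge0.
  apply: eq_integral => y _; rewrite indic_puncturedE unit_vecZ// enormZ ?(ltW a0)//.
  rewrite pmulr_rgt0//; have -> // : (a * enorm y <= a)%R = (enorm y <= 1)%R.
  by apply/idP/idP => hh; [rewrite -(ler_pM2l a0) mulr1|rewrite -[leRHS]mulr1 ler_pM2l].
rewrite muleA -EFinM -exprMn divff ?gt_eqF// expr1n mul1e.
by under eq_integral do rewrite mul1r.
Qed.

End radial.

Section recursion.
Local Open Scope ereal_scope.
Context (R : realType) (m : nat) (m_gt0 : (0 < m)%N).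
Local Notation lam := (lebesgue_power R m).
Local Notation leb := (@lebesgue_measure R).
Local Notation V := (vec R m).
Local Notation W := (vec R m.+1).
Local Notation P := (@punctured_ball R m).
Local Notation RR := (measurableTypeR R).

(* [slope_cos] and [slope_sin] are the cosine and the sine of the angle whose
   tangent is t. *)
Definition slope_cos (t : RR) : R := (Num.sqrt (1 + t ^+ 2))^-1.

Lemma slope_cos_gt0 t : (0 < slope_cos t)%R.
Proof. by rewrite invr_gt0 sqrtr_gt0 ltr_pwDl// sqr_ge0. Qed.

Lemma measurable_slope_cos : measurable_fun setT slope_cos.
Proof.
apply: measurable_inv_comp; last by move=> x; exact: sqrtr_ge0.
apply: measurable_sqrt_comp; apply: measurable_funD => //.
Qed.

Lemma enorm_cons (x : RR) (y : V) : (enorm (cons_pair (x, y)) = Num.sqrt (x ^+ 2 + enorm y ^+ 2) :> R)%R.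
Proof. by rewrite {1}/enorm dotp_cons sqr_enorm expr2. Qed.

Lemma measurable_cons_comp d (T : measurableType d) (f : T -> RR) (g : T -> V) :
  measurable_fun setT f -> measurable_fun setT g ->
  measurable_fun setT (fun x => cons_pair (f x, g x) : W).
Proof. by move=> mf mg; apply: measurable_cons. Qed.

Lemma cons_unit (y : V) (t : RR) : (0 < enorm y)%R ->
  cons_pair ((enorm y * t)%R : RR, y) = vscale (enorm y) (cons_pair (t, unit_vec y)).
Proof.
move=> y0; rewrite vscale_cons; congr (cons_pair (_, _)).
by rewrite unit_vecE vscaleA divff ?gt_eqF// vscale1.
Qed.

(* Substituting x = |y| t in each fibre, then scaling y by [slope_cos t]: under
   the uniform law on the sphere the slope t = x / |y| and the direction of y
   are independent, and t has density proportional to (1 + t^2)^(-(m+1)/2). *)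
Lemma sphere_recursion : exists2 K : R, (0 <= K)%R & forall F : W -> R,
  measurable_fun setT F -> (forall x, 0 <= F x <= 1)%R ->
  \int[sphere_unif R m.+1]_x (F x)%:E =
  K%:E * \int[leb]_t ((slope_cos t ^+ m.+1)%:E *
    \int[sphere_unif R m]_u (F (unit_vec (cons_pair (t, u))))%:E).
Proof.
have [c c0 hc] := integral_radial R m.
have v0 := ball_vol_gt0 R m_gt0.
have v0' := ball_vol_gt0 R (ltn0Sn m).
exists ((ball_vol R m.+1)^-1 * (c * ball_vol R m))%R.
  by rewrite !mulr_ge0 ?invr_ge0 ?(ltW v0) ?(ltW v0').
move=> F mF F01.
have F0 x : (0 <= F x)%R by have /andP[] := F01 x.
rewrite integral_sphere//; last exact/measurable_EFinP.
rewrite EFinM -muleA; congr (_ * _).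
pose f (z : W) := (\1_(@punctured_ball R m.+1) z)%:E * (F (unit_vec z))%:E.
have mf : measurable_fun setT f.
  by apply: (measurable_indic_comp (F := fun x => (F x)%:E)); exact/measurable_EFinP.
have f0 z : 0 <= f z by rewrite mule_ge0// lee_fin.
rewrite /lebesgue_power (@integral_power_measureS2 _ _ _ leb m f)//.
have mFu (T : measurableType _) (g : T -> W) : measurable_fun setT g ->
    measurable_fun setT (fun x => F (unit_vec (g x))).
  by move=> mg; apply: (measurableT_comp mF); exact: measurable_unit_comp.
pose H (z : RR * V) := (enorm z.2 * ((0 < enorm z.2 <= slope_cos z.1)%R%:R *
  F (unit_vec (cons_pair (z.1, unit_vec z.2)))))%:E : \bar R.
have mH : measurable_fun setT H.
  apply/measurable_EFinP; apply: measurable_funM.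
    by apply: measurable_enorm_comp; exact: measurable_snd.
  apply: measurable_funM.
    apply: measurable_enorm_itv; first exact: measurable_snd.
    by apply: (measurableT_comp measurable_slope_cos); exact: measurable_fst.
  apply: mFu; apply: measurable_cons_comp; first exact: measurable_fst.
  by apply: measurable_unit_comp; exact: measurable_snd.
have H0 z : 0 <= H z by rewrite lee_fin !mulr_ge0// enorm_ge0.
have mHy y : measurable_fun setT (fun t => H (t, y)).
  by apply: (measurableT_comp mH); exact: measurable_pair2.
have mHt t : measurable_fun setT (fun y => H (t, y)).
  by apply: (measurableT_comp mH); exact: measurable_pair1.
transitivity (\int[lam]_y \int[leb]_t H (t, y)).
  (* The substitution x = |y| t breaks down at y = 0, a null set because m > 0. *)
  apply: ge0_ae_eq_integral => //.
  - apply: (@measurable_fun_fubini_tonelli_G _ _ _ _ _ leb (f \o @cons_pair RR m)).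
      exact: (measurableT_comp mf (@measurable_cons_pair _ RR m)).
    by move=> z; exact: f0.
  - exact: (@measurable_fun_fubini_tonelli_G _ _ _ _ _ leb H).
  - by move=> y _; exact: integral_ge0.
  - by move=> y _; exact: integral_ge0.
  exists [set y : V | enorm y = 0%R]; split.
  - exact: measurable_enorm0.
  - exact: measure_enorm0.
  move=> y /= hy; apply: contrapT => /eqP y0; apply: hy => _.
  have {}y0 : (0 < enorm y)%R by rewrite lt_def y0 enorm_ge0.
  have mfy : measurable_fun setT (fun x => f (cons_pair (x, y))).
    by apply: (measurableT_comp mf); exact: measurable_cons_snd.
  transitivity ((enorm y)%:E * \int[leb]_t f (cons_pair ((enorm y * t)%R : RR, y))).
    rewrite (integral_scale1 y0 (f := fun x => f (cons_pair (x, y))))//.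
    by rewrite muleA -EFinM divff ?gt_eqF// mul1e.
  rewrite -ge0_integralZl_EFin//; last 2 first.
  - by apply: (measurableT_comp mfy); exact: measurable_scale1.
  - exact: ltW.
  apply: eq_integral => t _; rewrite /f /H/= -!EFinM cons_unit//; congr (_%:E).
  rewrite unit_vecZ// indic_puncturedE enormZ ?(ltW y0)// enorm_cons.
  have -> : (enorm (unit_vec y) ^+ 2 = 1)%R by rewrite sqr_enorm enorm_unit.
  have s0 := slope_cos_gt0 t; rewrite /slope_cos addrC in s0 *.
  rewrite y0/= pmulr_rgt0// -invr_gt0 s0/=.
  set q := Num.sqrt _ in s0 *; rewrite invr_gt0 in s0.
  by rewrite -[in RHS](mul1r q^-1%R) ler_pdivlMr.
pose J t := (slope_cos t ^+ m.+1)%:E *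
  \int[sphere_unif R m]_u (F (unit_vec (cons_pair (t : RR, u))))%:E.
have J0 t : 0 <= J t.
  rewrite mule_ge0//; first by rewrite lee_fin exprn_ge0// ltW// slope_cos_gt0.
  by apply: integral_ge0 => u _; rewrite lee_fin.
have mJ : measurable_fun setT J.
  apply: emeasurable_funM.
    by apply/measurable_EFinP; apply: measurable_funX; exact: measurable_slope_cos.
  apply: (@measurable_fun_fubini_tonelli_F _ _ _ _ _ (sphere_unif R m)
    (fun z : RR * V => (F (unit_vec (cons_pair (z.1, z.2))))%:E)).
    apply/measurable_EFinP; apply: mFu; apply: measurable_cons_comp.
      exact: measurable_fst.
    exact: measurable_snd.
  by move=> z; rewrite lee_fin.
rewrite -(fubini_tonelli H)// -ge0_integralZl_EFin//; last 2 first.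
- by move=> t _; exact: J0.
- by rewrite mulr_ge0// ltW.
apply: eq_integral => t _.
have s0 := slope_cos_gt0 t.
transitivity ((slope_cos t ^+ m)%:E * \int[lam]_y H (t, vscale (slope_cos t) y)).
  rewrite (integral_vscale s0 (mHt t))// muleA -EFinM -exprMn divff ?gt_eqF//.
  by rewrite expr1n mul1e.
transitivity ((slope_cos t ^+ m)%:E * ((slope_cos t)%:E *
   \int[lam]_y (\1_P y * (enorm y * F (unit_vec (cons_pair (t, unit_vec y)))))%:E)).
  congr (_ * _); rewrite -ge0_integralZl_EFin//; last 3 first.
  - by move=> y _; rewrite lee_fin !mulr_ge0// enorm_ge0.
  - apply/measurable_EFinP; apply: measurable_funM.
      exact: measurable_indic (@measurable_punctured_ball R m).
    apply: measurable_funM; first exact: measurable_enorm.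
    apply: mFu; apply: measurable_cons_comp => //; exact: measurable_unit_vec.
  - exact: ltW.
  apply: eq_integral => y _; rewrite /H/= enormZ ?(ltW s0)// unit_vecZ// indic_puncturedE -EFinM.
  rewrite pmulr_rgt0//.
  have -> : (slope_cos t * enorm y <= slope_cos t)%R = (enorm y <= 1)%R.
    by apply/idP/idP => hh; [rewrite -(ler_pM2l s0) mulr1|rewrite -[leRHS]mulr1 ler_pM2l].
  by congr (_%:E); ring.
(* The Jacobian |y| of the substitution is what [integral_radial] removes, at the price of the
   constant [c]. *)
rewrite (hc (fun u => F (unit_vec (cons_pair (t, u))))) //; last first.
  by apply: mFu; apply: measurable_cons_comp => //; exact: measurable_id.
rewrite (integral_sphere m_gt0 (F := fun u => (F (unit_vec (cons_pair (t, u))))%:E))//; last 2 first.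
- by apply/measurable_EFinP; apply: mFu; apply: measurable_cons_comp => //; exact: measurable_id.
- by move=> u; rewrite lee_fin.
set Z := \int[lam]_y _.
rewrite !muleA -!EFinM; congr (_%:E * _).
by rewrite exprS; field; rewrite gt_eqF.
Qed.

End recursion.

(** * Spherical caps *)

Section slope.
Context (R : realType).
Implicit Types (c t h : R).

Lemma slope_cos_sq t : slope_cos t ^+ 2 = (1 + t ^+ 2)^-1 :> R.
Proof. by rewrite exprVn sqr_sqrtr// addr_ge0// sqr_ge0. Qed.

Lemma slope_cos_le1 t : slope_cos t <= 1 :> R.
Proof.
rewrite -(@ler_pXn2r _ 2)// ?nnegrE ?(ltW (slope_cos_gt0 _))// slope_cos_sq expr1n.
by rewrite invf_le1 ?ltr_pwDl ?sqr_ge0// lerDl sqr_ge0.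
Qed.

Definition slope_sin t : R := t * slope_cos t.

Lemma slope_sin_sq t : slope_sin t ^+ 2 = 1 - slope_cos t ^+ 2.
Proof.
rewrite exprMn slope_cos_sq; field.
by rewrite gt_eqF// ltr_pwDl ?sqr_ge0.
Qed.

Lemma slope_sin_ge0 t : (0 <= slope_sin t) = (0 <= t).
Proof. by rewrite pmulr_lge0 ?slope_cos_gt0. Qed.

Lemma slope_sin_le c t : (slope_sin c <= slope_sin t) = (c <= t).
Proof.
have pos (a b : R) : 0 <= a -> 0 <= b -> (slope_sin a <= slope_sin b) = (a <= b).
  move=> a0 b0; rewrite -(@ler_pXn2r _ 2)// ?nnegrE ?slope_sin_ge0//.
  rewrite !slope_sin_sq lerD2l lerN2 !slope_cos_sq lef_pV2 ?posrE ?ltr_pwDl ?sqr_ge0//.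
  by rewrite lerD2l ler_pXn2r.
have sinN (a : R) : slope_sin (- a) = - slope_sin a by rewrite /slope_sin /slope_cos sqrrN mulNr.
have [c0|c0] := leP 0 c; have [t0|t0] := leP 0 t.
- exact: pos.
- rewrite [RHS]leNgt (lt_le_trans t0 c0); apply/negbTE; rewrite -ltNge.
  by apply: (@lt_le_trans _ _ 0); rewrite ?slope_sin_ge0// ltNge slope_sin_ge0 -ltNge.
- rewrite [RHS](le_trans (ltW c0) t0); apply: (@le_trans _ _ 0); rewrite ?slope_sin_ge0//.
  by rewrite leNgt; apply/negP => /ltW; rewrite slope_sin_ge0 leNgt c0.
- rewrite -lerN2 -!sinN pos ?oppr_ge0 ?(ltW c0) ?(ltW t0)//; exact: lerN2.
Qed.

(** The squared cosines are 1 / (1 + t^2) and 1 / (1 + T^2), whose ratio is 1 + (T^2 - t^2) / (1 +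
    t^2) <= 1 + 2 e <= exp (2 e). A square root and a k-th power give the factor. *)
Lemma slope_cos_ratio (k : nat) t T (e : R) : 0 <= e -> T ^+ 2 - t ^+ 2 <= 2 * e ->
  slope_cos t ^+ k <= expR (k%:R * e) * slope_cos T ^+ k :> R.
Proof.
move=> e0 tT; rewrite expRM_natl -exprMn.
have st := slope_cos_gt0 t; have sT := slope_cos_gt0 T.
apply: lerXn2r; rewrite ?nnegrE ?mulr_ge0 ?expR_ge0 ?(ltW st) ?(ltW sT)//.
rewrite -(@ler_pXn2r _ 2)// ?nnegrE ?mulr_ge0 ?expR_ge0 ?(ltW st) ?(ltW sT)//.
rewrite exprMn !slope_cos_sq -expRM_natl.
have t1 : 0 < 1 + t ^+ 2 by rewrite ltr_pwDl ?sqr_ge0.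
have T1 : 0 < 1 + T ^+ 2 by rewrite ltr_pwDl ?sqr_ge0.
rewrite -[leLHS]mul1r ler_pdivrMr// mulrAC ler_pdivlMr// mul1r.
apply: (@le_trans _ _ ((1 + 2 * e) * (1 + t ^+ 2))); last first.
  by rewrite ler_pM2r// expR_ge1Dx.
have : 0 <= e * t ^+ 2 by rewrite mulr_ge0// sqr_ge0.
by nra.
Qed.

End slope.

Section cap.
Local Open Scope ereal_scope.
Context (R : realType) (m : nat).
Local Notation V := (vec R m.+1).
Local Notation sig := (sphere_unif R m.+1).

Lemma measurable_cap (w : V) (b : R) :
  measurable_fun setT (fun x : V => (b <= dotp x w)%R%:R : R).
Proof.
apply: measurable_natb; apply: measurable_fun_ler => //.
by apply: measurable_dotp_comp => //; exact: measurable_id.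
Qed.

(** The cap has height b on the sphere of R^(m+1); its pole is fixed here and freed by
    [integral_cap]. Slicing a sphere of R^(m+2) thus leads from [Psi m.+1] to [Psi m]. *)
Definition Psi (b : R) : R :=
  fine (\int[sig]_x ((b <= dotp x (basis_vec R ord0))%R%:R)%:E).

Lemma integral_cap (w : V) (b : R) : dotp w w = 1%R ->
  \int[sig]_x ((b <= dotp x w)%R%:R)%:E = (Psi b)%:E.
Proof.
move=> w1; rewrite /Psi fineK; last first.
  rewrite ge0_fin_numE; last by apply: integral_ge0 => x _; rewrite lee_fin.
  apply: (@le_lt_trans _ _ (\int[sig]_x (cst 1 x))); last first.
    by rewrite integral_cst// mul1e (le_lt_trans (probability_le1 _ _))// ltry.
  apply: le_integral_sphere => //; first by apply/measurable_EFinP; exact: measurable_cap.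
  by move=> x _; rewrite /cst lee_fin lern1 leq_b1.
apply: (@integral_sphere_marginal R m.+1 (ltn0Sn m) w (basis_vec R ord0) (fun t => ((b <= t)%R%:R)%:E)) => //.
- exact: dotp_basis_diag.
- by apply/measurable_EFinP; apply: measurable_natb; exact: measurable_fun_ler.
Qed.

Let e1 : V := basis_vec R ord0.
Let e1_unit : dotp e1 e1 = 1%R. Proof. exact: dotp_basis_diag. Qed.

Lemma Psi_ge0 b : (0 <= Psi b)%R.
Proof. by rewrite -lee_fin -(integral_cap _ e1_unit) integral_ge0// => x _; rewrite lee_fin. Qed.

Lemma Psi_le1 b : (Psi b <= 1)%R.
Proof.
rewrite -lee_fin -(integral_cap _ e1_unit).
apply: (@le_trans _ _ (\int[sig]_x (cst 1 x))); last first.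
  by rewrite integral_cst// mul1e probability_le1.
apply: le_integral_sphere => //; first by apply/measurable_EFinP; exact: measurable_cap.
by move=> x _; rewrite /cst lee_fin lern1 leq_b1.
Qed.

Lemma Psi_homo b b' : (b <= b')%R -> (Psi b' <= Psi b)%R.
Proof.
move=> bb; rewrite -lee_fin -!(integral_cap _ e1_unit).
apply: le_integral_sphere => //; try by apply/measurable_EFinP; exact: measurable_cap.
move=> x _; rewrite lee_fin ler_nat; case: (leP b') => // h.
by rewrite (le_trans bb h).
Qed.

Lemma Psi_tail (e : R) : (0 <= e)%R -> (e ^+ 2 <= 2^-1)%R ->
  (Psi e <= Num.sqrt (1 - e ^+ 2) ^+ m.+1)%R.
Proof. by move=> e0 e2; rewrite -lee_fin -(integral_cap _ e1_unit); exact: sphere_tail. Qed.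

(** Two opposite closed hemispheres cover the sphere and have equal measure. *)
Lemma Psi0_ge : (2^-1 <= Psi 0)%R.
Proof.
suff : (1 <= Psi 0 + Psi 0)%R by move=> ?; lra.
have ne1 : dotp (vscale (-1) e1) (vscale (-1) e1) = 1%R.
  by rewrite dotpZl dotpZr e1_unit; ring.
rewrite -lee_fin EFinD -{1}(integral_cap _ e1_unit) -(integral_cap _ ne1).
rewrite -ge0_integralD//; last 2 first.
- by apply/measurable_EFinP; exact: measurable_cap.
- by apply/measurable_EFinP; exact: measurable_cap.
apply: (@le_trans _ _ (\int[sig]_x (cst 1 x))).
  by rewrite integral_cst// mul1e; rewrite [leRHS]probability_setT.
apply: le_integral_sphere => //.
- apply: emeasurable_funD; by apply/measurable_EFinP; exact: measurable_cap.
- by move=> x; rewrite -EFinD lee_fin addr_ge0.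
- move=> x _; rewrite /cst -EFinD lee_fin dotpZr mulN1r oppr_ge0 -natrD ler1n.
  by case: (lerP 0 (dotp x e1)) => // /ltW ->.
Qed.

End cap.

Section cap_slope.
Local Open Scope ereal_scope.
Context (R : realType) (m : nat) (m_gt0 : (0 < m)%N).
Local Notation V := (vec R m.+1).
Local Notation sig := (sphere_unif R m.+1).
Local Notation leb := (@lebesgue_measure R).
Local Notation RR := (measurableTypeR R).

Lemma dotp_unit_cons (t : RR) (u : vec R m) (a : R) (y : vec R m) : dotp u u = 1%R ->
  dotp (unit_vec (cons_pair (t, u))) (cons_pair (a : RR, y)) = (slope_cos t * (t * a + dotp u y))%R.
Proof.
by move=> u1; rewrite unit_vecE dotpZl dotp_cons enorm_cons sqr_enorm u1 addrC.
Qed.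

Lemma basis_vec0 : basis_vec R (ord0 : 'I_m.+1) = cons_pair (1%R : RR, [tuple 0%R : RR | _ < m]).
Proof.
apply: eq_from_tnth => k; rewrite tnth_mktuple.
case: (unliftP ord0 k) => [j ->|->]; last by rewrite (tnth_nth (0%R : RR)).
by rewrite tnthS tnth_mktuple.
Qed.

Lemma dotp_unit_cons0 (t : RR) (u : vec R m) : dotp u u = 1%R ->
  dotp (unit_vec (cons_pair (t, u))) (basis_vec R ord0) = slope_sin t.
Proof.
move=> u1; rewrite basis_vec0 dotp_unit_cons// mulr1 [X in (_ + X)%R](_ : _ = 0%R).
  by rewrite addr0 mulrC.
by rewrite /dotp big1// => k _; rewrite tnth_mktuple mulr0.
Qed.

Lemma measurable_ge (c : R) : measurable_fun setT (fun t : RR => (c <= t)%R%:R : R).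
Proof. by apply: measurable_natb; apply: measurable_fun_ler => //; exact: measurable_id. Qed.

Lemma measurable_slope_cosX k : measurable_fun setT (fun t : RR => slope_cos t ^+ k : R)%R.
Proof. by apply: measurable_funX; exact: measurable_slope_cos. Qed.

Lemma Psi_slope : exists2 K : R, (0 <= K)%R & 
  (forall c, (Psi m (slope_sin c))%:E =
    K%:E * \int[leb]_t (slope_cos t ^+ m.+1 * (c <= t)%R%:R)%:E).
Proof.
have [K K0 hK] := sphere_recursion R m_gt0.
exists K => // c; rewrite -(integral_cap _ (dotp_basis_diag R ord0)).
rewrite (hK (fun x => (slope_sin c <= dotp x (basis_vec R ord0))%R%:R)); last 2 first.
- exact: measurable_cap.
- by move=> x; rewrite ler0n lern1 leq_b1.
congr (_ * _); apply: eq_integral => t _; rewrite EFinM; congr (_ * _).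
transitivity (\int[sphere_unif R m]_u (cst ((c <= t)%R%:R)%:E u)).
  apply: eq_integral_sphere => //.
  - apply/measurable_EFinP; apply: (measurableT_comp (measurable_cap _ _)).
    by apply: measurable_unit_comp; apply: measurable_cons_comp => //; exact: measurable_id.
  - by move=> x; rewrite lee_fin.
  - by move=> u u1; rewrite dotp_unit_cons0// slope_sin_le.
by rewrite integral_cst// [X in _ * X]probability_setT mule1.
Qed.

Lemma integral_indic_co (a b : R) : (a <= b)%R ->
  \int[leb]_t ((a <= t < b)%R%:R)%:E = (b - a)%:E.
Proof.
move=> ab; have mJ : measurable (`[a, b[%classic : set RR) by exact: measurable_itv.
transitivity (\int[leb]_t (\1_(`[a, b[%classic : set RR) t)%:E).
  apply: eq_integral => t _; congr (_%:E); rewrite indicE; congr (_%:R)%R.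
  by congr nat_of_bool; apply/idP/idP; rewrite inE/= in_itv.
rewrite integral_indic// setIT; etransitivity; first exact: lebesgue_measure_itv.
rewrite /= lte_fin; case: ltgtP ab => // -> _; by rewrite subrr.
Qed.

(** Both bounds carry the same unknown [K], so that it cancels when they are combined. The first
    adds the mass of the slab between slopes c and c'; the second keeps only the slab of width h
    beyond c, where the density is at least its value at c + h. *)
Lemma Psi_slope_bounds : exists2 K : R, (0 <= K)%R &
  (forall c c' S, (c <= c')%R -> (0 <= S)%R ->
    (forall t, (c <= t < c')%R -> (slope_cos t ^+ m.+1 <= S)%R) ->
    (Psi m (slope_sin c) <= Psi m (slope_sin c') + K * S * (c' - c))%R) /\
  (forall c h, (0 <= c)%R -> (0 <= h)%R ->
    (K * (slope_cos (c + h)%R ^+ m.+1 * h) <= Psi m (slope_sin c))%R).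
Proof.
have [K K0 hK] := Psi_slope; exists K => //; split.
- move=> c c' S cc S0 hS; rewrite -lee_fin EFinD hK hK -mulrA (EFinM K).
  rewrite -ge0_muleDr; last 2 first.
  - apply: integral_ge0 => t _; rewrite lee_fin mulr_ge0// exprn_ge0// ltW//; exact: slope_cos_gt0.
  - by rewrite lee_fin mulr_ge0// subr_ge0.
  apply: lee_wpmul2l; first by rewrite lee_fin.
  rewrite EFinM -(integral_indic_co cc) -ge0_integralZl_EFin//; last first.
    apply/measurable_EFinP; apply: measurable_natb; apply: measurable_and.
      by apply: measurable_fun_ler => //; exact: measurable_id.
    by apply: measurable_fun_ltr => //; exact: measurable_id.
  rewrite -ge0_integralD//; last 4 first.
  - by move=> t _; rewrite lee_fin mulr_ge0// exprn_ge0// ltW// slope_cos_gt0.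
  - by apply/measurable_EFinP; apply: measurable_funM; [exact: measurable_slope_cosX|exact: measurable_ge].
  - by move=> t _; rewrite lee_fin mulr_ge0.
  - apply/measurable_EFinP; apply: measurable_funM => //; apply: measurable_natb; apply: measurable_and.
      by apply: measurable_fun_ler => //; exact: measurable_id.
    by apply: measurable_fun_ltr => //; exact: measurable_id.
  apply: ge0_le_integral => //.
  - by move=> t _; rewrite lee_fin mulr_ge0// exprn_ge0// ltW// slope_cos_gt0.
  - by apply/measurable_EFinP; apply: measurable_funM; [exact: measurable_slope_cosX|exact: measurable_ge].
  - apply: emeasurable_funD; apply/measurable_EFinP; apply: measurable_funM => //.
    + exact: measurable_slope_cosX.
    + exact: measurable_ge.
    + apply: measurable_natb; apply: measurable_and.
        by apply: measurable_fun_ler => //; exact: measurable_id.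
      by apply: measurable_fun_ltr => //; exact: measurable_id.
  - move=> t _; rewrite -EFinM -EFinD lee_fin.
    have [ct|ct] := leP c t; last by rewrite mulr0 addr_ge0// mulr_ge0// exprn_ge0// ltW// slope_cos_gt0.
    have [c't|c't] := leP c' t; first by rewrite /= mulr0 addr0.
    by rewrite /= mulr0 add0r !mulr1 hS// ct c't.
- move=> c h c0 h0; rewrite -lee_fin EFinM hK.
  apply: lee_wpmul2l; first by rewrite lee_fin.
  have ch : (c <= c + h)%R by rewrite lerDl.
  have hh : (h = c + h - c)%R by ring.
  rewrite {2}hh EFinM -(integral_indic_co ch) -ge0_integralZl_EFin//; last 2 first.
  - apply/measurable_EFinP; apply: measurable_natb; apply: measurable_and.
      by apply: measurable_fun_ler => //; exact: measurable_id.
    by apply: measurable_fun_ltr => //; exact: measurable_id.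
  - by rewrite exprn_ge0// ltW// slope_cos_gt0.
  apply: ge0_le_integral => //.
  - by move=> t _; rewrite -EFinM lee_fin mulr_ge0// exprn_ge0// ltW// slope_cos_gt0.
  - apply/measurable_EFinP; apply: measurable_funM => //; apply: measurable_natb; apply: measurable_and.
      by apply: measurable_fun_ler => //; exact: measurable_id.
    by apply: measurable_fun_ltr => //; exact: measurable_id.
  - by apply/measurable_EFinP; apply: measurable_funM; [exact: measurable_slope_cosX|exact: measurable_ge].
  - move=> t _; rewrite -EFinM lee_fin.
    have [ct|ct] := leP c t; last by rewrite !mulr0.
    have [c't|c't] := leP (c + h)%R t.
      by rewrite /= mulr0 mulr1 exprn_ge0// ltW// slope_cos_gt0.
    rewrite /= !mulr1; apply: lerXn2r; rewrite ?nnegrE ?(ltW (slope_cos_gt0 _))//.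
    rewrite -(@ler_pXn2r _ 2)// ?nnegrE ?(ltW (slope_cos_gt0 _))// !slope_cos_sq.
    by rewrite lef_pV2 ?posrE ?ltr_pwDl ?sqr_ge0// lerD2l ler_pXn2r// ?nnegrE; lra.
Qed.

(** The slab between c and c' is charged to the slab of width h beyond c': the widths have ratio (c'
    - c) / h and the densities at most the exponential. The condition -c' <= c gives t + (c' + h) >=
    0 for t in the slab, so that (c' + h)^2 - t^2 <= 2 (c' - c + h) (c' + h). *)
Lemma Psi_log_lipschitz (c c' h : R) : (c <= c')%R -> (- c' <= c)%R -> (0 < h)%R ->
  (Psi m (slope_sin c) <= Psi m (slope_sin c') *
    (1 + expR (m.+1%:R * ((c' - c + h) * (c' + h))) * ((c' - c) / h)))%R.
Proof.
move=> cc c'c h0; have [K K0 [hU hL]] := Psi_slope_bounds.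
have c'0 : (0 <= c')%R by lra.
set A := expR _.
have A0 : (0 <= A)%R by exact: expR_ge0.
set s := (slope_cos (c' + h)%R ^+ m.+1)%R.
have s0 : (0 <= s)%R by rewrite exprn_ge0// ltW// slope_cos_gt0.
apply: le_trans (hU c c' (A * s)%R cc _ _) _; first by rewrite mulr_ge0.
- move=> t /andP[ct tc']; apply: slope_cos_ratio.
    by rewrite mulr_ge0//; lra.
  by nra.
have := hL c' h c'0 (ltW h0); rewrite -/s => hs.
rewrite [leRHS]mulrDr mulr1 lerD2l.
have -> : (K * (A * s) * (c' - c) = K * (s * h) * (A * ((c' - c) / h)))%R.
  by field; rewrite gt_eqF.
apply: ler_wpM2r => //.
by rewrite mulr_ge0// divr_ge0 ?subr_ge0// ltW.
Qed.

End cap_slope.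

Section threshold.
Local Open Scope ereal_scope.
Context (R : realType) (m : nat) (m_gt0 : (0 < m)%N).
Local Notation V := (vec R m.+1).
Local Notation sig := (sphere_unif R m.+1).

Lemma sphere_pair_cap (t : R) :
  (sig \x sig) [set x : V * V | (t <= dotp x.1 x.2)%R] = (Psi m t)%:E.
Proof.
set S := [set _ | _].
have mb : measurable_fun setT (fun x : V * V => (t <= dotp x.1 x.2)%R).
  apply: measurable_fun_ler => //; apply: measurable_dotp_comp.
    exact: measurable_fst.
  exact: measurable_snd.
have mS : measurable S.
  rewrite (_ : S = (fun x : V * V => (t <= dotp x.1 x.2)%R) @^-1` [set true]).
    by rewrite -[X in measurable X]setTI; exact: mb.
  by apply/seteqP; split => x /=.
have mf : measurable_fun setT (fun x : V * V => ((t <= dotp x.1 x.2)%R%:R)%:E : \bar R).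
  by apply/measurable_EFinP; exact: measurable_natb.
rewrite -(setIT S) -integral_indic//.
transitivity (\int[sig \x sig]_x ((t <= dotp x.1 x.2)%R%:R)%:E).
  apply: eq_integral => x _; congr (_%:E); rewrite indicE; congr (_%:R)%R.
  by congr nat_of_bool; apply/idP/idP; rewrite inE.
rewrite (fubini_tonelli2 (fun x : V * V => ((t <= dotp x.1 x.2)%R%:R)%:E))//.
transitivity (\int[sig]_x (cst (Psi m t)%:E x)).
  apply: eq_integral_sphere => //.
  - apply: (@measurable_fun_fubini_tonelli_G _ _ _ _ _ sig (fun x : V * V => ((t <= dotp x.1 x.2)%R%:R)%:E)) => //.
  - by move=> y; apply: integral_ge0 => x _; rewrite lee_fin.
  - by move=> y; rewrite /cst lee_fin Psi_ge0.
  - by move=> y y1; rewrite /fubini_G/= integral_cap.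
by rewrite integral_cst// [X in _ * X]probability_setT mule1.
Qed.

(** The density of the slope is at most K, so the cap measure is K-Lipschitz in the slope. *)
Lemma continuous_Psi_slope : continuous (fun c => Psi m (slope_sin c) : R).
Proof.
have [K K0 [hU _]] := Psi_slope_bounds R m_gt0.
have hU1 (c c' : R) : (c <= c')%R -> (Psi m (slope_sin c) - Psi m (slope_sin c') <= K * (c' - c))%R.
  move=> cc; rewrite lerBlDl; have := hU c c' 1%R cc ler01; rewrite mulr1; apply.
  by move=> t _; rewrite exprn_ile1 ?slope_cos_le1// ltW// slope_cos_gt0.
have lip (c c' : R) : (`|Psi m (slope_sin c) - Psi m (slope_sin c')| <= K * `|c - c'|)%R.
  wlog cc : c c' / (c <= c')%R => [hw|].
    by have [/hw//|/ltW/hw] := leP c c'; rewrite distrC (distrC c').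
  rewrite ger0_norm; last by rewrite subr_ge0 Psi_homo// slope_sin_le.
  by rewrite ler0_norm ?subr_le0// opprB hU1.
move=> c; apply/cvgrPdist_le => e e0; apply/nbhs_ballP.
exists (e / (K + 1))%R => /=; first by rewrite divr_gt0// ltr_wpDl.
move=> t /=; rewrite /ball/= => ct; apply: le_trans (lip _ _) _.
have K1 : (0 < K + 1)%R by rewrite ltr_wpDl.
move: ct; rewrite ltr_pdivlMr// => /ltW; apply: le_trans.
by rewrite mulrC ler_wpM2l// lerDl.
Qed.

(** A threshold exists by the intermediate value theorem in the slope, between slope 0, where the
    cap has measure at least 1/2, and slope 1. Given existence, [xget] returns a solution. *)
Lemma Psi_tau (p : R) : (p <= 2^-1)%R -> (Psi m (slope_sin 1%R) <= p)%R ->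
  Psi m (tau m.+1 p) = p.
Proof.
move=> p2 p1.
have [|||c _ hc] := @IVT R (fun c => Psi m (slope_sin c)) 0%R 1%R p.
- exact: ler01.
- by apply: continuous_subspaceT => x; exact: continuous_Psi_slope.
- have s0 : slope_sin (0 : R)%R = 0%R by rewrite /slope_sin mul0r.
  rewrite ge_min le_max p1 s0 (le_trans p2 (Psi0_ge R m)) orbT//=.
have /= : [set t : R | (sig \x sig) [set x : V * V | (t <= dotp x.1 x.2)%R] = p%:E] (tau m.+1 p).
  by apply: xgetPex; exists (slope_sin c); rewrite /= sphere_pair_cap hc.
by rewrite sphere_pair_cap => -[].
Qed.

End threshold.

(** * Intersections of two caps *)

Section weighted.
Local Open Scope ereal_scope.
Context (R : realType) (K : R) (K0 : (0 <= K)%R) (k : nat).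
Local Notation leb := (@lebesgue_measure R).
Local Notation RR := (measurableTypeR R).
Implicit Type f g : RR -> R.

(** With the constant [K] of [pair_recursion] and k = m + 2 this is the expectation of f over the
    slope of a uniform point, since it then sends 1 to 1. *)
Definition slope_mean f : \bar R := K%:E * \int[leb]_t (slope_cos t ^+ k * f t)%:E.

Let mcf f : measurable_fun setT f ->
  measurable_fun setT (fun t : RR => (slope_cos t ^+ k * f t)%:E : \bar R).
Proof.
by move=> mf; apply/measurable_EFinP; apply: measurable_funM => //; exact: measurable_slope_cosX.
Qed.

Let sk0 (t : RR) : (0 <= slope_cos t ^+ k)%R.
Proof. by rewrite exprn_ge0// ltW// slope_cos_gt0. Qed.

Lemma slope_mean_le f g : measurable_fun setT f -> (forall t, 0 <= f t)%R ->
  measurable_fun setT g -> (forall t, f t <= g t)%R -> slope_mean f <= slope_mean g.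
Proof.
move=> mf f0 mg fg; apply: lee_wpmul2l; first by rewrite lee_fin.
apply: ge0_le_integral => //.
- by move=> t _; rewrite lee_fin mulr_ge0.
- exact: mcf.
- exact: mcf.
- by move=> t _; rewrite lee_fin ler_wpM2l.
Qed.

Lemma slope_meanD f g : measurable_fun setT f -> (forall t, 0 <= f t)%R ->
  measurable_fun setT g -> (forall t, 0 <= g t)%R ->
  slope_mean (fun t => f t + g t)%R = slope_mean f + slope_mean g.
Proof.
move=> mf f0 mg g0; rewrite /slope_mean -ge0_muleDr; last 2 first.
- by apply: integral_ge0 => t _; rewrite lee_fin mulr_ge0.
- by apply: integral_ge0 => t _; rewrite lee_fin mulr_ge0.
rewrite -ge0_integralD//; last 4 first.
- by move=> t _; rewrite lee_fin mulr_ge0.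
- exact: mcf.
- by move=> t _; rewrite lee_fin mulr_ge0.
- exact: mcf.
by congr (_ * _); apply: eq_integral => t _; rewrite -EFinD mulrDr.
Qed.

Lemma slope_meanZ a f : (0 <= a)%R -> measurable_fun setT f -> (forall t, 0 <= f t)%R ->
  slope_mean (fun t => a * f t)%R = a%:E * slope_mean f.
Proof.
move=> a0 mf f0; rewrite /slope_mean muleCA; congr (_ * _).
rewrite -ge0_integralZl_EFin//; last 2 first.
- by move=> t _; rewrite lee_fin mulr_ge0.
- exact: mcf.
by apply: eq_integral => t _; rewrite -EFinM mulrCA.
Qed.

End weighted.

Section pair.
Local Open Scope ereal_scope.
Context (R : realType) (m : nat) (m_gt0 : (0 < m)%N).
Local Notation V := (vec R m.+2).
Local Notation W := (vec R m.+1).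
Local Notation sig := (sphere_unif R m.+2).
Local Notation RR := (measurableTypeR R).
Local Notation leb := (@lebesgue_measure R).
Local Notation e1 := (basis_vec R (ord0 : 'I_m.+2)).

Lemma cons_pair_eta (x : V) : exists a y, x = cons_pair (a : RR, y : W).
Proof.
exists (thead x), [tuple of behead x]; apply: val_inj => /=.
by rewrite {1}(tuple_eta x).
Qed.

Definition pair_cap (t : R) (w w' : V) : \bar R :=
  \int[sig]_x ((t <= dotp x w)%R%:R * (t <= dotp x w')%R%:R)%:E.

(** A reflection carries w to the axis along which the sphere is sliced; y collects the remaining
    coordinates of the image of w'. *)
Lemma pair_cap_axis (t : R) (w w' : V) : dotp w w = 1%R -> dotp w' w' = 1%R ->
  exists2 y : W, dotp y y = (1 - dotp w w' ^+ 2)%R &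
    pair_cap t w w' = pair_cap t e1 (cons_pair (dotp w w' : RR, y)).
Proof.
move=> w1 w'1; have [U [mU Ud Uw Ui]] := sphere_rotation (ltn0Sn _) w1 (dotp_basis_diag R ord0).
have [a [y hy]] := cons_pair_eta (U w').
have ha : dotp w w' = a.
  by rewrite -Ud Uw hy basis_vec0 dotp_cons mul1r /dotp big1 ?addr0// => k _; rewrite tnth_mktuple mul0r.
exists y.
  by have := Ud w' w'; rewrite hy dotp_cons w'1 ha expr2 => <-; rewrite addrAC subrr add0r.
rewrite ha -hy /pair_cap -[RHS]Ui//.
  by apply: eq_integral => x _; rewrite -Uw !Ud.
by apply/measurable_EFinP; apply: measurable_funM; exact: measurable_cap.
Qed.

(* Let x in the sphere have slope s and direction u with respect to w, and let
   y be the normalized component of w' orthogonal to w. If <w, w'> = rho, then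
   t <= <x, w'> iff cap_arg t rho s <= <u, y>. *)
Definition cap_arg (t rho : R) (s : RR) : R :=
  ((t / slope_cos s - s * rho) / Num.sqrt (1 - rho ^+ 2))%R.

Lemma measurable_Psi_arg t rho : measurable_fun setT (fun s : RR => Psi m (cap_arg t rho s)).
Proof.
apply: (@measurableT_comp _ _ _ _ _ _ (Psi m : R -> R)).
  by apply: nonincreasing_measurable => // x y; exact: Psi_homo.
apply: measurable_funM => //; apply: measurable_funB.
  apply: measurable_funM => //; apply: measurable_inv_comp; first exact: measurable_slope_cos.
  by move=> x; rewrite ltW// slope_cos_gt0.
by apply: measurable_funM => //; exact: measurable_id.
Qed.

(** One [K] for all four statements makes them expectations under a single law of the slope. With A
    the indicator of the cap around w, and H the conditional measure of the cap around w', they read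
    p = E A = E H and [pair_cap] = E (A H). The second statement gives the tail of negative
    slopes. *)
Lemma pair_recursion : exists2 K : R, (0 <= K)%R &
  [/\ forall t, (Psi m.+1 t)%:E = slope_mean K m.+2 (fun s => (t <= slope_sin s)%R%:R),
      forall t, (Psi m.+1 t)%:E = slope_mean K m.+2 (fun s => (t <= - slope_sin s)%R%:R),
      1 = slope_mean K m.+2 (fun=> 1%R) &
      forall t rho (y : W), (rho ^+ 2 < 1)%R -> dotp y y = (1 - rho ^+ 2)%R ->
      (Psi m.+1 t)%:E = slope_mean K m.+2 (fun s => Psi m (cap_arg t rho s)) /\
      pair_cap t e1 (cons_pair (rho : RR, y)) =
        slope_mean K m.+2 (fun s => (t <= slope_sin s)%R%:R * Psi m (cap_arg t rho s))%R].
Proof.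
have [K K0 hK] := sphere_recursion R (ltn0Sn m).
exists K => //.
have mcons (s : RR) : measurable_fun setT (fun u : W => unit_vec (cons_pair (s, u))).
  by apply: measurable_unit_comp; apply: measurable_cons_comp => //; exact: measurable_id.
have cstI (a : R) : \int[sphere_unif R m.+1]_u (cst a%:E u) = a%:E.
  by rewrite integral_cst// [X in _ * X]probability_setT mule1.
have key (F : V -> R) (g : RR -> R) : measurable_fun setT F -> (forall x, 0 <= F x <= 1)%R ->
    (forall s, \int[sphere_unif R m.+1]_u (F (unit_vec (cons_pair (s, u))))%:E = (g s)%:E) ->
    \int[sig]_x (F x)%:E = slope_mean K m.+2 g.
  move=> mF F01 hg; rewrite hK//; congr (_ * _); apply: eq_integral => s _.
  by rewrite hg EFinM.
have n01 (b : bool) : (0 <= (b%:R : R) <= 1)%R by rewrite ler0n lern1 leq_b1.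
split.
- move=> t; rewrite -(integral_cap _ (dotp_basis_diag R ord0)).
  apply: key; [exact: measurable_cap|by move=> x; exact: n01|move=> s].
  rewrite -[RHS]cstI; apply: eq_integral_sphere => //.
  - by apply/measurable_EFinP; apply: (measurableT_comp (measurable_cap _ _)).
  - by move=> u; rewrite lee_fin.
  - by move=> u u1; rewrite dotp_unit_cons0.
- move=> t.
  have ne1 : dotp (vscale (-1) e1) (vscale (-1) e1) = 1%R.
    by rewrite dotpZl dotpZr dotp_basis_diag; ring.
  rewrite -(integral_cap _ ne1).
  apply: key; [exact: measurable_cap|by move=> x; exact: n01|move=> s].
  rewrite -[RHS]cstI; apply: eq_integral_sphere => //.
  - by apply/measurable_EFinP; apply: (measurableT_comp (measurable_cap _ _)).
  - by move=> u; rewrite lee_fin.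
  - by move=> u u1; rewrite dotpZr dotp_unit_cons0// mulN1r.
- transitivity (\int[sig]_x (cst 1 x)).
    by rewrite integral_cst// [X in _ * X]probability_setT mule1.
  apply: (key (cst 1%R)) => //; first by move=> x; rewrite /cst ler01 lexx.
  by move=> s; exact: (cstI 1%R).
move=> t rho y rho1 hy.
have r0 : (0 < Num.sqrt (1 - rho ^+ 2))%R by rewrite sqrtr_gt0 subr_gt0.
have ny : enorm y = Num.sqrt (1 - rho ^+ 2)%R by rewrite /enorm hy.
have v1 : dotp (cons_pair (rho : RR, y)) (cons_pair (rho : RR, y)) = 1%R.
  by rewrite dotp_cons hy expr2; ring.
have y1 : dotp (unit_vec y) (unit_vec y) = 1%R by rewrite enorm_unit// ny.
have argE (s : RR) (u : W) : dotp u u = 1%R ->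
    (t <= dotp (unit_vec (cons_pair (s, u))) (cons_pair (rho : RR, y)))%R =
    (cap_arg t rho s <= dotp u (unit_vec y))%R.
  move=> u1; rewrite dotp_unit_cons// unit_vecE dotpZr ny mulrC.
  have s0 := slope_cos_gt0 s.
  rewrite -ler_pdivrMr// /cap_arg [X in _ = (_ <= X)%R]mulrC [in RHS]ler_pM2r ?invr_gt0//.
  by rewrite lerBlDl.
split.
- rewrite -(integral_cap _ v1).
  apply: key; [exact: measurable_cap|by move=> x; exact: n01|move=> s].
  rewrite -(integral_cap _ y1); apply: eq_integral_sphere => //.
  - by apply/measurable_EFinP; apply: (measurableT_comp (measurable_cap _ _)).
  - by apply/measurable_EFinP; exact: measurable_cap.
  - by move=> u u1; rewrite argE.
- apply: key.
  - by apply: measurable_funM; exact: measurable_cap.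
  - by move=> x; rewrite -natrM mulnb; exact: n01.
  move=> s; rewrite EFinM -(integral_cap _ y1) -ge0_integralZl_EFin//; last first.
    by apply/measurable_EFinP; exact: measurable_cap.
  apply: eq_integral_sphere => //.
  - apply/measurable_EFinP; apply: measurable_funM;
      by apply: (measurableT_comp (measurable_cap _ _)).
  - by apply: emeasurable_funM => //; apply/measurable_EFinP; exact: measurable_cap.
  - by move=> u u1; rewrite argE// dotp_unit_cons0// EFinM.
Qed.

End pair.

Section arguments.
Context (R : realType) (m : nat) (m_gt0 : (0 < m)%N).

Lemma slope_cosV_bounds (s : R) : 1 <= (slope_cos s)^-1 <= 1 + s ^+ 2.
Proof.
rewrite invrK; apply/andP; split.
  by rewrite -[leLHS]sqrtr1 ler_wsqrtr// lerDl sqr_ge0.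
have h : 0 <= 1 + s ^+ 2 by rewrite addr_ge0// sqr_ge0.
apply: (@le_trans _ _ (Num.sqrt ((1 + s ^+ 2) ^+ 2))); last by rewrite sqrtr_sqr ger0_norm.
by rewrite ler_wsqrtr// expr2 ler_peMr// lerDl sqr_ge0.
Qed.

Lemma sqrt_compl_bounds (rho : R) : rho ^+ 2 <= 4^-1 ->
  1 <= (Num.sqrt (1 - rho ^+ 2))^-1 <= 1 + rho ^+ 2.
Proof.
move=> rho2; have r20 := sqr_ge0 rho; set x := rho ^+ 2 in rho2 r20 *.
have s0 : 0 < Num.sqrt (1 - x) by rewrite sqrtr_gt0; lra.
apply/andP; split.
  rewrite invf_ge1// -[leRHS]sqrtr1 ler_wsqrtr//; lra.
rewrite -[leLHS]mul1r ler_pdivrMr//.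
have x1 : 0 <= 1 + x by lra.
rewrite -(@ler_pXn2r _ 2)// ?nnegrE ?mulr_ge0 ?(ltW s0)//.
rewrite exprMn sqr_sqrtr; last by lra.
by rewrite expr1n; nra.
Qed.

Lemma cap_arg_bounds (tau rho T s : R) : 0 <= tau -> tau <= T -> T <= 8^-1 ->
  `|rho| <= 8^-1 -> `|s| <= T ->
  tau - 2 * T * `|rho| <= cap_arg tau rho s <= tau + T ^+ 3 + 2 * T * `|rho|.
Proof.
move=> tau0 tauT T8 rho8 sT.
have T0 : 0 <= T by exact: le_trans tau0 tauT.
have a0 := normr_ge0 rho; set a := `|rho| in rho8 a0 *.
have rho2 : rho ^+ 2 = a ^+ 2 by rewrite /a real_normK// num_real.
have [|u1 u2] := andP (sqrt_compl_bounds _ : 1 <= (Num.sqrt (1 - rho ^+ 2))^-1 <= _).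
  by rewrite rho2; nra.
have [v1 v2] := andP (slope_cosV_bounds s).
have sr : `|s * rho| <= T * a by rewrite normrM ler_pM.
have s2 : s ^+ 2 <= T ^+ 2.
  by rewrite -[s ^+ 2]real_normK ?num_real// ler_pXn2r ?nnegrE.
move: sr; rewrite ler_norml => /andP[sr1 sr2].
rewrite /cap_arg; set u := (Num.sqrt _)^-1 in u1 u2 *; set v := (slope_cos s)^-1 in v1 v2 *.
rewrite rho2 in u2.
have X1 : tau - T * a <= tau * v - s * rho by nra.
have X2 : tau * v - s * rho <= tau * (1 + T ^+ 2) + T * a by nra.
set X := tau * v - s * rho in X1 X2 *.
have u3 : u <= 2 by nra.
have Ta : 0 <= T * a by rewrite mulr_ge0.
apply/andP; split.
  have [X0|X0] := leP 0 X; first by nra.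
  have : 2 * X <= X * u by nra.
  by nra.
have Y0 : 0 <= tau * (1 + T ^+ 2) + T * a by nra.
have Y2 : tau * (1 + T ^+ 2) + T * a <= 2 * T by nra.
set Y := tau * (1 + T ^+ 2) + T * a in X2 Y0 Y2 *.
have XY : X * u <= Y * u by rewrite ler_wpM2r//; lra.
have Yu : Y * u <= Y * (1 + a ^+ 2) by rewrite ler_wpM2l.
have Ya : Y * a ^+ 2 <= T * a.
  have : a ^+ 2 <= 8^-1 * a by rewrite expr2 ler_wpM2r.
  by nra.
have tT : tau * T ^+ 2 <= T ^+ 3 by rewrite exprS ler_wpM2r// sqr_ge0.
by rewrite /Y in XY Yu Ya *; nra.
Qed.

(** This passes from a height to a slope. A slope c >= 0 exceeds its sine; for c < 0 the cosine is
    at least 1/2, so the sine is at most c / 2, and this halving is why 4 T a becomes 2 T a. *)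
Lemma slope_sin_lower (tau T a : R) : 0 <= tau -> 0 <= T -> T <= 8^-1 -> 0 <= a -> a <= 8^-1 ->
  slope_sin (tau - 4 * T * a) <= tau - 2 * T * a.
Proof.
move=> tau0 T0 T8 a0 a8; have Ta : 0 <= T * a by rewrite mulr_ge0.
have Ta1 : T * a <= 64^-1 by nra.
set c := tau - 4 * T * a.
have s1 := slope_cos_le1 c; have s0 := slope_cos_gt0 c; rewrite /slope_sin.
have [c0|c0] := leP 0 c.
  apply: (@le_trans _ _ c); first by rewrite ler_piMr.
  by rewrite /c; lra.
have s2 : 2^-1 <= slope_cos c.
  rewrite -(@ler_pXn2r _ 2)// ?nnegrE ?(ltW s0)// slope_cos_sq exprVn lef_pV2 ?posrE ?ltr_pwDl ?sqr_ge0//.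
  have : - 16^-1 <= c by rewrite /c; lra.
  by nra.
apply: (@le_trans _ _ (c * 2^-1)); last by rewrite /c; lra.
by rewrite ler_wnM2l// ltW.
Qed.

Lemma slope_sin_upper (b : R) : 0 <= b -> b ^+ 2 <= 2^-1 -> b <= slope_sin (b * (1 + b ^+ 2)).
Proof.
move=> b0 b2; set x := b ^+ 2 in b2 *; have x0 : 0 <= x by exact: sqr_ge0.
set c := b * (1 + x); rewrite /slope_sin /c -/c -mulrA ler_peMr//.
have s0 := slope_cos_gt0 c.
rewrite -(@ler_pXn2r _ 2)// ?nnegrE ?mulr_ge0 ?(ltW s0)//; last by lra.
rewrite expr1n exprMn slope_cos_sq ler_pdivlMr ?ltr_pwDl ?sqr_ge0// mul1r /c exprMn -/x.
by nra.
Qed.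

(* A bound on the relative variation of Psi m (cap_arg t rho s) over |s| <= T,
   where |rho| = a. *)
Definition pair_eta (d : nat) (T a : R) : R :=
  expR 8 * (9 * (d%:R * T ^+ 4) + 8 * (d%:R * T ^+ 2 * a)).

(** For |s| <= T the heights [cap_arg] stay between the sines of two slopes c and c', whose distance
    is of order T^3 + T |rho|; [Psi_log_lipschitz] compares the two extreme cap measures. *)
Lemma Psi_arg_bounds (tau rho T : R) : 0 <= tau -> tau <= T -> T <= 8^-1 -> 0 < T ->
  `|rho| <= 8^-1 -> 1 <= m.+2%:R * T ^+ 2 -> pair_eta m.+2 T `|rho| <= 1 ->
  exists Hm Hp : R, [/\ 0 <= Hm, Hp <= 1, Hp <= (1 + pair_eta m.+2 T `|rho|) * Hm &
    forall s, `|s| <= T -> Hm <= Psi m (cap_arg tau rho s) <= Hp].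
Proof.
move=> tau0 tauT T8 T0 rho8 M1.
have a0 := normr_ge0 rho; set a := `|rho| in rho8 a0 *.
have Ta : 0 <= T * a by rewrite mulr_ge0// ltW.
rewrite /pair_eta; set d : R := m.+2%:R in M1 *; set eta := expR 8 * _ => eta1.
pose b := tau + T ^+ 3 + 4 * T * a.
have T30 : 0 <= T ^+ 3 by rewrite exprn_ge0// ltW.
have T3 : T ^+ 3 <= 64^-1 * T.
  have -> : T ^+ 3 = T ^+ 2 * T by rewrite -exprSr.
  by rewrite ler_pM2r//; nra.
have Ta8 : T * a <= 8^-1 * T by rewrite mulrC ler_pM2r.
have b0 : 0 <= b by rewrite /b; nra.
have b2T : b <= 2 * T by rewrite /b; nra.
have b2 : b ^+ 2 <= 2^-1 by nra.
have b3 : b ^+ 3 <= 8 * T ^+ 3.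
  have -> : 8 * T ^+ 3 = (2 * T) ^+ 3 by rewrite exprMn -natrX.
  by rewrite ler_pXn2r ?nnegrE//; lra.
pose c' := b * (1 + b ^+ 2); pose c := tau - 4 * T * a.
have c'E : c' = b + b ^+ 3 by rewrite /c' mulrDr mulr1 -exprS.
have c'3 : c' <= 3 * T by rewrite c'E; nra.
have D : c' - c <= 9 * T ^+ 3 + 8 * (T * a).
  by rewrite c'E /c; rewrite /b in b3 *; lra.
have b30 : 0 <= b ^+ 3 by rewrite exprn_ge0.
have bE : b = tau + T ^+ 3 + 4 * T * a by [].
have cc' : c <= c' by rewrite c'E /c; lra.
have cc'2 : - c' <= c by rewrite c'E /c; lra.
have d0 : 0 < d by rewrite ltr0n.
(* At slopes of order T the logarithm of the density varies at rate of order d T, which sets the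
   scale of [h]. As c' - c <= h, c' <= 3 T and h <= T, the exponent is at most d (2 h) (4 T) = 8;
   this is the origin of [expR 8]. *)
pose h := (d * T)^-1.
have h0 : 0 < h by rewrite invr_gt0 mulr_gt0.
have dTh : d * T * h = 1 by rewrite divff// gt_eqF// mulr_gt0.
have hT : h <= T.
  rewrite -[leLHS]mul1r ler_pdivrMr ?mulr_gt0//.
  by move: M1; rewrite expr2; nra.
have Dh : (c' - c) / h <= 9 * (d * T ^+ 4) + 8 * (d * T ^+ 2 * a).
  rewrite invrK; have dT0 : 0 <= d * T by rewrite mulr_ge0// ltW.
  apply: le_trans (ler_wpM2r dT0 D) _.
  by rewrite le_eqVlt; apply/orP; left; apply/eqP; ring.
(* The hypothesis eta <= 1 is used here, the factor [expR 8] in eta being at least 1. *)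
have Dh1 : c' - c <= h.
  rewrite -[leRHS]mul1r -ler_pdivrMr//; apply: le_trans Dh _.
  apply: le_trans eta1; rewrite /eta ler_peMl//.
    by rewrite addr_ge0// ?mulr_ge0// ?exprn_ge0// ?ltW.
  by rewrite -[leLHS]expR0 ler_expR.
have lip := Psi_log_lipschitz m_gt0 cc' cc'2 h0.
exists (Psi m (slope_sin c')), (Psi m (slope_sin c)); split.
- exact: Psi_ge0.
- exact: Psi_le1.
- apply: le_trans lip _; rewrite mulrC ler_wpM2r ?Psi_ge0// lerD2l.
  rewrite /eta; apply: ler_pM; rewrite ?expR_ge0//.
    by rewrite divr_ge0 ?subr_ge0// ltW.
  rewrite ler_expR.
  have md : m.+1%:R <= d :> R by rewrite ler_nat.
  apply: (@le_trans _ _ (d * ((h + h) * (4 * T)))).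
    apply: ler_pM => //.
    + by rewrite mulr_ge0//; lra.
    + by apply: ler_pM; lra.
  rewrite (_ : _ * _ = 8 * (d * T * h)); last by ring.
  by rewrite dTh; lra.
- move=> s sT; have /andP[l1 l2] := cap_arg_bounds tau0 tauT T8 rho8 sT.
  apply/andP; split; apply: Psi_homo.
    apply: (@le_trans _ _ b); last exact: slope_sin_upper.
    by apply: (le_trans l2); rewrite -/a bE; lra.
  apply: le_trans l1; apply: slope_sin_lower => //; exact: ltW.
Qed.

End arguments.

Section pair_bound.
Context (R : realType) (m : nat) (m_gt0 : (0 < m)%N).
Local Notation V := (vec R m.+2).

(** For x = T^2 <= 1, (1 + x) (1 - x / 2) >= 1, so 1 / (1 + x) <= 1 - x / 2 <= exp (- x / 2); the
    cosine is the square root of the left side. *)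
Lemma slope_cos_exp (T : R) : 0 <= T -> T <= 1 -> slope_cos T <= expR (- (T ^+ 2 / 4)).
Proof.
move=> T0 T1; have s0 := slope_cos_gt0 T.
rewrite -(@ler_pXn2r _ 2)// ?nnegrE ?expR_ge0 ?(ltW s0)// slope_cos_sq -expRM_natl mulrN expRN.
have T20 := sqr_ge0 T.
rewrite lef_pV2 ?posrE ?expR_gt0 ?ltr_pwDl//.
rewrite -[expR _]invrK -expRN; have x0 : 0 < 1 + T ^+ 2 by rewrite ltr_pwDl.
rewrite -[leRHS]invrK lef_pV2 ?posrE ?invr_gt0 ?expR_gt0//.
apply: le_trans (expR_ge1Dx _).
rewrite -[leLHS]mul1r ler_pdivrMr//; have : T ^+ 2 <= 1 by rewrite exprn_ile1.
by nra.
Qed.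

Lemma Psi_tail_exp (T : R) : 0 <= T -> T ^+ 2 <= 2^-1 ->
  Psi m.+1 T <= expR (- (m.+2%:R * T ^+ 2 / 2)).
Proof.
move=> T0 T2; apply: le_trans (Psi_tail _ T0 T2) _.
rewrite (_ : - (m.+2%:R * T ^+ 2 / 2) = m.+2%:R * (- (T ^+ 2 / 2))); last by ring.
rewrite expRM_natl; apply: lerXn2r; rewrite ?nnegrE ?sqrtr_ge0 ?expR_ge0//.
rewrite -(@ler_pXn2r _ 2)// ?nnegrE ?expR_ge0 ?sqrtr_ge0// -expRM_natl.
rewrite sqr_sqrtr; last by lra.
rewrite (_ : 2%:R * _ = - T ^+ 2); last by field.
exact: expR_ge1Dx.
Qed.

Lemma Psi_tail_slope (T : R) : 0 <= T -> T <= 1 ->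
  Psi m.+1 (slope_sin T) <= expR (- (m.+2%:R * T ^+ 2 / 4)).
Proof.
move=> T0 T1.
have s0 := slope_cos_gt0 T.
have T2 : T ^+ 2 <= 1 by rewrite exprn_ile1.
apply: le_trans (Psi_tail _ _ _) _; first by rewrite slope_sin_ge0.
  rewrite slope_sin_sq slope_cos_sq lerBlDr -lerBlDl.
  rewrite (_ : 1 - 2^-1 = 2^-1); last by field.
  by rewrite lef_pV2 ?posrE ?ltr_pwDl ?sqr_ge0//; lra.
rewrite slope_sin_sq opprB addrC subrK sqrtr_sqr ger0_norm ?(ltW s0)//.
rewrite (_ : - (m.+2%:R * T ^+ 2 / 4) = m.+2%:R * (- (T ^+ 2 / 4))); last by ring.
by rewrite expRM_natl; apply: lerXn2r; rewrite ?nnegrE ?expR_ge0 ?(ltW s0)// slope_cos_exp.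
Qed.

(** On |s| <= T the conditional measure H lies in an interval [Hm, Hp] of ratio at most 1 + eta. As
    p = E H, both endpoints are close to p; as q = E (A H) and E A = p, q lies between Hm p and Hp p
    up to the tail. Hence q is close to p^2 with relative error eta. *)
Lemma pair_bound (tau T : R) (w w' : V) : let p := Psi m.+1 tau in
  0 < T -> T <= 8^-1 -> 1 <= m.+2%:R * T ^+ 2 -> p < 2^-1 ->
  expR (- (m.+2%:R * T ^+ 2 / 2)) < p ->
  dotp w w = 1 -> dotp w' w' = 1 -> `|dotp w w'| <= 8^-1 ->
  pair_eta m.+2 T `|dotp w w'| <= 1 ->
  exists2 q : R, pair_cap tau w w' = q%:E &
    `|q - p ^+ 2| <= pair_eta m.+2 T `|dotp w w'| * p ^+ 2 + 4 * expR (- (m.+2%:R * T ^+ 2 / 4)).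
Proof.
move=> p T0 T8 M1 p2 Mp w1 w'1 a8 eta1.
(* A negative threshold would give a cap containing a hemisphere, against p < 1/2; a threshold above
   T would contradict the tail bound, since p exceeds it. *)
have tau0 : 0 <= tau.
  rewrite leNgt; apply/negP => /ltW t0; have := Psi_homo m.+1 t0.
  by have := Psi0_ge R m.+1; rewrite -/p; lra.
have tauT : tau <= T.
  rewrite leNgt; apply/negP => /ltW t0; have := Psi_homo m.+1 t0.
  have := Psi_tail_exp (ltW T0); rewrite -/p => h1 h2.
  have T2 : T ^+ 2 <= 2^-1 by nra.
  by have := lt_le_trans Mp (le_trans h2 (h1 T2)); rewrite ltxx.
have [Hm [Hp [Hm0 Hp1 HH HT]]] := Psi_arg_bounds m_gt0 tau0 tauT T8 T0 a8 M1 eta1.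
have [y hy ->] := pair_cap_axis tau w1 w'1.
set rho := dotp w w' in a8 eta1 HH HT hy *.
have rho1 : rho ^+ 2 < 1.
  by rewrite -[rho ^+ 2]real_normK ?num_real//; have := normr_ge0 rho; nra.
have [K K0 [r1 r2 r3 r4]] := pair_recursion R m.
have [r5 r6] := r4 tau rho y rho1 hy.
set E := slope_mean K m.+2 in r1 r2 r3 r5 r6.
have ED (f g : measurableTypeR R -> R) : measurable_fun setT f -> (forall t, 0 <= f t) ->
  measurable_fun setT g -> (forall t, 0 <= g t) ->
  E (fun t => f t + g t) = (E f + E g)%E by exact: slope_meanD.
have EZ (a : R) (f : measurableTypeR R -> R) : 0 <= a -> measurable_fun setT f ->
  (forall t, 0 <= f t) -> E (fun t => a * f t) = (a%:E * E f)%E by exact: slope_meanZ.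
have Ele (f g : measurableTypeR R -> R) : measurable_fun setT f -> (forall t, 0 <= f t) ->
  measurable_fun setT g -> (forall t, f t <= g t) -> (E f <= E g)%E by exact: slope_mean_le.
set e0 := Psi m.+1 (slope_sin T).
pose A (s : measurableTypeR R) : R := (tau <= slope_sin s)%R%:R.
pose H (s : measurableTypeR R) : R := Psi m (cap_arg tau rho s).
(* [B] is at least 1 off |s| <= T and has mean 2 [e0]. Adding it to a bound valid on |s| <= T makes
   the bound valid for every slope. *)
pose B (s : measurableTypeR R) : R := (slope_sin T <= slope_sin s)%R%:R + (slope_sin T <= - slope_sin s)%R%:R.
have msin : measurable_fun setT (fun s : measurableTypeR R => slope_sin s : R).
  by apply: measurable_funM; [exact: measurable_id|exact: measurable_slope_cos].
have mA : measurable_fun setT A by apply: measurable_natb; exact: measurable_fun_ler.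
have mH : measurable_fun setT H by exact: measurable_Psi_arg.
have mB1 : measurable_fun setT (fun s : measurableTypeR R => (slope_sin T <= slope_sin s)%R%:R : R).
  by apply: measurable_natb; exact: measurable_fun_ler.
have mB2 : measurable_fun setT (fun s : measurableTypeR R => (slope_sin T <= - slope_sin s)%R%:R : R).
  by apply: measurable_natb; apply: measurable_fun_ler => //; exact: measurable_funN.
have mB : measurable_fun setT B by exact: measurable_funD.
have A0 s : 0 <= A s by rewrite ler0n.
have A1 s : A s <= 1 by rewrite lern1 leq_b1.
have H0 s : 0 <= H s by exact: Psi_ge0.
have H1 s : H s <= 1 by exact: Psi_le1.
have B0 s : 0 <= B s by rewrite addr_ge0.
have BT s : ~~ (`|s| <= T) -> 1 <= B s.
  rewrite -ltNge lter_normr => /orP[/ltW sT|/ltW sT]; rewrite /B.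
    by rewrite slope_sin_le sT lerDl.
  have -> : - slope_sin s = slope_sin (- s) by rewrite /slope_sin /slope_cos sqrrN mulNr.
  by rewrite !slope_sin_le sT lerDr.
have EB : E B = (2 * e0)%:E.
  by rewrite /B ED// -r1 -r2 -EFinD; congr (_%:E); rewrite -/e0; ring.
have Hp0 : 0 <= Hp.
  have /andP[h1 h2] := HT 0 (eq_ind_r (fun x => x <= T) (ltW T0) (normr0 R)).
  exact: le_trans (le_trans Hm0 h1) h2.
have Hm1 : Hm <= 1.
  have /andP[h1 h2] := HT 0 (eq_ind_r (fun x => x <= T) (ltW T0) (normr0 R)).
  exact: le_trans (le_trans h1 h2) Hp1.
pose AH (s : measurableTypeR R) : R := A s * H s.
have mAH : measurable_fun setT AH by exact: measurable_funM.
have AH0 s : 0 <= AH s by exact: mulr_ge0.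
have mcst (c : R) : measurable_fun setT (fun _ : measurableTypeR R => c) by exact: measurable_cst.
have I2 : p <= Hp + 2 * e0.
  rewrite -lee_fin EFinD /p r5 -EB -[X in (_ <= X + _)%E]mule1 r3 -EZ// -ED//; last first.
    by move=> s; rewrite mulr1.
  apply: Ele => //; first by apply: measurable_funD => //; exact: measurable_funM.
  move=> s; rewrite mulr1; have [sT|sT] := boolP (`|s| <= T).
    by have /andP[_ h] := HT s sT; rewrite (le_trans h)// lerDl.
  by apply: (le_trans (H1 s)); apply: (le_trans (BT s sT)); rewrite lerDr.
have I3 : Hm <= p + 2 * e0.
  rewrite -lee_fin EFinD /p r5 -EB -[leLHS]mule1 r3 -EZ// -ED//.
  apply: Ele => //.
  - by move=> s; rewrite mulr1.
  - by apply: measurable_funD.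
  move=> s; rewrite mulr1; have [sT|sT] := boolP (`|s| <= T).
    by have /andP[h _] := HT s sT; rewrite (le_trans h)// lerDl.
  by apply: (le_trans Hm1); apply: (le_trans (BT s sT)); rewrite lerDr Psi_ge0.
have qge0 : (0 <= E AH)%E.
  by apply: mule_ge0; rewrite ?lee_fin//; apply: integral_ge0 => s _; rewrite lee_fin mulr_ge0// exprn_ge0// ltW// slope_cos_gt0.
have I1e : (E AH <= (Hp * p + 2 * e0)%:E)%E.
  rewrite EFinD EFinM (r1 tau : p%:E = E A) -EB -EZ// -ED//; last 2 first.
  - exact: measurable_funM.
  - by move=> s; rewrite mulr_ge0.
  apply: Ele => //; first by apply: measurable_funD => //; exact: measurable_funM.
  move=> s; have [sT|sT] := boolP (`|s| <= T).
    by have /andP[_ h] := HT s sT; rewrite /AH mulrC; apply: (le_trans (ler_wpM2r (A0 s) h)); rewrite lerDl.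
  apply: (@le_trans _ _ 1); first by rewrite /AH mulr_ile1.
  by apply: (le_trans (BT s sT)); rewrite lerDr mulr_ge0.
have I4e : ((Hm * p)%:E <= E AH + (2 * e0)%:E)%E.
  rewrite EFinM (r1 tau : p%:E = E A) -EB -EZ// -ED//.
  apply: Ele => //.
  - exact: measurable_funM.
  - by move=> s; rewrite mulr_ge0.
  - exact: measurable_funD.
  move=> s; have [sT|sT] := boolP (`|s| <= T).
    by have /andP[h _] := HT s sT; rewrite mulrC; apply: (le_trans (ler_wpM2l (A0 s) h)); rewrite lerDl.
  apply: (@le_trans _ _ 1); first by rewrite mulr_ile1.
  by apply: (le_trans (BT s sT)); rewrite lerDr.
rewrite (r6 : _ = E AH).
move: qge0 I1e I4e; case: (E _) => [q| |]; rewrite ?leye_eq ?leeNy_eq//.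
rewrite -EFinD !lee_fin => q0 I1 I4; exists q => //.
set eta := pair_eta _ _ _ in eta1 HH *.
have eta0 : 0 <= eta.
  rewrite /eta /pair_eta mulr_ge0 ?expR_ge0// addr_ge0// ?mulr_ge0// ?exprn_ge0 ?ler0n// ?ltW//.
have T1 : T <= 1 by lra.
have := Psi_tail_slope (ltW T0) T1; rewrite -/e0; set ee := expR _ => e0e.
have e00 : 0 <= e0 by exact: Psi_ge0.
have p0 : 0 <= p by exact: Psi_ge0.
(* The tail enters as 2 (1 + eta) e0 p + 2 e0, which is at most 4 e0 because eta <= 1 and p <
   1/2. *)
apply: (@le_trans _ _ (eta * p ^+ 2 + 4 * e0)); last by rewrite lerD2l ler_wpM2l.
have ep : 0 <= eta * p by rewrite mulr_ge0.
have ee0 : eta * e0 <= e0 by rewrite ler_piMl.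
have epe : eta * e0 * p <= e0 * p by rewrite ler_wpM2r.
have pe : e0 * p <= e0 * 2^-1 by rewrite ler_wpM2l// ltW.
rewrite ler_norml; apply/andP; split.
  have h1 : Hp <= Hm + eta * p + eta * (2 * e0).
    apply: (le_trans HH); rewrite mulrDl mul1r -addrA lerD2l -mulrDr ler_wpM2l//.
  have h2 : p - 2 * e0 - eta * p - eta * (2 * e0) <= Hm by lra.
  have := ler_wpM2r p0 h2.
  rewrite expr2; move: I4 epe pe; lra.
have h1 : (1 + eta) * Hm <= (1 + eta) * (p + 2 * e0) by rewrite ler_wpM2l//; lra.
have h2 : Hp <= (1 + eta) * (p + 2 * e0) by exact: le_trans HH h1.
have := ler_wpM2r p0 h2.
by rewrite expr2; move: I1 epe pe; lra.
Qed.

End pair_bound.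

(** * Divergence of a latent position graph from the Erdos-Renyi graph *)

Section graphs.
Variable n : nat.

Lemma card_vpair m : #|{: vpair m}| = 'C(m, 2).
Proof.
rewrite card_sig -[in RHS](card_ord m) -(card_draws 'I_m 2).
by apply: eq_card => e; rewrite !inE.
Qed.

Lemma lift_pairP (e : vpair n) : #|[set lift ord0 i | i in val e]%SET| == 2.
Proof. by rewrite card_imset ?(valP e)//; exact: lift_inj. Qed.

Lemma star_pairP (i : 'I_n) : #|[set (ord0 : 'I_n.+1); lift ord0 i]%SET| == 2.
Proof. by rewrite cards2 neq_lift. Qed.

(** The added vertex is [ord0], because [cons_pair] prepends its latent point; the old vertices are
    shifted by [lift ord0]. *)
Definition vpair_split (x : vpair n + 'I_n) : vpair n.+1 :=
  match x with
  | inl e => exist (fun e : {set 'I_n.+1} => is_true (#|e| == 2)) _ (lift_pairP e)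
  | inr i => exist (fun e : {set 'I_n.+1} => is_true (#|e| == 2)) _ (star_pairP i)
  end.

(** Injectivity suffices, the cardinalities agreeing by Pascal's rule. *)
Lemma vpair_split_bij : bijective vpair_split.
Proof.
apply: inj_card_bij; last first.
  by rewrite card_sum !card_vpair card_ord binS bin1 leqnn.
have l0 (e : {set 'I_n}) : ord0 \notin [set lift ord0 i | i in e]%SET.
  by apply/imsetP => -[i _ /eqP]; rewrite (negbTE (neq_lift _ _)).
case=> [e|i] [e'|i'] /(congr1 val)/= E.
- congr inl; apply: val_inj; exact: imset_inj (@lift_inj _ _) _ _ E.
- by have := l0 (val e); rewrite E !inE eqxx.
- by have := l0 (val e'); rewrite -E !inE eqxx.
- have : lift ord0 i \in [set ord0; lift ord0 i']%SET by rewrite -E !inE eqxx orbT.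
  by rewrite !inE eq_sym (negbTE (neq_lift _ _))/= => /eqP/lift_inj ->.
Qed.

Definition graph_tail (G : graph n.+1) : graph n := [set e | vpair_split (inl e) \in G]%SET.
Definition graph_head (G : graph n.+1) : {set 'I_n} := [set i | vpair_split (inr i) \in G]%SET.

Lemma graph_split_bij : bijective (fun G : graph n.+1 => (graph_tail G, graph_head G)).
Proof.
have [g _ gK] := vpair_split_bij.
apply: inj_card_bij.
  move=> G G' [/setP h1 /setP h2]; apply/setP => e; rewrite -(gK e).
  by case: (g e) => [e'|i]; [have := h1 e'|have := h2 i]; rewrite !inE.
by rewrite card_prod -!cardsT -!powersetT !card_powerset !cardsT -expnD -card_sum
  (bij_eq_card vpair_split_bij).
Qed.

Lemma sum_graphS (R : realType) (F : graph n -> {set 'I_n} -> R) :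
  \sum_(G : graph n.+1) F (graph_tail G) (graph_head G) =
  \sum_(G : graph n) \sum_(S : {set 'I_n}) F G S.
Proof.
rewrite pair_big/= (reindex (fun G : graph n.+1 => (graph_tail G, graph_head G)))//.
exact/onW_bij/graph_split_bij.
Qed.

End graphs.

Section weights.
Context (R : realType) (p : R).

Definition bern (T : finType) (S : {set T}) : R := \prod_i (if i \in S then p else 1 - p).

Lemma bern_graphS n (G : graph n.+1) : bern G = bern (graph_tail G) * bern (graph_head G).
Proof.
rewrite /bern (reindex (@vpair_split n)); last exact/onW_bij/vpair_split_bij.
by rewrite big_sumType; congr (_ * _); apply: eq_bigr => i _; rewrite inE.
Qed.

Lemma bern_gt0 (T : finType) (S : {set T}) : 0 < p < 1 -> 0 < bern S.
Proof.
move=> /andP[p0 p1]; apply: prodr_gt0 => i _.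
by case: ifP => // _; rewrite subr_gt0.
Qed.

Lemma sum_bern (T : finType) : \sum_(S : {set T}) bern S = 1.
Proof.
transitivity (\prod_(i : T) \sum_(b : bool) (if b then p else 1 - p)); last first.
  by rewrite big1// => i _; rewrite big_bool/= addrC subrK.
rewrite bigA_distr_bigA/= (reindex (fun f : {ffun T -> bool} => [set i | f i]%SET)).
  by apply: eq_bigr => f _; apply: eq_bigr => i _; rewrite inE.
exists (fun S : {set T} => [ffun i => i \in S]) => [f|S] _.
  by apply/ffunP => i; rewrite ffunE inE.
by apply/setP => i; rewrite inE ffunE.
Qed.

End weights.

Section divergence.
Context (R : realType).

Lemma ln_le_sub1 (x : R) : 0 < x -> ln x <= x - 1.
Proof.
move=> x0; have := expR_ge1Dx (x - 1).
by rewrite addrC subrK => h; rewrite -ler_expR lnK.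
Qed.

(** A term with [P i = 0] vanishes through its factor, whatever value [ln] takes there. *)
Definition kl_div (I : finType) (P Q : I -> R) : R := \sum_i P i * ln (P i / Q i).

(** The logarithm splits into the marginal part and ln (P / (PA QB)), and [ln x <= x - 1] bounds the
    latter by a chi-squared term P^2 / (PA QB) - P. [M] stands for a bound on P^2 / PA, stated as a
    product so that PA may vanish. *)
Lemma kl_div_chain (I J : finType) (P : I -> J -> R) (PA QA : I -> R) (QB : J -> R) (M : I -> J -> R) :
  (forall i j, 0 <= P i j) -> (forall i, \sum_j P i j = PA i) ->
  (forall i, 0 < QA i) -> (forall j, 0 < QB j) ->
  (forall i j, 0 <= M i j) -> (forall i j, P i j ^+ 2 <= PA i * M i j) ->
  \sum_i \sum_j P i j * ln (P i j / (QA i * QB j)) <=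
  kl_div PA QA + (\sum_i \sum_j M i j / QB j - \sum_i PA i).
Proof.
move=> P0 PS QA0 QB0 M0 PM; rewrite /kl_div -sumrB -big_split/=; apply: ler_sum => i _.
have -> : PA i * ln (PA i / QA i) + (\sum_j M i j / QB j - PA i) =
    \sum_j (P i j * ln (PA i / QA i) + (M i j / QB j - P i j)).
  by rewrite big_split/= sumrB -mulr_suml PS.
apply: ler_sum => j _.
have [P1|P1] := eqVneq (P i j) 0.
  by rewrite P1 !mul0r subr0 add0r divr_ge0// ltW.
have {}P1 : 0 < P i j by rewrite lt_def P1 P0.
have PA1 : 0 < PA i.
  apply: (lt_le_trans P1); rewrite -PS (bigD1 j)//= lerDl.
  by apply: sumr_ge0.
have -> : P i j / (QA i * QB j) = (PA i / QA i) * (P i j / (PA i * QB j)).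
  by field; rewrite !gt_eqF.
rewrite lnM ?posrE ?divr_gt0// ?mulr_gt0// mulrDr lerD2l.
apply: (@le_trans _ _ (P i j * (P i j / (PA i * QB j) - 1))).
  by rewrite ler_pM2l// ln_le_sub1// divr_gt0// mulr_gt0.
rewrite mulrBr mulr1 lerD2r mulrA -expr2 invfM mulrA ler_pM2r ?invr_gt0//.
by rewrite ler_pdivrMr// mulrC.
Qed.

(* Through the Hellinger distance: the divergence dominates
   \sum (sqrt P - sqrt Q)^2, and |P - Q| = |sqrt P - sqrt Q| (sqrt P + sqrt Q). *)
Lemma kl_div_tv (I : finType) (P Q : I -> R) (A : {set I}) (e : R) :
  (forall i, 0 <= P i) -> \sum_i P i = 1 -> (forall i, 0 < Q i) -> \sum_i Q i = 1 -> 0 < e ->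
  `|\sum_(i in A) P i - \sum_(i in A) Q i| <= kl_div P Q / (2 * e) + 2 * e.
Proof.
move=> P0 P1 Q0 Q1 e0.
(* [ln x <= x - 1] at x = sqrt (Q / P) gives P ln (P / Q) >= 2 P - 2 sqrt (P Q); adding Q - P
   completes the square. *)
have hell i : (Num.sqrt (P i) - Num.sqrt (Q i)) ^+ 2 <= P i * ln (P i / Q i) + (Q i - P i).
  have [Pi|Pi] := eqVneq (P i) 0.
    by rewrite Pi sqrtr0 sub0r sqrrN sqr_sqrtr ?(ltW (Q0 i))// mul0r add0r subr0.
  have {}Pi : 0 < P i by rewrite lt_def Pi P0.
  have sP : 0 < Num.sqrt (P i) by rewrite sqrtr_gt0.
  have sQ : 0 < Num.sqrt (Q i) by rewrite sqrtr_gt0.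
  have PE := sqr_sqrtr (ltW Pi); have QE := sqr_sqrtr (ltW (Q0 i)).
  set a := Num.sqrt (P i) in sP PE *; set b := Num.sqrt (Q i) in sQ QE *.
  have h := ln_le_sub1 (divr_gt0 sQ sP).
  have lnE : ln (P i / Q i) = - (2 * ln (b / a)).
    have -> : P i / Q i = ((b / a) ^+ 2)^-1 by rewrite -PE -QE; field; rewrite !gt_eqF.
    by rewrite lnV ?posrE ?exprn_gt0 ?divr_gt0// lnXn ?divr_gt0// mulr_natl.
  have : P i * (ln (b / a)) <= P i * (b / a - 1) by rewrite ler_pM2l.
  have -> : P i * (b / a - 1) = a * b - a ^+ 2 by rewrite -PE; field; rewrite gt_eqF.
  rewrite lnE -PE -QE; set l := ln _; move=> h2.
  have -> : (a - b) ^+ 2 = a ^+ 2 - 2 * (a * b) + b ^+ 2 by ring.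
  by lra.
rewrite -sumrB; apply: le_trans (ler_norm_sum _ _ _) _.
apply: (@le_trans _ _ (\sum_i `|P i - Q i|)).
  rewrite [leRHS](bigID (mem A))/= lerDl; exact: sumr_ge0.
(* With x = |a - b|, x (a + b) <= x^2 / (2 e) + e (a + b)^2 / 2, and (a + b)^2 <= 2 (a^2 + b^2) = 2
   (P + Q). The sum of P + Q is 2, whence the final 2 e. *)
have bound i : `|P i - Q i| <= (P i * ln (P i / Q i) + (Q i - P i)) / (2 * e) + (P i + Q i) * e.
  have := hell i.
  have PE := sqr_sqrtr (P0 i); have QE := sqr_sqrtr (ltW (Q0 i)).
  have a0 := sqrtr_ge0 (P i); have b0 := sqrtr_ge0 (Q i).
  set a := Num.sqrt (P i) in a0 PE *; set b := Num.sqrt (Q i) in b0 QE *.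
  pose D := P i * ln (P i / Q i) + (Q i - P i); rewrite -/D => hD.
  have PQ : `|P i - Q i| = `|a - b| * (a + b).
    by rewrite -PE -QE subr_sqr normrM [`|a + b|]ger0_norm// addr_ge0.
  have x0 := normr_ge0 (a - b); set x := `|a - b| in PQ x0.
  have x2 : x ^+ 2 = (a - b) ^+ 2 by rewrite real_normK ?num_real.
  have S : P i + Q i = a ^+ 2 + b ^+ 2 by rewrite PE QE.
  rewrite PQ S.
  apply: (@le_trans _ _ (x ^+ 2 / (2 * e) + (a ^+ 2 + b ^+ 2) * e)); last first.
    by rewrite lerD2r ler_pM2r ?invr_gt0 ?mulr_gt0// x2.
  have ab2 : (a + b) ^+ 2 <= 2 * (a ^+ 2 + b ^+ 2).
    have := sqr_ge0 (a - b); nra.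
  have e20 : 0 < 2 * e by rewrite mulr_gt0.
  rewrite -(ler_pM2r e20) [leRHS]mulrDl divfK ?gt_eqF//.
  have := sqr_ge0 (x - e * (a + b)).
  have : e ^+ 2 * (a + b) ^+ 2 <= e ^+ 2 * (2 * (a ^+ 2 + b ^+ 2)) by rewrite ler_wpM2l ?sqr_ge0.
  have -> : (x - e * (a + b)) ^+ 2 = x ^+ 2 - x * (a + b) * (2 * e) + e ^+ 2 * (a + b) ^+ 2 by ring.
  have -> : (a ^+ 2 + b ^+ 2) * e * (2 * e) = e ^+ 2 * (2 * (a ^+ 2 + b ^+ 2)) by ring.
  by lra.
apply: le_trans (ler_sum _ (fun i _ => bound i)) _.
rewrite big_split/= -!mulr_suml !big_split/= sumrN P1 Q1 subrr addr0.
by rewrite lerD2l.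
Qed.

End divergence.

Section bool_measurability.
Context d (T : measurableType d).

Lemma measurable_forallb (I : finType) (b : I -> T -> bool) :
  (forall i, measurable_fun setT (b i)) -> measurable_fun setT (fun x => [forall i, b i x]).
Proof.
move=> mb; apply: (@measurable_fun_bool _ _ _ _ true); rewrite setTI.
rewrite (_ : _ @^-1` _ = \bigcap_(i in [set: I]) (b i @^-1` [set true])).
  apply: fin_bigcap_measurable => // i _; rewrite -[X in measurable X]setTI.
  exact: mb.
apply/seteqP; split => x /=; first by move=> /forallP h i _; exact: h.
by move=> h; apply/forallP => i; have /= := h i Logic.I.
Qed.

Lemma measurable_eqb (b : T -> bool) (c : bool) : measurable_fun setT b ->
  measurable_fun setT (fun x => b x == c).
Proof.
move=> mb; case: c.
  by rewrite (_ : (fun _ => _) = b)//; apply/funext => x; case: (b x).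
rewrite (_ : (fun _ => _) = (fun x => ~~ b x)); first exact: measurable_neg.
by apply/funext => x; case: (b x).
Qed.

Lemma measurable_impb (a : bool) (b : T -> bool) : (a -> measurable_fun setT b) ->
  measurable_fun setT (fun x => a ==> b x).
Proof. by case: a => // h; exact: h. Qed.

End bool_measurability.

(** * Graphs with latent positions: one new vertex at a time *)

Section latent.
Local Open Scope ereal_scope.
Context d0 (T : measurableType d0) (R : realType) (sigma : probability T R).
Variable kappa : T -> T -> bool.
Hypothesis mkappa : measurable_fun setT (fun z : T * T => kappa z.1 z.2).
Hypothesis kappaC : forall x y, kappa x y = kappa y x.
Variable p : R.
Hypothesis p01 : (0 < p < 1)%R.

(** This repeats [geo_graph] for an abstract symmetric relation; the two are convertible once
    [kappa] is [cap_rel t]. *)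
Definition latent_graph n (v : n.-tuple T) : graph n :=
  finset (fun e : vpair n => [forall i in val e, forall j in val e,
    (i != j) ==> kappa (tnth v i) (tnth v j)]).

Definition latent_row n (x : T) (v : n.-tuple T) : {set 'I_n} :=
  finset (fun i => kappa x (tnth v i)).

Local Notation pow := (power_measure sigma).

Lemma measurable_kappa d1 (X : measurableType d1) (f g : X -> T) :
  measurable_fun setT f -> measurable_fun setT g ->
  measurable_fun setT (fun x => kappa (f x) (g x)).
Proof.
move=> mf mg.
rewrite (_ : (fun _ => _) = (fun z : T * T => kappa z.1 z.2) \o (fun x => (f x, g x)))//.
by apply: (measurableT_comp mkappa); exact/measurable_fun_pairP.
Qed.

Lemma power_setT n : pow n setT = 1.
Proof.
transitivity ((\int[sigma]_x (1%R)%:E) ^+ n); last first.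
  rewrite integral_cst// mul1e [X in X ^+ _]probability_setT.
  by rewrite -EFin_expe expr1n.
rewrite -(integral_prod_tnth sigma n (h := fun=> 1%R))//.
under eq_integral do rewrite big1//.
by rewrite integral_cst// mul1e.
Qed.

Lemma integral_power1 n : \int[pow n]_v (cst 1 v) = 1.
Proof. by rewrite integral_cst// mul1e; exact: power_setT. Qed.

Lemma integral_prob1 : \int[sigma]_x (cst 1 x) = 1.
Proof. by rewrite integral_cst// mul1e; exact: probability_setT. Qed.

Lemma latent_graph_cons n (x : T) (v : n.-tuple T) :
  graph_tail (latent_graph (cons_pair (x, v))) = latent_graph v /\
  graph_head (latent_graph (cons_pair (x, v))) = latent_row x v.
Proof.
split; apply/setP => e; rewrite !inE /=.
  apply/forall_inP/forall_inP => h i ie; apply/forall_inP => j je; apply/implyP => ij.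
    have /forall_inP/(_ (lift ord0 j) (imset_f _ je))/implyP := h (lift ord0 i) (imset_f _ ie).
    by rewrite !tnthS (inj_eq (@lift_inj _ _)); exact.
  move: ie je ij => /imsetP[i' ie' ->] /imsetP[j' je' ->].
  rewrite (inj_eq (@lift_inj _ _)) !tnthS => ij.
  by have /forall_inP/(_ _ je')/implyP := h _ ie'; exact.
have t0 : tnth (cons_pair (x, v)) ord0 = x by rewrite (tnth_nth x).
apply/forall_inP/idP => [h|h i].
  have := h ord0; rewrite !inE eqxx => /(_ isT)/forall_inP/(_ (lift ord0 e)).
  by rewrite !inE eqxx orbT => /(_ isT); rewrite neq_lift/= t0 tnthS.
rewrite !inE => /orP[] /eqP ->; apply/forall_inP => j; rewrite !inE => /orP[] /eqP ->;
  by rewrite ?eqxx// ?t0 ?tnthS ?h ?implybT// kappaC h implybT.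
Qed.

Lemma measurable_latent_graph n (G : graph n) :
  measurable_fun setT (fun v : n.-tuple T => latent_graph v == G).
Proof.
rewrite (_ : (fun _ => _) = (fun v => [forall e, (e \in latent_graph v) == (e \in G)])).
  apply: measurable_forallb => e; apply: measurable_eqb.
  rewrite (_ : (fun _ => _) = (fun v : n.-tuple T => [forall i in val e, forall j in val e,
    (i != j) ==> kappa (tnth v i) (tnth v j)])); last by apply/funext => v; rewrite inE.
  apply: measurable_forallb => i; apply: measurable_impb => _.
  apply: measurable_forallb => j; apply: measurable_impb => _; apply: measurable_impb => _.
  by apply: measurable_kappa; exact: measurable_tnth.
apply/funext => v; apply/eqP/forallP => [-> e|h]; first exact: eqxx.
by apply/setP => e; apply/eqP.
Qed.

Lemma measurable_latent_row n d1 (X : measurableType d1) (f : X -> T) (g : X -> n.-tuple T) (S : {set 'I_n}) :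
  measurable_fun setT f -> measurable_fun setT g ->
  measurable_fun setT (fun x => latent_row (f x) (g x) == S).
Proof.
move=> mf mg.
rewrite (_ : (fun _ => _) = (fun x => [forall i, kappa (f x) (tnth (g x) i) == (i \in S)])).
  apply: measurable_forallb => i; apply: measurable_eqb; apply: measurable_kappa => //.
  exact: (measurableT_comp (measurable_tnth i) mg).
apply/funext => x; apply/eqP/forallP => [<- i|h]; first by rewrite inE.
by apply/setP => i; rewrite inE; apply/eqP.
Qed.

Definition latent_law n (G : graph n) : R := fine (pow n [set v | latent_graph v = G]).

Definition graph_indic n (G : graph n) (v : n.-tuple T) : R := (latent_graph v == G)%:R.

Lemma measurable_graph_indic n (G : graph n) : measurable_fun setT (graph_indic G).
Proof. by apply: measurable_natb; exact: measurable_latent_graph. Qed.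

Lemma latent_law_integral n (G : graph n) :
  (latent_law G)%:E = \int[pow n]_v ((latent_graph v == G)%:R)%:E.
Proof.
have mS : measurable [set v : n.-tuple T | latent_graph v = G].
  rewrite (_ : [set _ | _] = (fun v : n.-tuple T => latent_graph v == G) @^-1` [set true]).
    by rewrite -[X in measurable X]setTI; exact: measurable_latent_graph.
  by apply/seteqP; split => v /= /eqP.
rewrite /latent_law fineK; last first.
  rewrite ge0_fin_numE//; apply: (@le_lt_trans _ _ (pow n setT)).
    by apply: le_measure; rewrite ?inE.
  by rewrite power_setT ltry.
rewrite -[in LHS](setIT [set v | _]) -integral_indic//.
apply: eq_integral => v _; congr (_%:E); rewrite indicE; congr (_%:R)%R.
by congr nat_of_bool; apply/idP/idP; rewrite inE => /eqP.
Qed.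

Lemma sum_latent_law n : (\sum_(G : graph n) latent_law G = 1)%R.
Proof.
suff : (\sum_(G : graph n) latent_law G)%:E = 1%:E by case.
rewrite -sumEFin; under eq_bigr do rewrite latent_law_integral.
rewrite -ge0_integral_sum//; last first.
  by move=> G; apply/measurable_EFinP; exact: measurable_graph_indic.
- transitivity (\int[pow n]_v (cst 1 v)); last exact: integral_power1.
  apply: eq_integral => v _; rewrite sumEFin (bigD1 (latent_graph v))//= eqxx big1 ?addr0//.
  by move=> G; rewrite eq_sym => /negbTE ->.
Qed.

Definition row_law n (v : n.-tuple T) (S : {set 'I_n}) : \bar R :=
  \int[sigma]_x ((latent_row x v == S)%:R)%:E.

Lemma measurable_row_event n (S : {set 'I_n}) :
  measurable_fun setT (fun z : n.-tuple T * T => ((latent_row z.2 z.1 == S)%:R)%:E : \bar R).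
Proof.
apply/measurable_EFinP; apply: measurable_natb.
by apply: measurable_latent_row; [exact: measurable_snd|exact: measurable_fst].
Qed.

Lemma measurable_row_law n (S : {set 'I_n}) : measurable_fun setT (fun v => row_law v S).
Proof.
apply: (@measurable_fun_fubini_tonelli_F _ _ _ _ _ sigma
  (fun z : n.-tuple T * T => ((latent_row z.2 z.1 == S)%:R)%:E)).
  exact: measurable_row_event.
by move=> z; rewrite lee_fin.
Qed.

Lemma measurable_row_event1 n (v : n.-tuple T) (S : {set 'I_n}) :
  measurable_fun setT (fun x => ((latent_row x v == S)%:R)%:E : \bar R).
Proof.
apply/measurable_EFinP; apply: measurable_natb; apply: measurable_latent_row => //.
Qed.

Lemma row_law_ge0 n (v : n.-tuple T) (S : {set 'I_n}) : 0 <= row_law v S.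
Proof. by apply: integral_ge0 => x _; rewrite lee_fin. Qed.

Lemma row_law_le1 n (v : n.-tuple T) (S : {set 'I_n}) : row_law v S <= 1.
Proof.
apply: (@le_trans _ _ (\int[sigma]_x (cst 1 x))); last by rewrite integral_prob1.
apply: ge0_le_integral => //; first exact: measurable_row_event1.
by move=> x _; rewrite /cst lee_fin lern1 leq_b1.
Qed.

Lemma row_law_fin n (v : n.-tuple T) (S : {set 'I_n}) : exists2 r : R, row_law v S = r%:E & (0 <= r <= 1)%R.
Proof.
have h : row_law v S \is a fin_num.
  rewrite ge0_fin_numE; last exact: row_law_ge0.
  exact: le_lt_trans (row_law_le1 _ _) (ltry _).
exists (fine (row_law v S)); first by rewrite fineK.
by rewrite -!lee_fin fineK// row_law_ge0 row_law_le1.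
Qed.

Lemma sum_row_law n (v : n.-tuple T) : \sum_(S : {set 'I_n}) row_law v S = 1.
Proof.
rewrite -ge0_integral_sum//; last by move=> S; exact: measurable_row_event1.
transitivity (\int[sigma]_x (cst 1 x)); last exact: integral_prob1.
apply: eq_integral => x _; rewrite sumEFin (bigD1 (latent_row x v))//= eqxx big1 ?addr0//.
by move=> S; rewrite eq_sym => /negbTE ->.
Qed.

Definition latent_joint n (G : graph n) (S : {set 'I_n}) : R :=
  fine (\int[pow n]_v ((graph_indic G v)%:E * row_law v S)).

(** This is the [M] of [kl_div_chain]. Squaring inside the integral conditions on the positions,
    which determine the row law explicitly, while the graph alone does not. *)
Definition latent_joint2 n (G : graph n) (S : {set 'I_n}) : R :=
  fine (\int[pow n]_v ((graph_indic G v)%:E * (row_law v S * row_law v S))).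

Lemma integral_power_fin n (f : n.-tuple T -> \bar R) : measurable_fun setT f ->
  (forall v, 0 <= f v <= 1) -> (fine (\int[pow n]_v f v))%:E = \int[pow n]_v f v.
Proof.
move=> mf f01; rewrite fineK// ge0_fin_numE; last first.
  by apply: integral_ge0 => v _; have /andP[] := f01 v.
apply: (@le_lt_trans _ _ (\int[pow n]_v (cst 1 v))); last first.
  by rewrite integral_power1 ltry.
apply: ge0_le_integral => //; first by move=> v _; have /andP[] := f01 v.
by move=> v _; have /andP[] := f01 v.
Qed.

Lemma measurable_indic_row n (G : graph n) S :
  measurable_fun setT (fun v => (graph_indic G v)%:E * row_law v S).
Proof.
apply: emeasurable_funM; last exact: measurable_row_law.
by apply/measurable_EFinP; exact: measurable_graph_indic.
Qed.

Lemma measurable_indic_row2 n (G : graph n) S :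
  measurable_fun setT (fun v => (graph_indic G v)%:E * (row_law v S * row_law v S)).
Proof.
apply: emeasurable_funM; first by apply/measurable_EFinP; exact: measurable_graph_indic.
by apply: emeasurable_funM; exact: measurable_row_law.
Qed.

Lemma indic_row_itv n (G : graph n) S v : 0 <= (graph_indic G v)%:E * row_law v S <= 1.
Proof.
rewrite /graph_indic; have [r -> /andP[r0 r1]] := row_law_fin v S.
by rewrite -EFinM !lee_fin mulr_ge0//= mulr_ile1// lern1 leq_b1.
Qed.

Lemma indic_row2_itv n (G : graph n) S v :
  0 <= (graph_indic G v)%:E * (row_law v S * row_law v S) <= 1.
Proof.
rewrite /graph_indic; have [r -> /andP[r0 r1]] := row_law_fin v S.
by rewrite -!EFinM !lee_fin !mulr_ge0//= !mulr_ile1 ?mulr_ge0// lern1 leq_b1.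
Qed.

Lemma indic_row_ge0 n (G : graph n) S v : 0 <= (graph_indic G v)%:E * row_law v S.
Proof. by have /andP[] := indic_row_itv G S v. Qed.

Lemma indic_row2_ge0 n (G : graph n) S v :
  0 <= (graph_indic G v)%:E * (row_law v S * row_law v S).
Proof. by have /andP[] := indic_row2_itv G S v. Qed.

Lemma latent_jointE n (G : graph n) S :
  (latent_joint G S)%:E = \int[pow n]_v ((graph_indic G v)%:E * row_law v S).
Proof.
by apply: integral_power_fin; [exact: measurable_indic_row|exact: indic_row_itv].
Qed.

Lemma latent_joint2E n (G : graph n) S :
  (latent_joint2 G S)%:E = \int[pow n]_v ((graph_indic G v)%:E * (row_law v S * row_law v S)).
Proof.
by apply: integral_power_fin; [exact: measurable_indic_row2|exact: indic_row2_itv].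
Qed.

Lemma latent_joint_ge0 n (G : graph n) S : (0 <= latent_joint G S)%R.
Proof. by rewrite -lee_fin latent_jointE integral_ge0// => v _; exact: indic_row_ge0. Qed.

Lemma latent_joint2_ge0 n (G : graph n) S : (0 <= latent_joint2 G S)%R.
Proof. by rewrite -lee_fin latent_joint2E integral_ge0// => v _; exact: indic_row2_ge0. Qed.

Lemma latent_law_ge0 n (G : graph n) : (0 <= latent_law G)%R.
Proof. by rewrite -lee_fin latent_law_integral integral_ge0// => v _; rewrite lee_fin. Qed.

Lemma sum_latent_joint n (G : graph n) : (\sum_S latent_joint G S = latent_law G)%R.
Proof.
suff : (\sum_S latent_joint G S)%:E = (latent_law G)%:E by case.
rewrite -sumEFin; under eq_bigr do rewrite latent_jointE.
rewrite -ge0_integral_sum//; last 2 first.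
- by move=> S; exact: measurable_indic_row.
- by move=> S v _; exact: indic_row_ge0.
rewrite latent_law_integral; apply: eq_integral => v _.
rewrite -ge0_sume_distrr; last by move=> S _; exact: row_law_ge0.
by rewrite sum_row_law mule1.
Qed.

(** Cauchy-Schwarz on the set of positions that produce G: the integral of (r - c)^2 over this set
    is nonnegative for every c >= 0, and c is taken to be the ratio of joint to marginal. If the
    marginal vanishes, so does the joint. *)
Lemma latent_joint_sq n (G : graph n) S :
  (latent_joint G S ^+ 2 <= latent_law G * latent_joint2 G S)%R.
Proof.
have key (c : R) : (0 <= c)%R ->
    (2 * c * latent_joint G S <= latent_joint2 G S + c ^+ 2 * latent_law G)%R.
  move=> c0; rewrite -lee_fin EFinD EFinM (EFinM (c ^+ 2)) latent_jointE latent_joint2E latent_law_integral.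
  have m1 := measurable_indic_row G S; have m2 := measurable_indic_row2 G S.
  have n1 v : 0 <= (graph_indic G v)%:E * row_law v S by exact: indic_row_ge0.
  have n2 v : 0 <= (graph_indic G v)%:E * (row_law v S * row_law v S) by exact: indic_row2_ge0.
  have m3 : measurable_fun setT (fun v : n.-tuple T => (graph_indic G v)%:E : \bar R).
    by apply/measurable_EFinP; exact: measurable_graph_indic.
  have c20 : (0 <= c ^+ 2)%R by rewrite exprn_ge0.
  rewrite -ge0_integralZl_EFin//; last by rewrite mulr_ge0.
  rewrite -ge0_integralZl_EFin// -ge0_integralD//; last 2 first.
  - by move=> v _; rewrite -EFinM lee_fin mulr_ge0.
  - exact: (emeasurable_funM _ m3).
  apply: ge0_le_integral => //.
  - by move=> v _; rewrite mule_ge0// lee_fin mulr_ge0.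
  - exact: emeasurable_funM.
  - by apply: emeasurable_funD => //; exact: (emeasurable_funM _ m3).
  move=> v _; rewrite /graph_indic; have [r -> /andP[r0 r1]] := row_law_fin v S.
  rewrite -!EFinM -EFinD lee_fin; case: (_ == _) => /=; last by rewrite !mul0r !mulr0 addr0.
  by have := sqr_ge0 (r - c); nra.
have L0 := latent_law_ge0 G; have J0 := latent_joint_ge0 G S; have M0 := latent_joint2_ge0 G S.
have [L1|L1] := eqVneq (latent_law G) 0%R.
  have : (latent_joint G S <= latent_law G)%R.
    rewrite -sum_latent_joint (bigD1 S)//= lerDl; apply: sumr_ge0 => S' _.
    exact: latent_joint_ge0.
  rewrite L1 mul0r => J1; have -> : latent_joint G S = 0%R by apply/eqP; rewrite eq_le J1 J0.
  by rewrite expr0n.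
have {}L1 : (0 < latent_law G)%R by rewrite lt_def L1 L0.
have := key (latent_joint G S / latent_law G)%R (divr_ge0 J0 L0).
set j := latent_joint G S; set l := latent_law G in L1 *; set k := latent_joint2 G S.
have -> : ((j / l) ^+ 2 * l = j ^+ 2 / l)%R by field; rewrite gt_eqF.
have -> : (2 * (j / l) * j = 2 * (j ^+ 2 / l))%R by field; rewrite gt_eqF.
move=> h; have {}h : (j ^+ 2 / l <= k)%R by lra.
by move: h; rewrite ler_pdivrMr// mulrC.
Qed.

Lemma latent_lawS n (G : graph n.+1) :
  latent_law G = latent_joint (graph_tail G) (graph_head G).
Proof.
suff : (latent_law G)%:E = (latent_joint (graph_tail G) (graph_head G))%:E by case.
rewrite latent_law_integral latent_jointE integral_power_measureS2//; last first.
  by apply/measurable_EFinP; exact: measurable_graph_indic.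
apply: eq_integral => v _; rewrite -ge0_integralZl_EFin//; last exact: measurable_row_event1.
apply: eq_integral => x _; rewrite -EFinM; congr (_%:E).
rewrite /graph_indic -natrM mulnb; congr (_%:R)%R; congr nat_of_bool.
have [<- <-] := latent_graph_cons x v.
apply/eqP/andP => [->|[/eqP h1 /eqP h2]]; first by rewrite !eqxx.
by apply: (bij_inj (@graph_split_bij n)); rewrite h1 h2.
Qed.

(** The factor that one position z contributes to the product of two likelihood ratios, averaged
    over a Bernoulli edge: two rows can only contribute where they agree. *)
Definition latent_weight (x x' z : T) : R :=
  if kappa x z == kappa x' z then (if kappa x z then p else 1 - p)^-1%R else 0%R.

Lemma latent_weight_ge0 x x' z : (0 <= latent_weight x x' z)%R.
Proof.
have /andP[p0 p1] := p01; rewrite /latent_weight; case: ifP => // _.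
by rewrite invr_ge0; case: ifP => _; rewrite ?subr_ge0 ltW.
Qed.

Lemma measurable_latent_weight d1 (X : measurableType d1) (f g h : X -> T) :
  measurable_fun setT f -> measurable_fun setT g -> measurable_fun setT h ->
  measurable_fun setT (fun x => latent_weight (f x) (g x) (h x)).
Proof.
move=> mf mg mh; rewrite /latent_weight.
rewrite (_ : (fun _ => _) = (fun x => if kappa (f x) (h x) then
   (if kappa (g x) (h x) then p^-1 else 0) else
   (if kappa (g x) (h x) then 0 else (1 - p)^-1) : R))%R.
  by apply: measurable_fun_ifT; [exact: measurable_kappa| |];
    apply: measurable_fun_ifT => //; exact: measurable_kappa.
by apply/funext => x; case: (kappa (f x) _); case: (kappa (g x) _).
Qed.

(* The second moment of the likelihood ratio of a row of length n is the mean of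
   latent_corr x x' ^+ n over independent x and x'. *)
Definition latent_corr (x x' : T) : \bar R := \int[sigma]_z (latent_weight x x' z)%:E.

(** At most one S, the common value of the two rows, survives in the sum, and [bern] is itself a
    product over vertices. This turns a sum over rows into a product over positions. *)
Lemma prod_latent_weight n (x x' : T) (v : n.-tuple T) :
  (\prod_(i < n) latent_weight x x' (tnth v i) =
  \sum_(S : {set 'I_n}) (bern p S)^-1 * ((latent_row x v == S)%:R * (latent_row x' v == S)%:R))%R.
Proof.
rewrite [RHS](bigD1 (latent_row x v))//= eqxx mul1r [X in (_ + X)%R]big1 ?addr0; last first.
  by move=> S; rewrite eq_sym => /negbTE ->; rewrite mul0r mulr0.
have [E|E] := eqVneq (latent_row x' v) (latent_row x v).
  rewrite mulr1 /bern -prodfV; apply: eq_bigr => i _; rewrite /latent_weight.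
  move/setP/(_ i): E; rewrite !inE => ->; rewrite eqxx.
  by case: ifP.
have /existsP[i hi] : [exists i, kappa x (tnth v i) != kappa x' (tnth v i)].
  move: E; apply: contraR; rewrite negb_exists => /forallP h.
  by apply/eqP/setP => i; rewrite !inE; have := h i; rewrite negbK => /eqP.
by rewrite mulr0 (bigD1 i)//= /latent_weight (negbTE hi) mul0r.
Qed.

Lemma row_law_sq n (v : n.-tuple T) S : row_law v S * row_law v S =
  \int[sigma \x sigma]_z (((latent_row z.1 v == S)%:R * (latent_row z.2 v == S)%:R))%:E.
Proof.
rewrite (fubini_tonelli1 (fun z : T * T => (((latent_row z.1 v == S)%:R * (latent_row z.2 v == S)%:R))%:E)) /=; last 2 first.
- by apply/measurable_EFinP; apply: measurable_funM; apply: measurable_natb; apply: measurable_latent_row.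
- by move=> z; rewrite lee_fin mulr_ge0.
rewrite {1}/row_law -ge0_integralZr//; last exact: row_law_ge0.
  apply: eq_integral => x _; rewrite /fubini_F/= -ge0_integralZl_EFin//.
  exact: measurable_row_event1.
exact: measurable_row_event1.
Qed.

(** Summing over G removes the graph indicator. The squared row law is expanded over two independent
    copies x, x' of the new point, and the sum over rows becomes a product over positions. With the
    copies fixed by Fubini, the n positions are independent and each contributes one factor
    [latent_corr]. *)
Lemma sum_latent_joint2 n :
  (\sum_(G : graph n) \sum_(S : {set 'I_n}) latent_joint2 G S / bern p S)%:E =
  \int[sigma \x sigma]_z (latent_corr z.1 z.2) ^+ n.
Proof.
have b0 (S : {set 'I_n}) : (0 <= (bern p S)^-1)%R by rewrite invr_ge0 ltW// bern_gt0.
have mH : measurable_fun setT (fun u : n.-tuple T * (T * T) =>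
    (\prod_(i < n) latent_weight u.2.1 u.2.2 (tnth u.1 i))%:E : \bar R).
  apply/measurable_EFinP; apply: measurable_prod => i _; apply: measurable_latent_weight.
  - by apply: (measurableT_comp measurable_fst); exact: measurable_snd.
  - by apply: (measurableT_comp measurable_snd); exact: measurable_snd.
  - by apply: (measurableT_comp (measurable_tnth i)); exact: measurable_fst.
have H0 (u : n.-tuple T * (T * T)) : 0 <= (\prod_(i < n) latent_weight u.2.1 u.2.2 (tnth u.1 i))%:E.
  by rewrite lee_fin prodr_ge0// => i _; exact: latent_weight_ge0.
transitivity (\int[pow n]_v \int[sigma \x sigma]_z (\prod_(i < n) latent_weight z.1 z.2 (tnth v i))%:E).
  transitivity (\int[pow n]_v \sum_(S : {set 'I_n}) ((bern p S)^-1)%:E * (row_law v S * row_law v S)).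
    rewrite exchange_big/= -sumEFin ge0_integral_sum//; last 2 first.
    - by move=> S; apply: emeasurable_funM => //; apply: emeasurable_funM; exact: measurable_row_law.
    - by move=> S v _; rewrite mule_ge0 ?lee_fin// mule_ge0 ?row_law_ge0.
    apply: eq_bigr => S _.
    rewrite ge0_integralZl_EFin//; last 2 first.
    - by move=> v _; rewrite mule_ge0 ?row_law_ge0.
    - by apply: emeasurable_funM; exact: measurable_row_law.
    rewrite -mulr_suml mulrC EFinM; congr (_ * _).
    rewrite -sumEFin; under eq_bigr do rewrite latent_joint2E.
    rewrite -ge0_integral_sum//; last 2 first.
    - by move=> G; exact: measurable_indic_row2.
    - by move=> G v _; exact: indic_row2_ge0.
    apply: eq_integral => v _.
    rewrite (bigD1 (latent_graph v))//= big1 ?adde0; last first.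
      by move=> G; rewrite /graph_indic eq_sym => /negbTE ->; rewrite mul0e.
    by rewrite /graph_indic eqxx mul1e.
  apply: eq_integral => v _.
  under [RHS]eq_integral do rewrite prod_latent_weight -sumEFin.
  rewrite ge0_integral_sum//; last 2 first.
  - move=> S; apply/measurable_EFinP; apply: measurable_funM => //.
    apply: measurable_funM; apply: measurable_natb; apply: measurable_latent_row => //.
  - by move=> S z _; rewrite lee_fin mulr_ge0// mulr_ge0.
  apply: eq_bigr => S _; rewrite row_law_sq -ge0_integralZl_EFin//.
  apply/measurable_EFinP; apply: measurable_funM; apply: measurable_natb; apply: measurable_latent_row => //.
transitivity (\int[sigma \x sigma]_z \int[pow n]_v
    (\prod_(i < n) latent_weight z.1 z.2 (tnth v i))%:E).
  exact: (@fubini_tonelli _ _ _ _ R (pow n)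
    (product_subprobability (sigma : subprobability T R, sigma : subprobability T R)) (fun u : n.-tuple T * (T * T) =>
    (\prod_(i < n) latent_weight u.2.1 u.2.2 (tnth u.1 i))%:E) mH H0).
apply: eq_integral => z _ /=.
rewrite (integral_prod_tnth sigma n (h := latent_weight z.1 z.2))//.
- by apply: measurable_latent_weight => //; exact: measurable_id.
- by move=> x; exact: latent_weight_ge0.
Qed.

Lemma latent_kl_step n (X : R) : \int[sigma \x sigma]_z (latent_corr z.1 z.2) ^+ n <= X%:E ->
  (kl_div (@latent_law n.+1%N) (@bern R p (vpair n.+1)) <= kl_div (@latent_law n) (@bern R p (vpair n)) + (X - 1))%R.
Proof.
move=> hX; rewrite {1}/kl_div.
under eq_bigr do rewrite latent_lawS bern_graphS.
rewrite (sum_graphS (fun G S => latent_joint G S * ln (latent_joint G S / (bern p G * bern p S))))%R.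
apply: le_trans (kl_div_chain (P := @latent_joint n) (PA := @latent_law n) (M := @latent_joint2 n) _ _ _ _ _ _) _.
- exact: latent_joint_ge0.
- exact: sum_latent_joint.
- by move=> G; exact: bern_gt0.
- by move=> G; exact: bern_gt0.
- exact: latent_joint2_ge0.
- exact: latent_joint_sq.
rewrite lerD2l sum_latent_law lerD2r -lee_fin sum_latent_joint2//.
Qed.

Lemma latent_kl0 : kl_div (@latent_law 0%N) (@bern R p (vpair 0)) = 0%R.
Proof.
have c0 : #|{: vpair 0}| = 0%N by rewrite card_vpair.
have g0 (G : graph 0) : G = finset.set0.
  by apply/setP => e; have := card0_eq c0 e; rewrite !inE.
have b1 (G : graph 0) : bern p G = 1%R.
  by rewrite /bern big_pred0// => e; have := card0_eq c0 e; rewrite !inE.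
have l1 : latent_law (finset.set0 : graph 0) = 1%R.
  have := sum_latent_law 0; rewrite (bigD1 finset.set0)//= big1 ?addr0// => G.
  by rewrite (g0 G) eqxx.
rewrite /kl_div big1// => G _; rewrite b1 (g0 G) l1 divr1 ln1 mulr0//.
Qed.

Lemma latent_kl n (X : nat -> R) :
  (forall k, (k < n)%N -> \int[sigma \x sigma]_z (latent_corr z.1 z.2) ^+ k <= (X k)%:E) ->
  (kl_div (@latent_law n) (@bern R p (vpair n)) <= \sum_(k < n) (X k - 1))%R.
Proof.
elim: n => [|n IH] hX; first by rewrite latent_kl0 big_ord0.
rewrite big_ord_recr/=; apply: le_trans (latent_kl_step (hX n (ltnSn n))) _.
by rewrite lerD2r IH// => k kn; apply: hX; exact: ltnW.
Qed.

End latent.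

(** * Correlation of two rows on the sphere *)

Section sphere_correlation.
Local Open Scope ereal_scope.
Context (R : realType) (m : nat) (t : R).
Local Notation V := (vec R m.+2).
Local Notation sig := (sphere_unif R m.+2).

Definition cap_rel (x y : V) : bool := (t <= dotp x y)%R.

Lemma cap_relC x y : cap_rel x y = cap_rel y x.
Proof. by rewrite /cap_rel dotpC. Qed.

Lemma measurable_cap_rel : measurable_fun setT (fun z : V * V => cap_rel z.1 z.2).
Proof.
apply: measurable_fun_ler => //; apply: measurable_dotp_comp.
  exact: measurable_fst.
exact: measurable_snd.
Qed.

Let p := Psi m.+1 t.
Hypothesis p01 : (0 < p < 2^-1)%R.

Let p1 : (0 < p < 1)%R.
Proof. by have /andP[? ?] := p01; apply/andP; split; lra. Qed.

Lemma integral_sphere_cst (c : R) : \int[sig]_x (cst c%:E x) = c%:E.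
Proof. by rewrite integral_cst// [X in _ * X]probability_setT mule1. Qed.

Lemma pair_cap_ge0 (w w' : V) : 0 <= pair_cap t w w'.
Proof. by apply: integral_ge0 => x _; rewrite lee_fin mulr_ge0. Qed.

Lemma pair_cap_le (w w' : V) : dotp w w = 1%R -> pair_cap t w w' <= p%:E.
Proof.
move=> w1; rewrite /p -(@integral_cap R m.+1 w t w1).
have m1 := @measurable_cap R m.+1.
apply: ge0_le_integral => //.
- by apply/measurable_EFinP; exact: measurable_funM.
- by apply/measurable_EFinP.
- by move=> x _; rewrite lee_fin ler_piMr// lern1 leq_b1.
Qed.

Let mtriple (f g : V * V -> V) : measurable_fun setT f -> measurable_fun setT g ->
  measurable_fun setT (fun z : V * V => ((t <= dotp (f z) (g z))%R%:R : R)).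
Proof.
by move=> mf mg; apply: measurable_natb; apply: measurable_fun_ler => //; exact: measurable_dotp_comp.
Qed.

Let mpair (w : V) : measurable_fun setT (fun z : V * V =>
  ((t <= dotp z.2 w)%R%:R * (t <= dotp z.2 z.1)%R%:R)%:E : \bar R).
Proof.
apply/measurable_EFinP; apply: measurable_funM; apply: mtriple => //.
Qed.

Lemma measurable_pair_cap (w : V) : measurable_fun setT (fun w' => pair_cap t w w').
Proof.
apply: (@measurable_fun_fubini_tonelli_F _ _ _ _ _ sig (fun z : V * V =>
  ((t <= dotp z.2 w)%R%:R * (t <= dotp z.2 z.1)%R%:R)%:E) (mpair w)) => z.
by rewrite lee_fin mulr_ge0.
Qed.

(** For fixed x, the points w' whose cap contains x have measure p whatever x is, so averaging over
    w' decouples the two events. This is why gamma has mean zero. *)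
Lemma integral_pair_cap (w : V) : dotp w w = 1%R ->
  \int[sig]_w' pair_cap t w w' = (p ^+ 2)%:E.
Proof.
move=> w1.
have H0 (z : V * V) : 0 <= ((t <= dotp z.2 w)%R%:R * (t <= dotp z.2 z.1)%R%:R : R)%:E.
  by rewrite lee_fin mulr_ge0.
transitivity (\int[sig]_x \int[sig]_w' ((t <= dotp x w)%R%:R * (t <= dotp x w')%R%:R)%:E).
  exact: (@fubini_tonelli _ _ _ _ R sig sig _ (mpair w) H0).
transitivity (\int[sig]_x (p%:E * ((t <= dotp x w)%R%:R)%:E)).
  apply: eq_integral_sphere => //.
  - apply: (@measurable_fun_fubini_tonelli_G _ _ _ _ _ sig _ (mpair w)) => z.
    by rewrite lee_fin mulr_ge0.
  - by move=> x; apply: integral_ge0 => y _; rewrite lee_fin mulr_ge0.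
  - apply: emeasurable_funM => //; apply/measurable_EFinP; exact: measurable_cap.
  - by move=> x; rewrite mule_ge0// lee_fin// Psi_ge0.
  - move=> x x1; rewrite muleC -(@integral_cap R m.+1 x t x1) -ge0_integralZl_EFin//; last first.
      by apply/measurable_EFinP; exact: measurable_cap.
    by apply: eq_integral => y _; rewrite (dotpC y).
rewrite ge0_integralZl_EFin ?Psi_ge0//; last by apply/measurable_EFinP; exact: measurable_cap.
by rewrite integral_cap// -EFinM expr2.
Qed.

Local Notation corr := (latent_corr sig cap_rel p).

Lemma latent_corrE (w w' : V) : dotp w w = 1%R -> dotp w' w' = 1%R ->
  exists q, [/\ pair_cap t w w' = q%:E, (0 <= q <= p)%R &
    corr w w' = (1 + (q - p ^+ 2) / (p * (1 - p)))%R%:E].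
Proof.
move=> w1 w1'; have /andP[p0 ple] := p1.
have q1 := pair_cap_ge0 w w'; have q2 := pair_cap_le w' w1.
have qf : pair_cap t w w' \is a fin_num by rewrite ge0_fin_numE//; exact: le_lt_trans q2 (ltry _).
exists (fine (pair_cap t w w')); have qE := fineK qf.
set q := fine _ in qE *; split => //; first by rewrite -!lee_fin qE q1 q2.
have mw (x : V) : measurable_fun setT (fun z : V => ((t <= dotp z x)%R%:R)%:E : \bar R).
  by apply/measurable_EFinP; exact: measurable_cap.
have mW : measurable_fun setT (fun z : V => (latent_weight cap_rel p w w' z)%:E).
  apply/measurable_EFinP; apply: (measurable_latent_weight measurable_cap_rel) => //.
have mww : measurable_fun setT (fun z : V =>
    ((t <= dotp z w)%R%:R * (t <= dotp z w')%R%:R)%:E : \bar R).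
  by apply/measurable_EFinP; apply: measurable_funM; exact: measurable_cap.
have c0 : (0 <= (1 - p)^-1)%R by rewrite invr_ge0 subr_ge0 ltW.
have c1 : (0 <= p^-1)%R by rewrite invr_ge0 ltW.
have c2 : (0 <= p^-1 + (1 - p)^-1)%R by rewrite addr_ge0.
have W0 z : 0 <= (latent_weight cap_rel p w w' z)%:E by rewrite lee_fin latent_weight_ge0.
(* With a, b the two cap indicators, the weight is a b / p + (1 - a) (1 - b) / (1 - p). The negative
   terms are moved to the left so that only nonnegative functions are integrated. *)
have key : corr w w' + ((1 - p)^-1 * (p + p))%:E =
    ((1 - p)^-1)%:E + (p^-1 + (1 - p)^-1)%:E * q%:E.
  rewrite qE /latent_corr (EFinM (1 - p)^-1 (p + p))%R (EFinD p p) -{1}(@integral_cap R m.+1 w t w1) -(@integral_cap R m.+1 w' t w1').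
  rewrite -ge0_integralD//.
  rewrite -ge0_integralZl_EFin//; last 2 first.
  - by move=> x _; rewrite -EFinD lee_fin addr_ge0.
  - exact: emeasurable_funD.
  rewrite -ge0_integralD//; last 2 first.
  - by move=> x _; rewrite -EFinD -EFinM lee_fin mulr_ge0// addr_ge0.
  - by apply: emeasurable_funM => //; exact: emeasurable_funD.
  rewrite /pair_cap -ge0_integralZl_EFin//.
  transitivity (\int[sig]_z (cst ((1 - p)^-1)%:E z + (p^-1 + (1 - p)^-1)%:E *
      ((t <= dotp z w)%R%:R * (t <= dotp z w')%R%:R)%:E)); last first.
    rewrite ge0_integralD ?integral_sphere_cst//.
    - by move=> x _; rewrite -EFinM lee_fin !mulr_ge0.
    - exact: emeasurable_funM.
  apply: eq_integral => z _; rewrite /cst !(=^~ EFinM, =^~ EFinD); congr (_%:E).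
  rewrite /latent_weight /cap_rel (dotpC w) (dotpC w').
  by case: (t <= dotp z w)%R; case: (t <= dotp z w')%R => /=; ring.
have corrf : corr w w' \is a fin_num.
  rewrite ge0_fin_numE; last by apply: integral_ge0.
  apply: (@le_lt_trans _ _ (corr w w' + ((1 - p)^-1 * (p + p))%:E)).
    by rewrite leeDl// lee_fin mulr_ge0// addr_ge0// ltW.
  by rewrite key -EFinM -EFinD ltry.
rewrite -(fineK corrf) in key *; move: key; rewrite -!EFinM -!EFinD => -[key].
congr (_%:E); move/(canRL (addrK _)): key => ->.
have hp : (p != 0)%R by rewrite gt_eqF.
have hq : (1 - p != 0)%R by rewrite gt_eqF// subr_gt0.
by field; rewrite ?hp ?hq ?andbT//; apply/andP.
Qed.

Lemma measurable_corr : measurable_fun setT (fun z : V * V => corr z.1 z.2).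
Proof.
apply: (@measurable_fun_fubini_tonelli_F _ _ _ _ _ sig (fun z : (V * V) * V =>
  (latent_weight cap_rel p z.1.1 z.1.2 z.2)%:E)).
  apply/measurable_EFinP; apply: (measurable_latent_weight measurable_cap_rel) => //.
  - exact: (measurableT_comp measurable_fst measurable_fst).
  - exact: (measurableT_comp measurable_snd measurable_fst).
by move=> z; rewrite lee_fin latent_weight_ge0.
Qed.

Lemma measurable_corr1 (x : V) : measurable_fun setT (fun y => corr x y).
Proof.
apply: (measurableT_comp measurable_corr (g := fun y => (x, y))).
exact: measurable_pair1.
Qed.

Lemma corr_ge0 (x y : V) : 0 <= corr x y.
Proof. by apply: integral_ge0 => z _; rewrite lee_fin latent_weight_ge0. Qed.

Lemma integral_corr (w : V) : dotp w w = 1%R -> \int[sig]_w' corr w w' = 1.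
Proof.
move=> w1; have /andP[p0 ple] := p1; set c := ((p * (1 - p))^-1)%R.
have c0 : (0 <= c)%R by rewrite invr_ge0 mulr_ge0 ?subr_ge0// ltW.
have d0 : (0 <= c * p ^+ 2)%R by rewrite mulr_ge0// sqr_ge0.
have : \int[sig]_w' corr w w' + (c * p ^+ 2)%:E = 1 + (c * p ^+ 2)%:E.
  have eI : \int[sig]_w' (c%:E * pair_cap t w w') = (c * p ^+ 2)%:E.
    rewrite ge0_integralZl_EFin//; last 2 first.
    - by move=> x _; exact: pair_cap_ge0.
    - exact: measurable_pair_cap.
    by rewrite integral_pair_cap.
  transitivity (\int[sig]_w' (corr w w' + cst (c * p ^+ 2)%:E w')).
    apply/esym; rewrite ge0_integralD ?integral_sphere_cst//.
    - by move=> x _; exact: corr_ge0.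
    - exact: measurable_corr1.
  transitivity (\int[sig]_w' (cst 1 w' + c%:E * pair_cap t w w')); last first.
    rewrite ge0_integralD ?integral_sphere_cst ?eI//.
    - by move=> x _; rewrite mule_ge0// pair_cap_ge0.
    - by apply: emeasurable_funM => //; exact: measurable_pair_cap.
  apply: eq_integral_sphere => //.
  - by apply: emeasurable_funD => //; exact: measurable_corr1.
  - by move=> x; rewrite adde_ge0 ?corr_ge0// /cst lee_fin.
  - by apply: emeasurable_funD => //; apply: emeasurable_funM => //; exact: measurable_pair_cap.
  - by move=> x; rewrite adde_ge0// mule_ge0// pair_cap_ge0.
  move=> x x1; have [q [-> _ ->]] := latent_corrE w1 x1.
  rewrite /cst -EFinM -!EFinD; congr (_%:E); rewrite /c.
  have hp : (p != 0)%R by rewrite gt_eqF.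
  have hq : (1 - p != 0)%R by rewrite gt_eqF// subr_gt0.
  by field; rewrite ?hp ?hq ?andbT//; apply/andP.
by move/(congr1 (fun z => z - (c * p ^+ 2)%:E)); rewrite !addeK.
Qed.

End sphere_correlation.

(** In the induction step the two sides differ by g^2 (n (1 - n g) + 1), which is nonnegative
    because n g <= 1. *)
Lemma exp1D_le_quadratic (R : realType) (g : R) (n : nat) : 0 <= 1 + g -> n%:R * `|g| <= 1 ->
  (1 + g) ^+ n <= 1 + n%:R * g + (n%:R * g) ^+ 2.
Proof.
move=> g0; elim: n => [_|n IH h]; first by rewrite !mul0r expr0 expr0n/= !addr0.
have ng : n%:R * `|g| <= 1.
  by apply: le_trans h; rewrite ler_wpM2r// ler_nat.
rewrite exprSr; apply: le_trans (ler_wpM2r g0 (IH ng)) _.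
have n0 : 0 <= n%:R :> R by [].
have hg : n%:R * g <= 1 by apply: le_trans ng; rewrite ler_wpM2l// ler_norm.
have : 0 <= g ^+ 2 * (n%:R * (1 - n%:R * g) + 1).
  by rewrite mulr_ge0 ?sqr_ge0// addr_ge0// mulr_ge0// subr_ge0.
rewrite -[n.+1]addn1 natrD; nra.
Qed.

Section correlation_power.
Local Open Scope ereal_scope.
Context (R : realType) (m : nat) (t : R).
Local Notation V := (vec R m.+2).
Local Notation sig := (sphere_unif R m.+2).
Let p := Psi m.+1 t.
Hypothesis p01 : (0 < p < 2^-1)%R.
Local Notation corr := (latent_corr sig (@cap_rel R m t) p).

Context (n : nat) (a b e : R).
Hypotheses (a0 : (0 <= a)%R) (b0 : (0 <= b)%R) (e0 : (0 <= e)%R) (e2 : (e ^+ 2 <= 2^-1)%R).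
Hypothesis small_corr : forall (w w' : V) q, dotp w w = 1%R -> dotp w' w' = 1%R ->
  (`|dotp w' w| <= e)%R -> pair_cap t w w' = q%:E ->
  let g := ((q - p ^+ 2) / (p * (1 - p)))%R in
  (n%:R * `|g| <= 1 /\ (n%:R * g) ^+ 2 <= a + b * (dotp w' w) ^+ 2)%R.

Let X := (1 + (a + b / m.+2%:R + 4 * 2 ^+ n * Num.sqrt (1 - e ^+ 2) ^+ m.+2))%R.

(** For |<w, w'>| <= e the quadratic bound applies: its linear term averages to zero by
    [integral_corr], and its square is controlled by the second moment 1 / d. The remaining w' lie
    in two opposite caps of height e, whose measure must beat 2^n. *)
Lemma integral_corr_power (k : nat) (w : V) : (k <= n)%N -> dotp w w = 1%R ->
  \int[sig]_w' (corr w w' ^+ k) <= X%:E.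
Proof.
move=> kn w1; have /andP[p0 ph] := p01.
have p1 : (0 < p < 1)%R by rewrite p0/=; lra.
have wN1 : dotp (vscale (-1) w) (vscale (-1) w) = 1%R.
  by rewrite dotpZl dotpZr w1 mulr1 mulN1r opprK.
(* One 2^n bounds (1 + gamma)^k, the other bounds k. *)
pose c : R := (2 * 2 ^+ n)%R.
have c0 : (0 <= c)%R by rewrite mulr_ge0// exprn_ge0.
pose E1 (z : V) : \bar R := ((e <= dotp z w)%R%:R)%:E.
pose E2 (z : V) : \bar R := ((e <= dotp z (vscale (-1) w))%R%:R)%:E.
pose Q (z : V) : \bar R := ((dotp z w) ^+ 2)%:E.
have mE1 : measurable_fun setT E1 by apply/measurable_EFinP; exact: measurable_cap.
have mE2 : measurable_fun setT E2 by apply/measurable_EFinP; exact: measurable_cap.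
have mQ : measurable_fun setT Q.
  apply/measurable_EFinP; apply: measurable_funX.
  by apply: measurable_dotp_comp => //; exact: measurable_id.
have mC : measurable_fun setT (corr w) by exact: measurable_corr1.
have mCk : measurable_fun setT (fun z => corr w z ^+ k).
  elim: k {kn} => [|k IH]; first by rewrite (_ : (fun _ => _) = cst 1).
  rewrite (_ : (fun _ => _) = (fun z => corr w z * corr w z ^+ k)); last first.
    by apply/funext => z; rewrite expeS.
  exact: emeasurable_funM.
have E10 z : 0 <= E1 z by rewrite lee_fin.
have E20 z : 0 <= E2 z by rewrite lee_fin.
have Q0 z : 0 <= Q z by rewrite lee_fin sqr_ge0.
have C0 z : 0 <= corr w z by exact: corr_ge0.
have Ck0 z : 0 <= corr w z ^+ k by rewrite expe_ge0.
have a1 : (0 <= 1 + a)%R by rewrite addr_ge0.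
(* The linear term k gamma is written k [corr] - k, and -k is carried to the other side, so that
   every integrand is nonnegative. *)
pose G z := k%:R%:E * corr w z + ((1 + a)%:E + (b%:E * Q z + (c%:E * E1 z + c%:E * E2 z))).
have mcE1 : measurable_fun setT (fun z => c%:E * E1 z) by exact: emeasurable_funM.
have mcE2 : measurable_fun setT (fun z => c%:E * E2 z) by exact: emeasurable_funM.
have mbQ : measurable_fun setT (fun z => b%:E * Q z) by exact: emeasurable_funM.
have mkC : measurable_fun setT (fun z => k%:R%:E * corr w z) by exact: emeasurable_funM.
have mE : measurable_fun setT (fun z => c%:E * E1 z + c%:E * E2 z) by exact: emeasurable_funD.
have mbE : measurable_fun setT (fun z => b%:E * Q z + (c%:E * E1 z + c%:E * E2 z)).
  exact: emeasurable_funD.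
have maE : measurable_fun setT (fun z => (1 + a)%:E + (b%:E * Q z + (c%:E * E1 z + c%:E * E2 z))).
  exact: emeasurable_funD.
have cE10 z : 0 <= c%:E * E1 z by rewrite mule_ge0.
have cE20 z : 0 <= c%:E * E2 z by rewrite mule_ge0.
have bQ0 z : 0 <= b%:E * Q z by rewrite mule_ge0.
have kC0 z : 0 <= k%:R%:E * corr w z by rewrite mule_ge0// lee_fin.
have cE0 z : 0 <= c%:E * E1 z + c%:E * E2 z by rewrite adde_ge0.
have bE0 z : 0 <= b%:E * Q z + (c%:E * E1 z + c%:E * E2 z) by rewrite adde_ge0.
have aE0 z : 0 <= (1 + a)%:E + (b%:E * Q z + (c%:E * E1 z + c%:E * E2 z)) by rewrite adde_ge0.
have pointwise z : dotp z z = 1%R -> corr w z ^+ k + k%:R%:E <= G z.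
  move=> z1; have [q [hq /andP[q0 qp] hc]] := latent_corrE p01 w1 z1.
  rewrite -/p in qp hc *; rewrite /G hc -EFin_expe; set g := ((q - p ^+ 2) / _)%R.
  rewrite -!(EFinM, EFinD) lee_fin.
  have pp : (0 < p * (1 - p))%R by rewrite mulr_gt0// subr_gt0; have /andP[] := p1.
  have g1 : (g <= 1)%R by rewrite ler_pdivrMr// mul1r mulrBr mulr1 expr2 lerB.
  have g2 : (-1 <= g)%R.
    rewrite ler_pdivlMr//; have h : (0 <= p * (1 - 2 * p))%R by rewrite mulr_ge0//; lra.
    lra.
  have k0 : (0 <= k%:R :> R)%R by [].
  have knR : (k%:R <= n%:R :> R)%R by rewrite ler_nat.
  have [he|he] := leP `|dotp z w|%R e.
    have [h1 h2] := small_corr w1 z1 he hq; rewrite -/g in h1 h2.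
    have kg : (k%:R * `|g| <= 1)%R by apply: le_trans h1; rewrite ler_wpM2r.
    have g3 : (0 <= 1 + g)%R by lra.
    have hh := exp1D_le_quadratic g3 kg.
    have hk : ((k%:R * g) ^+ 2 <= (n%:R * g) ^+ 2)%R.
      by rewrite [leLHS]exprMn [leRHS]exprMn; apply: ler_wpM2r; [exact: sqr_ge0|by apply: lerXn2r; rewrite ?nnegrE].
    have t1 : (0 <= c * (e <= dotp z w)%R%:R)%R by rewrite mulr_ge0.
    have t2 : (0 <= c * (e <= dotp z (vscale (-1) w))%R%:R)%R by rewrite mulr_ge0.
    lra.
  have big : ((1 + g) ^+ k + k%:R <= k%:R * (1 + g) + c)%R.
    have s1 : ((1 + g) ^+ k <= 2 ^+ n)%R.
      apply: (@le_trans _ _ (2 ^+ k)%R); first by apply: lerXn2r; rewrite ?nnegrE; lra.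
      by apply: ler_weXn2l => //; lra.
    have s2 : (n%:R <= 2 ^+ n :> R)%R by rewrite -natrX ler_nat ltnW// ltn_expl.
    rewrite /c; nra.
  have b2 : (0 <= b * (dotp z w) ^+ 2)%R by rewrite mulr_ge0// sqr_ge0.
  have ind : (c <= c * (e <= dotp z w)%R%:R + c * (e <= dotp z (vscale (-1) w))%R%:R)%R.
    rewrite dotpZr mulN1r; move: he; rewrite lter_normr => /orP[] /ltW ->.
      by rewrite mulr1 lerDl mulr_ge0.
    by rewrite mulr1 lerDr mulr_ge0.
  lra.
have key : \int[sig]_w' (corr w w' ^+ k) + k%:R%:E <= X%:E + k%:R%:E.
  have -> : \int[sig]_w' (corr w w' ^+ k) + k%:R%:E = \int[sig]_w' (corr w w' ^+ k + cst k%:R%:E w').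
    by rewrite ge0_integralD ?integral_sphere_cst//; move=> x _; rewrite lee_fin.
  apply: (@le_trans _ _ (\int[sig]_w' G w')).
    apply: le_integral_sphere => //.
    - exact: emeasurable_funD.
    - by move=> z; rewrite adde_ge0// lee_fin.
    - exact: emeasurable_funD.
    - by move=> z; rewrite adde_ge0.
  rewrite ge0_integralD// ge0_integralZl_EFin ?ler0n// integral_corr// mule1.
  rewrite ge0_integralD// (integral_sphere_cst m (1 + a)%R).
  rewrite ge0_integralD// ge0_integralZl_EFin// sphere_second_moment//.
  rewrite ge0_integralD// !ge0_integralZl_EFin//.
  rewrite addeC leeD2r//.
  apply: (@le_trans _ _ ((1 + a)%:E + (b%:E * (m.+2%:R^-1)%:E +
     (c%:E * (Num.sqrt (1 - e ^+ 2) ^+ m.+2)%:E + c%:E * (Num.sqrt (1 - e ^+ 2) ^+ m.+2)%:E)))).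
    by rewrite !leeD2l// leeD// lee_wpmul2l ?lee_fin//; exact: sphere_tail.
  by rewrite -!(EFinM, EFinD) lee_fin /X /c; set S := (Num.sqrt _ ^+ _)%R; set N := (2 ^+ n)%R; set D := m.+2%:R^-1%R; lra.
by move: key; rewrite leeD2rE.
Qed.

Lemma integral_corr_power2 (k : nat) : (k <= n)%N ->
  \int[sig \x sig]_z (corr z.1 z.2 ^+ k) <= X%:E.
Proof.
move=> kn; have /andP[p0 ph] := p01.
have p1 : (0 < p < 1)%R by rewrite p0/=; lra.
have mC : measurable_fun setT (fun z : V * V => corr z.1 z.2 ^+ k).
  elim: k {kn} => [|k IH]; first by rewrite (_ : (fun _ => _) = cst 1).
  rewrite (_ : (fun _ => _) = (fun z : V * V => corr z.1 z.2 * corr z.1 z.2 ^+ k)); last first.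
    by apply/funext => z; rewrite expeS.
  by apply: emeasurable_funM => //; exact: measurable_corr.
have C0 (z : V * V) : 0 <= corr z.1 z.2 ^+ k by rewrite expe_ge0// corr_ge0.
rewrite (@fubini_tonelli1 _ _ _ _ R sig sig _ mC C0).
have X0 : (0 <= X)%R.
  by rewrite !addr_ge0// ?divr_ge0// !mulr_ge0// exprn_ge0// sqrtr_ge0.
rewrite -(integral_sphere_cst m X); apply: le_integral_sphere => //.
- exact: (@measurable_fun_fubini_tonelli_F _ _ _ _ _ sig _ mC C0).
- by move=> x; apply: integral_ge0 => y _; exact: (C0 (x, y)).
- by move=> x x1; rewrite /fubini_F/=; exact: integral_corr_power.
Qed.

End correlation_power.

(** * The total variation bound for fixed n *)

Section law_of_geo.
Context (R : realType) (m n : nat) (p : R).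
Local Notation V := (vec R m.+2).
Local Notation t := (tau m.+2 p).

Lemma Geo_latent (A : {set graph n}) :
  Geo m.+2 p A = \sum_(G in A) latent_law (sphere_unif R m.+2) (@cap_rel R m t) G.
Proof.
have mk := measurable_cap_rel (m := m) t.
have mG (G : graph n) := measurable_latent_graph mk G.
have mi (G : graph n) : measurable_fun setT (fun v : n.-tuple V =>
    ((latent_graph (cap_rel t) v == G)%:R)%:E : \bar R).
  by apply/measurable_EFinP; apply: measurable_natb; exact: mG.
pose pow := power_measure (sphere_unif R m.+2) n.
suff : (pow [set v | geo_graph t v \in A] =
    (\sum_(G in A) latent_law (sphere_unif R m.+2) (@cap_rel R m t) G)%:E)%E.
  by rewrite /Geo => ->.
have indE (v : n.-tuple V) : ((geo_graph t v \in A)%:R)%:E =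
    (\sum_(G in A) ((latent_graph (cap_rel t) v == G)%:R)%:E)%E :> \bar R.
  rewrite sumEFin; congr (_%:E).
  have [h|h] := boolP (geo_graph t v \in A).
    rewrite (bigD1 (geo_graph t v))//= eqxx big1 ?addr0// => G /andP[_ hG].
    by rewrite eq_sym (negbTE hG).
  rewrite big1// => G GA; case: eqP => // hG; move: h.
  by rewrite (_ : geo_graph t v = G)// GA.
have mS : measurable [set v : n.-tuple V | geo_graph t v \in A].
  rewrite (_ : [set _ | _] = \bigcup_(G in [set G | G \in A])
      ((fun v : n.-tuple V => latent_graph (cap_rel t) v == G) @^-1` [set true])).
    apply: fin_bigcup_measurable => // G _; rewrite -[X in measurable X]setTI.
    exact: mG.
  apply/seteqP; split => v /=; first by move=> h; exists (geo_graph t v) => //=; rewrite eqxx.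
  by move=> [G GA] /= /eqP hG; rewrite (_ : geo_graph t v = G).
rewrite -sumEFin; under eq_bigr do rewrite latent_law_integral//.
rewrite -(setIT [set v | _]) -integral_indic//.
transitivity (\int[pow]_v (\sum_(G in A) ((latent_graph (cap_rel t) v == G)%:R)%:E))%E.
  apply: eq_integral => v _; rewrite -indE; congr (_%:E); rewrite indicE; congr (_%:R).
  by congr nat_of_bool; apply/idP/idP; rewrite inE.
rewrite big_mkcond/=; under eq_integral do rewrite big_mkcond/=.
rewrite ge0_integral_sum//.
- by apply: eq_bigr => G _; case: ifP => // _; rewrite integral0.
- by move=> G; case: (G \in A).
- by move=> G v _; case: (G \in A); rewrite lee_fin.
Qed.

End law_of_geo.

Lemma sqrt_exp_le (R : realType) (x : R) (k : nat) :
  Num.sqrt (1 - x) ^+ k <= expR (- (k%:R * x / 2)).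
Proof.
have -> : expR (- (k%:R * x / 2)) = (expR (- (x / 2))) ^+ k.
  by rewrite -expRM_natl; congr expR; ring.
apply: lerXn2r; rewrite ?nnegrE ?sqrtr_ge0 ?expR_ge0//.
rewrite -[leRHS](ger0_norm (expR_ge0 _)) -sqrtr_sqr; apply: ler_wsqrtr.
rewrite expr2 -expRD; apply: le_trans (expR_ge1Dx _) _.
by rewrite ler_expR; lra.
Qed.

Section finite_bound.
Context (R : realType) (m n : nat) (p M : R).
Local Notation d := (m.+2%:R : R).
(* The event |<w, w'>| > e has probability at most 2 exp (- 4 n), which beats
   the trivial bound 2^n on (1 + gamma)^n. *)
Local Notation e := (Num.sqrt (8 * n%:R / d) : R).

(** [pair_bound] divided by p (1 - p) >= p / 2 bounds |gamma| by x + y |<w, w'>| + z; hence 18, 16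
    and 8 are twice 9, 8 and 4. The factor 3 comes from (x + y r + z)^2 <= 3 (x^2 + (y r)^2 + z^2).
    [corr_const] collects x and z, [corr_slope] the coefficient of r^2. *)
Definition corr_const : R :=
  3 * n%:R ^+ 2 * ((18 * expR 8 * p * M ^+ 2 / m.+2%:R) ^+ 2 + (8 * expR (- (M / 4)) / p) ^+ 2).
Definition corr_slope : R := 3 * n%:R ^+ 2 * (16 * expR 8 * p * M) ^+ 2.

Hypotheses (m_gt0 : (0 < m)%N) (p01 : 0 < p < 2^-1) (M1 : 1 <= M) (Md : 64 * M <= d)
  (Mp : expR (- (M / 2)) < p) (nd : 512 * n%:R <= d)
  (eta1 : expR 8 * (9 * (M ^+ 2 / d) + 8 * (M * e)) <= 1)
  (ab1 : corr_const + corr_slope * (8 * n%:R / d) <= 1).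

Let d0 : 0 < d. Proof. by rewrite ltr0n. Qed.

Lemma Psi_tauE : Psi m.+1 (tau m.+2 p) = p.
Proof.
have /andP[p0 ph] := p01.
apply: Psi_tau => //; first exact: ltW.
apply: (@le_trans _ _ (expR (- (m.+2%:R * 1 ^+ 2 / 4)))); first exact: Psi_tail_slope.
apply: le_trans (ltW Mp); rewrite ler_expR lerN2 expr1n mulr1.
by move: Md M1; lra.
Qed.

Let e0 : 0 <= e. Proof. exact: sqrtr_ge0. Qed.
Let e2 : e ^+ 2 = 8 * n%:R / d.
Proof. by rewrite sqr_sqrtr// divr_ge0 ?ltW// mulr_ge0. Qed.
Let e8 : e <= 8^-1.
Proof.
rewrite -[leRHS]ger0_norm ?invr_ge0// -sqrtr_sqr; apply: ler_wsqrtr.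
by rewrite ler_pdivrMr//; move: nd; rewrite expr2; lra.
Qed.

Lemma small_corrE (w w' : vec R m.+2) q : dotp w w = 1 -> dotp w' w' = 1 ->
  `|dotp w' w| <= e -> pair_cap (tau m.+2 p) w w' = q%:E ->
  let g := (q - p ^+ 2) / (p * (1 - p)) in
  n%:R * `|g| <= 1 /\ (n%:R * g) ^+ 2 <= corr_const + corr_slope * (dotp w' w) ^+ 2.
Proof.
move=> w1 w1' rho hq g; have /andP[p0 ph] := p01.
have M0 : 0 < M by apply: lt_le_trans M1.
(* The choice d T^2 = M turns the tail exponents of [pair_bound] into M / 2 and M / 4. *)
pose T := Num.sqrt (M / d).
have T2 : T ^+ 2 = M / d by rewrite sqr_sqrtr// divr_ge0 ?ltW.
have dT2 : d * T ^+ 2 = M by rewrite T2; field; rewrite gt_eqF.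
have dT4 : d * T ^+ 4 = M ^+ 2 / d.
  by rewrite (exprM T 2 2) T2; field; rewrite gt_eqF.
have T0 : 0 < T by rewrite sqrtr_gt0 divr_gt0.
have T8 : T <= 8^-1.
  rewrite -[leRHS]ger0_norm ?invr_ge0// -sqrtr_sqr; apply: ler_wsqrtr.
  by rewrite ler_pdivrMr//; move: Md; rewrite expr2; lra.
set r := `|dotp w' w| in rho.
have r0 : 0 <= r by exact: normr_ge0.
have etaE a : pair_eta m.+2 T a = expR 8 * (9 * (M ^+ 2 / d) + 8 * (M * a)).
  by rewrite /pair_eta dT4 dT2.
have Md0 : 0 <= M ^+ 2 / d by rewrite divr_ge0 ?sqr_ge0// ltW.
have eta_r : pair_eta m.+2 T r <= 1.
  apply: le_trans eta1; rewrite etaE ler_wpM2l ?expR_ge0// lerD2l ler_wpM2l//.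
  by rewrite ler_wpM2l// ltW.
have rC : r = `|dotp w w'| by rewrite /r dotpC.
have := @pair_bound R m m_gt0 (tau m.+2 p) T w w'; rewrite Psi_tauE dT2 -rC.
move=> /(_ T0 T8 M1 ph Mp w1 w1' (le_trans rho e8) eta_r)[q'].
rewrite hq => -[<-] hb.
set E := expR (- (M / 4)) in hb.
have E0 : 0 <= E by exact: expR_ge0.
have hg : `|g| <= 18 * expR 8 * p * M ^+ 2 / d + 16 * expR 8 * p * M * r + 8 * E / p.
  have pp : 0 < p * (1 - p) by rewrite mulr_gt0//; lra.
  rewrite /g normrM normfV (gtr0_norm pp) ler_pdivrMr//.
  apply: (le_trans hb); rewrite etaE.
  have -> : expR 8 * (9 * (M ^+ 2 / d) + 8 * (M * r)) * p ^+ 2 + 4 * E =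
     (18 * expR 8 * p * M ^+ 2 / d + 16 * expR 8 * p * M * r + 8 * E / p) * (p / 2).
    by field; rewrite ?gt_eqF.
  rewrite ler_wpM2l//; last by nra.
  have c0 : 0 <= expR 8 :> R by exact: expR_ge0.
  by rewrite !addr_ge0 ?divr_ge0 ?mulr_ge0 ?sqr_ge0// ?(ltW p0) ?(ltW M0) ?(ltW d0).
set x := 18 * expR 8 * p * M ^+ 2 / d in hg; set y := 16 * expR 8 * p * M in hg.
set z := 8 * E / p in hg.
have hg2 : (n%:R * g) ^+ 2 <= corr_const + corr_slope * r ^+ 2.
  rewrite /corr_const /corr_slope -/E -/x -/y -/z exprMn.
  have -> : 3 * n%:R ^+ 2 * (x ^+ 2 + z ^+ 2) + 3 * n%:R ^+ 2 * y ^+ 2 * r ^+ 2 =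
    n%:R ^+ 2 * (3 * (x ^+ 2 + (y * r) ^+ 2 + z ^+ 2)) by ring.
  rewrite ler_wpM2l ?sqr_ge0// -real_normK ?num_real//.
  apply: (@le_trans _ _ ((x + y * r + z) ^+ 2)); first by apply: lerXn2r; rewrite ?nnegrE//; exact: le_trans hg.
  have := sqr_ge0 (x - y * r); have := sqr_ge0 (x - z); have := sqr_ge0 (y * r - z).
  by rewrite !expr2; lra.
split; last by move: hg2; rewrite /r real_normK ?num_real.
have cs0 : 0 <= corr_slope by rewrite /corr_slope mulr_ge0 ?sqr_ge0// mulr_ge0 ?sqr_ge0.
have : (n%:R * g) ^+ 2 <= 1.
  apply: (le_trans hg2); apply: le_trans ab1; rewrite lerD2l ler_wpM2l// -e2.
  by apply: lerXn2r; rewrite ?nnegrE.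
rewrite -[X in _ <= X](expr1n _ 2) -real_normK ?num_real// ler_sqr ?nnegrE//.
by rewrite normrM ger0_norm.
Qed.

(** The free u of [kl_div_tv] is kept until the limit, where it is a fixed fraction of the target
    accuracy; this spares a square root. *)
Lemma dTV_finite (u : R) : 0 < u ->
  dTV (@Geo R m.+2 n p) (@ER R n p) <=
  n%:R * (corr_const + corr_slope / d + 4 * 2 ^+ n * expR (- (4 * n%:R))) / (2 * u) + 2 * u.
Proof.
move=> u0; have /andP[p0 ph] := p01.
have p1 : 0 < p < 1 by rewrite p0/=; lra.
have Ep : Psi m.+1 (tau m.+2 p) = p := Psi_tauE.
set t := tau m.+2 p in Ep.
have mk := measurable_cap_rel (m := m) t.
pose L := latent_law (sphere_unif R m.+2) (@cap_rel R m t) (n := n).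
pose Q := bern (R := R) p (T := vpair n).
have cc0 : 0 <= corr_const by rewrite /corr_const mulr_ge0 ?addr_ge0 ?sqr_ge0// mulr_ge0 ?sqr_ge0.
have cs0 : 0 <= corr_slope by rewrite /corr_slope mulr_ge0 ?sqr_ge0// mulr_ge0 ?sqr_ge0.
set S := corr_const + corr_slope / d + 4 * 2 ^+ n * expR (- (4 * n%:R)).
have kl : kl_div L Q <= n%:R * S.
  have -> : n%:R * S = \sum_(k < n) ((1 + S) - 1).
    by rewrite sumr_const card_ord [1 + S]addrC addrK mulr_natl.
  apply: (latent_kl mk (@cap_relC R m t) p1 (X := fun=> 1 + S)) => k kn.
  have hp : 0 < Psi m.+1 t < 2^-1 by rewrite Ep.
  have := @integral_corr_power2 R m t hp n corr_const corr_slope e cc0 cs0 e0 _ _ k (ltnW kn).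
  rewrite Ep => h; apply: le_trans (h _ _) _.
  - by rewrite e2 ler_pdivrMr//; move: nd; have : 0 <= n%:R :> R by []; lra.
  - exact: small_corrE.
  - rewrite lee_fin lerD2l /S lerD2l ler_wpM2l ?mulr_ge0 ?exprn_ge0//.
    apply: le_trans (sqrt_exp_le _ _) _; rewrite ler_expR e2 lerN2.
    have -> : d * (8 * n%:R / d) / 2 = 4 * n%:R by field; rewrite gt_eqF.
    by [].
have B0 : 0 <= n%:R * S / (2 * u) + 2 * u.
  have S0 : 0 <= S.
    by rewrite /S addr_ge0// addr_ge0// divr_ge0.
  have u2 : 0 <= 2 * u by rewrite mulr_ge0// ltW.
  by rewrite addr_ge0// divr_ge0// mulr_ge0.
rewrite /dTV; apply: bigmax_le => // A _.
rewrite Geo_latent -/t.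
have -> : ER p A = \sum_(G in A) Q G by [].
apply: le_trans (kl_div_tv (P := L) (Q := Q) A _ _ _ _ u0) _.
- by move=> G; exact: latent_law_ge0.
- exact: sum_latent_law.
- by move=> G; exact: bern_gt0.
- exact: sum_bern.
by rewrite lerD2r ler_wpM2r// invr_ge0 mulr_ge0// ltW.
Qed.

End finite_bound.

(** * Asymptotics *)

Section asymptotics.
Context (R : realType) (alpha p D N L : R).
Hypotheses (alpha_gt0 : 0 < alpha) (L1 : 1 <= L) (LN : L <= N)
  (p_gt : alpha / N < p) (D_ge : p ^+ 2 * N ^+ 3 * (6 * L ^+ 6) <= D).

Let N1 : 1 <= N. Proof. exact: le_trans LN. Qed.
Let N0 : 0 < N. Proof. exact: lt_le_trans N1. Qed.
Let L0 : 0 < L. Proof. exact: lt_le_trans L1. Qed.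
Let p0 : 0 < p. Proof. by apply: lt_trans p_gt; rewrite divr_gt0. Qed.
Let L6 : 1 <= L ^+ 6. Proof. exact: exprn_ege1. Qed.

(** As p N > alpha, the factor p^2 N^3 is at least alpha^2 N. Hence d exceeds any multiple of n for
    large n, as the bounds on the far event require. *)
Lemma dim_ge : alpha ^+ 2 * N * L ^+ 6 <= D.
Proof.
apply: le_trans D_ge.
have -> : p ^+ 2 * N ^+ 3 * (6 * L ^+ 6) = (p * N) ^+ 2 * N * (6 * L ^+ 6) by ring.
have h : alpha ^+ 2 <= (p * N) ^+ 2.
  apply: lerXn2r; rewrite ?nnegrE ?(ltW alpha_gt0) ?mulr_ge0 ?(ltW p0) ?(ltW N0)//.
  by rewrite -ler_pdivrMr// ltW.
apply: ler_pM; rewrite ?mulr_ge0 ?sqr_ge0 ?exprn_ge0 ?(ltW L0) ?(ltW N0) ?ler_wpM2r ?(ltW N0) ?(ltW alpha_gt0)//.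
by have : 0 <= L ^+ 6 := ltW (lt_le_trans ltr01 L6); lra.
Qed.

Let a0 : 0 < alpha ^+ 2. Proof. exact: exprn_gt0. Qed.

Lemma dim_gt0 : 0 < D.
Proof. by apply: lt_le_trans dim_ge; rewrite !mulr_gt0// exprn_gt0. Qed.
Let D0 := dim_gt0.

Let i0 : 0 < L^-1. Proof. by rewrite invr_gt0. Qed.
Let i1 : L^-1 <= 1. Proof. by rewrite invf_le1. Qed.
Let Li : L * L^-1 = 1. Proof. by rewrite mulfV// gt_eqF. Qed.
Let iX k : L^-1 ^+ k.+1 <= L^-1.
Proof. by rewrite exprS ler_piMr ?(ltW i0)// exprn_ile1// ltW. Qed.
Let iN : N^-1 <= L^-1. Proof. by rewrite lef_pV2 ?posrE. Qed.
Let LiX j k : L ^+ j * L^-1 ^+ (j + k) = L^-1 ^+ k.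
Proof. by rewrite exprD mulrA -exprMn Li expr1n mul1r. Qed.

Lemma edges_dim : N ^+ 3 * p ^+ 2 / D <= L^-1 ^+ 6.
Proof.
rewrite ler_pdivrMr// exprVn -ler_pdivrMl ?invrK ?invr_gt0 ?exprn_gt0//.
apply: le_trans D_ge; have : 0 <= L ^+ 6 * (N ^+ 3 * p ^+ 2).
  by rewrite !mulr_ge0 ?exprn_ge0 ?(ltW L0) ?(ltW N0) ?(ltW p0).
lra.
Qed.

Lemma vertices_dim : N / D <= (alpha ^+ 2)^-1 * L^-1 ^+ 6.
Proof.
rewrite ler_pdivrMr// exprVn -invfM mulrC ler_pdivlMr ?mulr_gt0 ?exprn_gt0//.
by apply: le_trans dim_ge; rewrite mulrCA mulrA.
Qed.

Hypothesis D1 : 1 <= D.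

(** The bound N / D <= alpha^-2 L^-6 makes the square root of order L^-3, which absorbs the factor
    L. The constant 24 is 8 times 3, where 3 bounds the square root of 8. *)
Lemma eta_asymptotics k : 0 <= k ->
  9 * ((k * L) ^+ 2 / D) + 8 * (k * L * Num.sqrt (8 * N / D)) <=
  (9 * (k / alpha) ^+ 2 + 24 * (k / alpha)) / L.
Proof.
move=> k0; have v := vertices_dim; set r := k / alpha.
have r0 : 0 <= r by rewrite divr_ge0// ltW.
have rE : k ^+ 2 * (alpha ^+ 2)^-1 = r ^+ 2 by rewrite /r exprMn exprVn.
have key x : x <= (alpha ^+ 2)^-1 * L^-1 ^+ 6 -> (k * L) ^+ 2 * x <= r ^+ 2 * L^-1 ^+ 4.
  move=> hx; apply: (@le_trans _ _ ((k * L) ^+ 2 * ((alpha ^+ 2)^-1 * L^-1 ^+ 6))).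
    by rewrite ler_wpM2l// sqr_ge0.
  by rewrite exprMn mulrACA rE (LiX 2 4).
have h1 : (k * L) ^+ 2 / D <= r ^+ 2 / L.
  apply: le_trans (key _ _) _.
    by apply: le_trans v; rewrite ler_peMl ?invr_ge0 ?(ltW D0).
  by rewrite ler_wpM2l ?sqr_ge0.
have h2 : k * L * Num.sqrt (8 * N / D) <= 3 * r / L.
  rewrite -(@ler_pXn2r _ 2)// ?nnegrE ?mulr_ge0 ?sqrtr_ge0 ?invr_ge0 ?(ltW L0) ?(ltW alpha_gt0)//.
  have q0 : 0 <= N / D by rewrite divr_ge0 ?(ltW N0) ?(ltW D0).
  rewrite exprMn sqr_sqrtr; last by rewrite -mulrA mulr_ge0.
  have := key _ v; set x := N / D; have -> : 8 * N / D = 8 * x by rewrite mulrA.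
  have : r ^+ 2 * L^-1 ^+ 4 <= r ^+ 2 * L^-1 ^+ 2.
    by rewrite ler_wpM2l ?sqr_ge0// ler_wiXn2l// ltW.
  have : 0 <= r ^+ 2 * L^-1 ^+ 2 by rewrite mulr_ge0 ?sqr_ge0.
  have -> : (3 * r / L) ^+ 2 = 9 * (r ^+ 2 * L^-1 ^+ 2) by ring.
  have -> : (k * L) ^+ 2 * (8 * x) = 8 * ((k * L) ^+ 2 * x) by ring.
  move: (_ * x) (_ * _ ^+ 4) (_ * L^-1 ^+ 2) => *; lra.
have -> : (9 * r ^+ 2 + 24 * r) / L = 9 * (r ^+ 2 / L) + 8 * (3 * r / L) by ring.
by rewrite lerD// ler_wpM2l.
Qed.

(** Here the assumption n^3 p^2 << d is used in full: with x = N^3 p^2 / D, the slope term is of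
    order x L^2 and the curvature term of order x L^4 / D. The tail term is of order 1 / (N^3 p^2)
    <= 1 / (alpha^2 N). The factor [N^-1 ^+ 3] is the tail exp (- M / 4) at M = 12 L. *)
Lemma corr_asymptotics c k : 0 <= c ->
  N * (3 * N ^+ 2 * ((18 * c * p * (k * L) ^+ 2 / D) ^+ 2 + (8 * N^-1 ^+ 3 / p) ^+ 2) +
       3 * N ^+ 2 * (16 * c * p * (k * L)) ^+ 2 / D) <=
  (3 * (18 * c * k ^+ 2) ^+ 2 + 3 * (16 * c * k) ^+ 2 + 192 * (alpha ^+ 2)^-1) / L.
Proof.
move=> c0; have ed := edges_dim.
set x := N ^+ 3 * p ^+ 2 / D in ed *.
have x0 : 0 <= x by rewrite divr_ge0 ?mulr_ge0 ?exprn_ge0 ?(ltW N0) ?(ltW p0) ?(ltW D0).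
have h1 : x * (L ^+ 4 / D) <= L^-1.
  apply: (@le_trans _ _ (L^-1 ^+ 6 * L ^+ 4)).
    apply: ler_pM => //.
    - by rewrite divr_ge0 ?exprn_ge0 ?(ltW L0) ?(ltW D0).
    - by rewrite ler_piMr ?exprn_ge0 ?(ltW L0)// invf_le1.
  by rewrite mulrC (LiX 4 2).
have h2 : x * L ^+ 2 <= L^-1.
  apply: (@le_trans _ _ (L^-1 ^+ 6 * L ^+ 2)); first by rewrite ler_wpM2r ?sqr_ge0.
  by rewrite mulrC (LiX 2 4).
have h3 : (N ^+ 3 * p ^+ 2)^-1 <= (alpha ^+ 2)^-1 * L^-1.
  apply: (@le_trans _ _ ((alpha ^+ 2)^-1 * N^-1)); last by rewrite ler_wpM2l ?invr_ge0 ?(ltW a0).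
  rewrite -invfM lef_pV2 ?posrE ?mulr_gt0 ?exprn_gt0//.
  have -> : N ^+ 3 * p ^+ 2 = (p * N) ^+ 2 * N by ring.
  rewrite ler_wpM2r ?(ltW N0)//; apply: lerXn2r.
  - by rewrite nnegrE ltW.
  - by rewrite nnegrE mulr_ge0// ltW.
  - by rewrite -ler_pdivrMr// ltW.
have hN : N ^+ 3 * (N^-1 ^+ 3 / p) ^+ 2 = (N ^+ 3 * p ^+ 2)^-1.
  have Nz : N * N^-1 = 1 by rewrite mulfV// gt_eqF.
  rewrite invfM -!exprVn; move: N^-1 p^-1 Nz => z w Nz.
  have -> : N ^+ 3 * (z ^+ 3 * w) ^+ 2 = (N * z) ^+ 3 * (z ^+ 3 * w ^+ 2) by ring.
  by rewrite Nz expr1n mul1r.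
have -> : N * (3 * N ^+ 2 * ((18 * c * p * (k * L) ^+ 2 / D) ^+ 2 + (8 * N^-1 ^+ 3 / p) ^+ 2) +
       3 * N ^+ 2 * (16 * c * p * (k * L)) ^+ 2 / D) =
   3 * (18 * c * k ^+ 2) ^+ 2 * (x * (L ^+ 4 / D)) + 3 * (16 * c * k) ^+ 2 * (x * L ^+ 2) +
   192 * (N ^+ 3 * p ^+ 2)^-1.
  by rewrite -hN /x; set y := D^-1; set z := N^-1; set w := p^-1; ring.
have s3 (y : R) : 0 <= 3 * y ^+ 2 by apply: mulr_ge0 => //; exact: sqr_ge0.
rewrite [leRHS]mulrDl [in leRHS]mulrDl; apply: lerD; first apply: lerD.
- exact: ler_wpM2l.
- exact: ler_wpM2l.
- by rewrite -[leRHS]mulrA ler_wpM2l.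
Qed.

End asymptotics.

(** After multiplication by n, the two factors n and the factor 2^n are each at most e^n, and e^(-4
    n) outweighs their product. *)
Lemma exp_tail_le (R : realType) (n : nat) : (0 < n)%N ->
  n%:R * (4 * 2 ^+ n * expR (- (4 * n%:R))) <= 4 / n%:R :> R.
Proof.
move=> n0; set N := n%:R : R; have N0 : 0 < N by rewrite ltr0n.
have hN : N <= expR N by apply: le_trans (expR_ge1Dx N); lra.
have h2 : 2 ^+ n <= expR N.
  have -> : expR N = expR 1 ^+ n by rewrite -expRM_natl mulr1.
  apply: lerXn2r; rewrite ?nnegrE ?expR_ge0//.
  by apply: le_trans (expR_ge1Dx 1); lra.
rewrite ler_pdivlMr//.
have -> : N * (4 * 2 ^+ n * expR (- (4 * N))) * N = 4 * (N * 2 ^+ n * N * expR (- (4 * N))) by ring.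
rewrite -[leRHS]mulr1 ler_wpM2l//.
apply: (@le_trans _ _ (expR N * expR N * expR N * expR (- (4 * N)))).
  have p2 : 0 <= 2 ^+ n :> R by exact: exprn_ge0.
  rewrite ler_wpM2r ?expR_ge0//; apply: ler_pM => //; rewrite ?mulr_ge0 ?(ltW N0)//.
  by apply: ler_pM => //; rewrite ltW.
by rewrite -!expRD -[leRHS]expR0 ler_expR; lra.
Qed.

Section tv_const.
Context (R : realType) (alpha : R).
Hypothesis alpha_gt0 : 0 < alpha.

Definition corr_bound : R :=
  3 * (18 * expR 8 * 12 ^+ 2) ^+ 2 + 3 * (16 * expR 8 * 12) ^+ 2 + 192 * (alpha ^+ 2)^-1.
Definition eta_bound : R := expR 8 * (9 * (12 / alpha) ^+ 2 + 24 * (12 / alpha)).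
(** All summands but the last are thresholds for L = ln n: 1 for L >= 1, then one each for d >= 768
    n, n^-6 < p, the bound [ab1] and the bound [eta1]. Together with the 4 of [exp_tail_le] the sum
    also dominates the numerator [corr_bound] + 4 of the final bound. *)
Definition tv_const : R :=
  1 + 64 * 12 * (alpha ^+ 2)^-1 + alpha^-1 + 8 * corr_bound + eta_bound + 4.

Lemma corr_bound_ge0 : 0 <= corr_bound.
Proof.
by rewrite /corr_bound !addr_ge0// mulr_ge0 ?sqr_ge0// invr_ge0 sqr_ge0.
Qed.

Lemma eta_bound_ge0 : 0 <= eta_bound.
Proof.
have h : 0 <= 12 / alpha by rewrite divr_ge0// ltW.
apply: mulr_ge0; first exact: expR_ge0.
by apply: addr_ge0; apply: mulr_ge0 => //; exact: sqr_ge0.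
Qed.

Lemma tv_const_ge :
  [/\ 1 <= tv_const, 64 * 12 * (alpha ^+ 2)^-1 <= tv_const, alpha^-1 <= tv_const,
      8 * corr_bound <= tv_const & eta_bound <= tv_const].
Proof.
have c := corr_bound_ge0; have h := eta_bound_ge0.
have v : 0 < alpha^-1 by rewrite invr_gt0.
have v2 : 0 < (alpha ^+ 2)^-1 by rewrite invr_gt0 exprn_gt0.
rewrite /tv_const; move: corr_bound eta_bound (alpha^-1) (alpha ^+ 2)^-1 c h v v2 => x y z w *.
by split; lra.
Qed.

Lemma dTV_ln_bound (p u : R) (n d : nat) :
  tv_const <= ln n%:R -> alpha / n%:R < p < 1 / 2 ->
  p ^+ 2 * n%:R ^+ 3 * (6 * (ln n%:R) ^+ 6) <= d%:R -> 0 < u ->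
  dTV (@Geo R d n p) (@ER R n p) <= tv_const / (2 * u * ln n%:R) + 2 * u.
Proof.
have a0 := alpha_gt0.
set L := ln n%:R; set N := n%:R : R => cL /andP[p_gt p_lt] D_ge u0.
have c0 : 0 < expR 8 :> R by exact: expR_gt0.
have [/le_trans/(_ cL) L1 /le_trans/(_ cL) LA /le_trans/(_ cL) LB /le_trans/(_ cL) LC
  /le_trans/(_ cL) LD] := tv_const_ge.
have L0 : 0 < L by lra.
have n0 : (0 < n)%N.
  by case: (posnP n) => // nE; move: L1; rewrite /L nE ln0// ler10.
have N0 : 0 < N by rewrite ltr0n.
have N1 : 1 <= N by rewrite ler1n.
have eL : expR L = N by rewrite lnK// posrE.
have LN : L <= N by rewrite -eL; apply: le_trans (expR_ge1Dx L); lra.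
have p0 : 0 < p by apply: lt_trans p_gt; rewrite divr_gt0.
have dg := dim_ge a0 L1 LN p_gt D_ge.
have sq0 : 0 < alpha ^+ 2 by exact: exprn_gt0.
have LXL : L <= L ^+ 6 by rewrite exprS ler_peMr ?(ltW L0)// exprn_ege1.
have Da x : x * (alpha ^+ 2)^-1 <= L -> x * N <= d%:R.
  rewrite ler_pdivrMr// => h.
  apply: le_trans dg; rewrite mulrAC ler_wpM2r ?(ltW N0)//.
  by apply: (le_trans h); rewrite mulrC ler_wpM2l// ltW.
(* This single inequality yields 64 M <= d, as M = 12 L and L <= N, and also 512 n <= d and d >
   2. *)
have D768 : 64 * 12 * N <= d%:R by exact: Da.
have : (2 < d)%N by rewrite -(ltr_nat R); lra.
case: d D_ge dg Da D768 => [|[|[|m]]]// D_ge dg Da D768 _.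
have D1 : 1 <= m.+3%:R :> R by rewrite ler1n.
have D0 : 0 < m.+3%:R :> R by rewrite ltr0n.
have ph : 0 < p < 2^-1 by rewrite p0/=; lra.
(* The choice M = 12 L makes expR (- (M / 2)) = n^-6, which is less than p. *)
have EM : expR (- (12 * L / 4)) = N^-1 ^+ 3.
  by rewrite exprVn -eL -expRM_natl -expRN; congr expR; lra.
have Mp : expR (- (12 * L / 2)) < p.
  apply: le_lt_trans p_gt; rewrite ler_pdivlMr// -[X in _ * X]eL -expRD.
  apply: (@le_trans _ _ (expR (- L))); first by rewrite ler_expR; lra.
  by rewrite expRN eL -[leRHS]invrK lef_pV2 ?posrE ?invr_gt0//; exact: le_trans LN.
have eta1 : expR 8 * (9 * ((12 * L) ^+ 2 / m.+3%:R) +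
    8 * (12 * L * Num.sqrt (8 * N / m.+3%:R))) <= 1.
  apply: (@le_trans _ _ (eta_bound / L)); last by rewrite ler_pdivrMr// mul1r.
  rewrite /eta_bound -[leRHS]mulrA ler_wpM2l ?(ltW c0)//.
  exact: (eta_asymptotics a0 L1 LN p_gt D_ge).
have cs := corr_asymptotics a0 L1 LN p_gt D_ge D1 12 (ltW c0).
have ccE : corr_const m.+1 n p (12 * L) = 3 * N ^+ 2 *
  ((18 * expR 8 * p * (12 * L) ^+ 2 / m.+3%:R) ^+ 2 + (8 * N^-1 ^+ 3 / p) ^+ 2).
  by rewrite /corr_const EM.
rewrite -ccE -/(corr_slope n p (12 * L)) -/corr_bound in cs.
set cc := corr_const m.+1 n p (12 * L) in cs.
set sl := corr_slope n p (12 * L) in cs.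
have cc0 : 0 <= cc.
  by rewrite /cc /corr_const mulr_ge0 ?addr_ge0 ?sqr_ge0// mulr_ge0 ?sqr_ge0.
have sc0 : 0 <= sl.
  by rewrite /sl /corr_slope mulr_ge0 ?sqr_ge0// mulr_ge0 ?sqr_ge0.
have ab1 : cc + sl * (8 * N / m.+3%:R) <= 1.
  apply: (@le_trans _ _ (8 * (N * (cc + sl / m.+3%:R)))).
    have -> : 8 * (N * (cc + sl / m.+3%:R)) = 8 * N * cc + sl * (8 * N / m.+3%:R) by ring.
    by rewrite lerD2r ler_peMl//; lra.
  apply: (@le_trans _ _ (8 * (corr_bound / L))); first by rewrite ler_wpM2l.
  by rewrite mulrA ler_pdivrMr// mul1r.
have M1 : 1 <= 12 * L by lra.
have Md : 64 * (12 * L) <= m.+3%:R by apply: le_trans D768; rewrite mulrA ler_wpM2l.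
have nd : 512 * N <= m.+3%:R by apply: le_trans D768; rewrite ler_wpM2r ?(ltW N0)//; lra.
apply: le_trans (@dTV_finite R m.+1 n p (12 * L) isT ph M1 Md Mp nd eta1 ab1 u u0) _.
rewrite lerD2r -/N -/cc -/sl.
have -> : tv_const / (2 * u * L) = (tv_const / L) / (2 * u).
  by rewrite invfM mulrA mulrAC.
rewrite ler_wpM2r ?invr_ge0 ?mulr_ge0 ?(ltW u0)// mulrDr.
apply: (le_trans (lerD cs (exp_tail_le R n0))).
apply: (@le_trans _ _ (corr_bound / L + 4 / L)).
  by rewrite lerD2l ler_wpM2l// lef_pV2 ?posrE.
rewrite -mulrDl ler_wpM2r ?invr_ge0 ?(ltW L0)//.
have c := corr_bound_ge0; have h := eta_bound_ge0.
have v : 0 < alpha^-1 by rewrite invr_gt0.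
have v2 : 0 < (alpha ^+ 2)^-1 by rewrite invr_gt0.
rewrite /tv_const; move: corr_bound eta_bound (alpha^-1) (alpha ^+ 2)^-1 c h v v2 => x y z w *.
lra.
Qed.

End tv_const.

Theorem theorem1p2 (R : realType) (alpha : R) (alpha_gt0 : 0 < alpha) :
  exists2 C : R, 0 < C &
    forall (p : nat -> R) (d : nat -> nat),
      (\forall n \near \oo, alpha / n%:R < p n < 1 / 2) ->
      (\forall n \near \oo,
        p n ^+ 2 * n%:R ^+ 3 * (C * (ln n%:R) `^ C) <= (d n)%:R) ->
      dTV (@Geo R (d n) n (p n)) (@ER R n (p n)) @[n --> \oo] --> (0 : R).
Proof.
(* The same constant is both factor and exponent. The curvature term of [corr_asymptotics], bounded
   there with D >= 1 alone, takes five powers of the logarithm. *)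
exists 6 => // p d hp hd.
apply/cvgrPdist_le => e e0; near=> n.
have e4 : 0 < e / 4 by rewrite divr_gt0.
(* For u = e / 4 the term 2 u is e / 2, and the other term is at most e / 2 as soon as ln n >= 4
   [tv_const alpha] / e^2. *)
have Lbig : tv_const alpha + tv_const alpha * (4 / e ^+ 2) <= ln n%:R.
  rewrite -ler_expR lnK; last by near: n; exists 1%N => // n /= n1; rewrite posrE ltr0n.
  by near: n; exact: nbhs_infty_ger.
have c0 : 0 < tv_const alpha by have [h _ _ _ _] := tv_const_ge alpha_gt0; apply: lt_le_trans h.
have s0 : 0 < tv_const alpha * (4 / e ^+ 2) by rewrite mulr_gt0// divr_gt0// exprn_gt0.
have L1 : tv_const alpha <= ln n%:R by lra.
have L2 : tv_const alpha * (4 / e ^+ 2) <= ln n%:R by lra.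
have L0 : 0 < ln n%:R :> R by lra.
have hpn : alpha / n%:R < p n < 1 / 2 by near: n.
have hdn : p n ^+ 2 * n%:R ^+ 3 * (6 * (ln n%:R) ^+ 6) <= (d n)%:R.
  have : p n ^+ 2 * n%:R ^+ 3 * (6 * (ln n%:R) `^ 6) <= (d n)%:R by near: n.
  by rewrite powR_mulrn ?(ltW L0).
have b := dTV_ln_bound alpha_gt0 L1 hpn hdn e4.
rewrite sub0r normrN ger0_norm; last by rewrite /dTV; exact: bigmax_ge_id.
apply: (le_trans b).
have : tv_const alpha / (2 * (e / 4) * ln n%:R) <= e / 2.
  rewrite ler_pdivrMr ?mulr_gt0//.
  have -> : tv_const alpha = e / 2 * (2 * (e / 4) * (tv_const alpha * (4 / e ^+ 2))).
    by field; rewrite ?gt_eqF.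
  rewrite ler_wpM2l ?divr_ge0 ?(ltW e0)// ler_wpM2l// mulr_ge0// ltW//.
lra.
Unshelve. all: by end_near.
Qed.
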